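(* Let $n\ge 3$, let $\Omega\subset\mathbb{R}^n$ be a bounded domain containing the origin, let $p>1$ and $a\in\mathbb{R}$. Then the system of inequalities $$ \begin{cases} -\Delta u\ge \lambda_1|x|^a v^{p-1}\\ -\Delta v\ge \lambda_2|x|^a u^{p-1} \end{cases} $$ has a nontrivial and nonnegative distributional solution $u,v$ on $\Omega\setminus\{0\}$ (for some $\lambda_1,\lambda_2>0$) if and only if one of the following conditions is satisfied: (i) $p>2$ and $a>-2$; (ii) $p=2$ and $a\ge -2$; (iii) $1<p<2$, $a>-n$ and $p<p_a:=\dfrac{2(n-1)+a}{n-2}$.
   Context: A nontrivial and nonnegative distributional solution of the system on $\Omega\setminus\{0\}$ is a pair $u,v$ of nonnegative functions, not both almost everywhere zero, with $u,v\in L^1_{\rm loc}(\Omega\setminus\{0\})$ and $u^{p-1},v^{p-1}\in L^1_{\rm loc}(\Omega\setminus\{0\})$, for which there exist $\lambda_1,\lambda_2>0$ such that both inequalities of the system hold in the sense of distributions on $\Omega\setminus\{0\}$. (The constants $\lambda_1,\lambda_2$ are not prescribed; they are part of the solution.) *)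

(* Defs.v *)
(* R^n is 'rV[R]_n; its library topology, induced by the sup norm, is the Euclidean
   one. *)
From HB Require Import structures.
From mathcomp Require Import all_boot all_order all_algebra.
From mathcomp Require Import all_classical all_reals all_analysis.

Set Implicit Arguments.
Unset Strict Implicit.
Unset Printing Implicit Defensive.
Import Order.TTheory GRing.Theory Num.Theory.
Import numFieldNormedType.Exports.
Local Open Scope classical_set_scope.
Local Open Scope ring_scope.

Definition rV_display : measure_display. Proof. exact. Qed.

(* The sigma-algebra on R^n generated by the coordinate maps; since R is second
   countable this is the Borel sigma-algebra of R^n. *)
Section measurable_rV.
Context {R : realType} {n : nat}.

Let coors (i : 'I_n) (x : 'rV[R]_n) : measurableTypeR R := x ord0 i.

Let rV_set0 : g_sigma_preimage coors set0.
Proof. exact: sigma_algebra0. Qed.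

Let rV_setC A : g_sigma_preimage coors A -> g_sigma_preimage coors (~` A).
Proof. exact: sigma_algebraC. Qed.

Let rV_bigcup (F : (set 'rV[R]_n)^nat) :
  (forall i, g_sigma_preimage coors (F i)) ->
  g_sigma_preimage coors (\bigcup_i (F i)).
Proof. exact: sigma_algebra_bigcup. Qed.

HB.instance Definition _ := @isMeasurable.Build rV_display 'rV[R]_n
  (g_sigma_preimage coors) rV_set0 rV_setC rV_bigcup.

Lemma measurable_coord (i : 'I_n) :
  measurable_fun [set: 'rV[R]_n]
    (fun x : 'rV[R]_n => x ord0 i : measurableTypeR R).
Proof.
move=> _ Y mY; rewrite setTI; apply: sub_sigma_algebra => /=.
rewrite -bigcup_seq/=; exists i => /=; first by rewrite mem_index_enum.
by exists Y => //; rewrite setTI.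
Qed.

Lemma measurable_box (A : 'I_n -> set (measurableTypeR R)) :
  (forall i, measurable (A i)) ->
  measurable [set x : 'rV[R]_n | forall i, A i (x ord0 i)].
Proof.
move=> mA.
rewrite (_ : [set _ | _] = \bigcap_(i in [set: 'I_n])
    ((fun x : 'rV[R]_n => x ord0 i : measurableTypeR R) @^-1` A i)); last first.
  by apply/seteqP; split=> x /= Ax i => [_|]; exact: Ax.
apply: fin_bigcap_measurable => // i _.
by rewrite -[X in measurable X]setTI; exact: measurable_coord.
Qed.

Lemma measurable_fun_rV d (T : measurableType d) (f : T -> 'rV[R]_n) :
  (forall i, measurable_fun [set: T]
    (fun t => f t ord0 i : measurableTypeR R)) ->
  measurable_fun [set: T] f.
Proof.
move=> mf _ A mA; rewrite setTI.
suff : preimage_set_system setT f measurable `<=` measurable.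
  by move=> /(_ (f @^-1` A)); apply; exists A => //; rewrite setTI.
rewrite -[X in preimage_set_system _ _ X]/(<<s _ >>) -g_sigma_preimageE.
apply: smallest_sub; first exact: sigma_algebra_measurable.
move=> _ [B /= + <-]; rewrite -bigcup_seq/= => -[i _ [C mC <-]].
by rewrite !setTI -[X in measurable X]setTI; exact: (mf i).
Qed.

End measurable_rV.

Section lebesgue_rV.
Context {R : realType}.
Local Open Scope ereal_scope.

Definition rV_cons n (p : measurableTypeR R * 'rV[R]_n) : 'rV[R]_n.+1 :=
  \row_i oapp (p.2 ord0) p.1 (unlift ord0 i).

Lemma measurable_rV_cons n : measurable_fun [set: _] (@rV_cons n).
Proof.
apply: measurable_fun_rV => i.
case: (unliftP ord0 i) => [j ->|->].
  rewrite (_ : (fun _ => _) = (fun x : 'rV[R]_n => x ord0 j) \o snd); last first.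
    by apply/funext => p /=; rewrite mxE liftK.
  by apply: measurableT_comp => //; exact: measurable_coord.
rewrite (_ : (fun _ => _) = fst)//.
by apply/funext => p /=; rewrite mxE unlift_none.
Qed.

Section lebesgue_cons.
Variables (n : nat) (nu : {sigma_finite_measure set 'rV[R]_n -> \bar R}).

Definition lebesgue_cons : set 'rV[R]_n.+1 -> \bar R :=
  pushforward (lebesgue_measure \x nu) (@rV_cons n).

Let lebesgue_cons0 : lebesgue_cons set0 = 0.
Proof. by rewrite /lebesgue_cons /pushforward preimage_set0 measure0. Qed.

Let lebesgue_cons_ge0 A : 0 <= lebesgue_cons A.
Proof. by rewrite /lebesgue_cons /pushforward; exact: measure_ge0. Qed.

Let measurable_preimage A : measurable A -> measurable (@rV_cons n @^-1` A).
Proof.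
by move=> mA; rewrite -[X in measurable X]setTI; exact: measurable_rV_cons.
Qed.

Let lebesgue_cons_sigma_additive : semi_sigma_additive lebesgue_cons.
Proof.
move=> F mF tF mUF; rewrite /lebesgue_cons /pushforward preimage_bigcup.
apply: measure_semi_sigma_additive.
- by move=> k; exact: measurable_preimage.
- apply/trivIsetP => /= i j _ _ ij; rewrite -preimage_setI.
  by move/trivIsetP : tF => /(_ _ _ _ _ ij) ->//; rewrite preimage_set0.
- by rewrite -preimage_bigcup; exact: measurable_preimage.
Qed.

HB.instance Definition _ := isMeasure.Build _ _ _ lebesgue_cons
  lebesgue_cons0 lebesgue_cons_ge0 lebesgue_cons_sigma_additive.

Lemma lebesgue_cons_box (A : set (measurableTypeR R)) (B : set 'rV[R]_n) :
  measurable A -> measurable B ->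
  lebesgue_cons [set x | A (x ord0 ord0) /\ B (\row_j x ord0 (lift ord0 j))] =
  lebesgue_measure A * nu B.
Proof.
move=> mA mB; rewrite -product_measure1E// /lebesgue_cons /pushforward.
congr product_measure1; apply/seteqP.
have E (p : measurableTypeR R * 'rV[R]_n) :
    (\row_j rV_cons p ord0 (lift ord0 j) = p.2)%R.
  by apply/rowP => j; rewrite !mxE liftK.
by split=> p /=; rewrite E mxE unlift_none/=.
Qed.

Let lebesgue_cons_sigma_finite : sigma_finite setT lebesgue_cons.
Proof.
have /sigma_finiteP[F [TF ndF Foo]] := sigma_finiteT (@lebesgue_measure R).
have /sigma_finiteP[G [TG ndG Goo]] := sigma_finiteT nu.
pose tl (x : 'rV[R]_n.+1) : 'rV[R]_n := (\row_j x ord0 (lift ord0 j))%R.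
exists (fun k => [set x : 'rV[R]_n.+1 | F k (x ord0 ord0) /\ G k (tl x)]).
  apply/esym; rewrite -subTset => x _.
  have [k _ Fk] : (\bigcup_k F k) (x ord0 ord0) by rewrite -TF.
  have [l _ Gl] : (\bigcup_k G k) (tl x) by rewrite -TG.
  exists (maxn k l) => //; split.
  - by move: Fk; exact/subsetPset/ndF/leq_maxl.
  - by move: Gl; exact/subsetPset/ndG/leq_maxr.
move=> k; have [mF Fk] := Foo k; have [mG Gk] := Goo k; split; last first.
  by rewrite lebesgue_cons_box// lte_mul_pinfty// ge0_fin_numE.
apply: measurableI.
  by rewrite -[X in measurable X]setTI; exact: measurable_coord.
rewrite -[X in measurable X]setTI.
suff : measurable_fun [set: 'rV[R]_n.+1] tl by apply.
apply: measurable_fun_rV => i.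
rewrite (_ : (fun _ => _) =
  (fun x : 'rV[R]_n.+1 => x ord0 (lift ord0 i) : measurableTypeR R)).
  exact: measurable_coord.
by apply/funext => x; rewrite mxE.
Qed.

HB.instance Definition _ := Measure_isSigmaFinite.Build _ _ _ lebesgue_cons
  lebesgue_cons_sigma_finite.

End lebesgue_cons.

Fixpoint lebesgue_rV n : {sigma_finite_measure set 'rV[R]_n -> \bar R} :=
  match n with
  | 0%N => dirac (0%R : 'rV[R]_0)
  | m.+1 => lebesgue_cons (lebesgue_rV m)
  end.

Lemma lebesgue_rV_box n (A : 'I_n -> set (measurableTypeR R)) :
  (forall i, measurable (A i)) ->
  lebesgue_rV n [set x | forall i, A i (x ord0 i)] =
  \prod_(i < n) lebesgue_measure (A i).
Proof.
elim: n A => [|n IH] A mA /=.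
  by rewrite big_ord0 diracE mem_set// => -[].
rewrite big_ord_recl -IH => [|i]; last exact: mA.
rewrite -lebesgue_cons_box//; last first.
  exact: (@measurable_box _ _ (A \o lift ord0) (fun i => mA _)).
congr (lebesgue_cons _ _); apply/seteqP; split=> x /= Ax.
  by split=> // i; rewrite mxE.
move=> i; case: (unliftP ord0 i) => [j ->|-> //]; last exact: Ax.1.
by have := Ax.2 j; rewrite mxE.
Qed.

End lebesgue_rV.

Section distributions.
Context {R : realType} {n : nat}.
Implicit Types (D : set 'rV[R]_n) (f g u v phi : 'rV[R]_n -> R).

(* The norm `|x| of 'rV[R]_n is the sup norm. *)
Definition enorm (x : 'rV[R]_n) : R := Num.sqrt (\sum_(i < n) x ord0 i ^+ 2).

Definition partial (i : 'I_n) f : 'rV[R]_n -> R :=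
  fun x => 'D_(delta_mx ord0 i) f x.

Definition iter_partial (s : seq 'I_n) f : 'rV[R]_n -> R := foldr partial f s.

Definition laplacian f : 'rV[R]_n -> R :=
  fun x => \sum_(i < n) partial i (partial i f) x.

Definition smooth f := forall s : seq 'I_n,
  continuous (iter_partial s f) /\
  forall (i : 'I_n) x, derivable (iter_partial s f) x (delta_mx ord0 i).

Definition test_function D phi := [/\ smooth phi,
  compact (closure [set x | phi x != 0]) & closure [set x | phi x != 0] `<=` D].

(* The analogue on R^n of the library's locally_integrable, which is stated for
   functions of one real variable. *)
Definition locally_integrable_rV D f := [/\ measurable_fun D f, open D &
  forall K, K `<=` D -> compact K ->
    (\int[lebesgue_rV n]_(x in K) `|f x|%:E < +oo)%E].

(* -Delta u >= f in the sense of distributions on D. *)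
Definition distr_nlaplacian_ge D u f :=
  forall phi, test_function D phi -> (forall x, 0 <= phi x) ->
    (\int[lebesgue_rV n]_(x in D) (f x * phi x)%:E <=
     \int[lebesgue_rV n]_(x in D) (u x * - laplacian phi x)%:E)%E.

(* u and v are only relevant on D, that is, on Omega minus the origin. *)
Definition distr_solution (Omega : set 'rV[R]_n) (p a : R) u v :=
  let D := Omega `\ 0 in
  [/\ (forall x, D x -> 0 <= u x) /\ (forall x, D x -> 0 <= v x),
      ~ ({ae lebesgue_rV n, forall x, D x -> u x = 0} /\
         {ae lebesgue_rV n, forall x, D x -> v x = 0}),
      locally_integrable_rV D u /\ locally_integrable_rV D v,
      locally_integrable_rV D (fun x => u x `^ (p - 1)) /\
      locally_integrable_rV D (fun x => v x `^ (p - 1)) &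
      exists lambda1 lambda2 : R, [/\ 0 < lambda1, 0 < lambda2,
        distr_nlaplacian_ge D u
          (fun x => lambda1 * enorm x `^ a * v x `^ (p - 1)) &
        distr_nlaplacian_ge D v
          (fun x => lambda2 * enorm x `^ a * u x `^ (p - 1))]].

End distributions.

Definition critical_exponent {R : realType} (n : nat) (a : R) : R :=
  (2 * (n%:R - 1) + a) / (n%:R - 2).

(* Main.v *)
(* Existence is explicit: with s = |x|^2, take u = v = C - s^(a/2+1) when a > -2 and
   u = v = s^(-sigma) with a suitable 0 < sigma < (n-2)/2 otherwise.

   For nonexistence, smooth compactly supported weights replace spherical means, so that
   only the weak inequalities are used.  In the variable t = - ln |x|^2 the weighted means
   U, V of u, v over the annuli |x|^2 ~ e^(-t) satisfy
     U'' - (n-2)/2 U' <= - c e^(-(a+2)t/2) M(v^(p-1)),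
   and symmetrically, M denoting the same mean.  A weak Harnack inequality for nonnegative
   distributional superharmonic functions, applied on finitely many balls covering an
   annulus, gives M(v^(p-1)) >= c V^(p-1) (no convexity is available when p < 2).
   Hence S = U + V satisfies S'' - k S' <= - c e^(-bt) S^q, which forces S = 0 for large t
   outside the three listed cases.  So u and v vanish near 0, and the Harnack
   inequality propagates their vanishing through the connected set Omega. *)
Require Import Defs.
From mathcomp Require Import all_boot all_order all_algebra.
From mathcomp Require Import all_classical all_reals all_analysis.
From mathcomp Require Import measurable_realfun.
From mathcomp Require Import ring lra.

Set Implicit Arguments.
Unset Strict Implicit.
Unset Printing Implicit Defensive.
Import Order.TTheory GRing.Theory Num.Theory.
Import numFieldNormedType.Exports.
Local Open Scope classical_set_scope.
Local Open Scope ring_scope.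

(** * The differential inequality for radial means *)
Section ode.
Context {R : realType}.
Implicit Types (f df : R -> R) (x y a : R).

(** The homogeneous equation [S'' - k S' = 0], with [k = (n-2)/2], has the solutions 1 and
    [exp (k t)], the images of the constant and of |x|^(2-n). Put [q = p - 1] and [b = (a+2)/2]. For
    [q < 1] the threshold is where the source [exp (-b t) S^q] of the fastest solution
    [S = exp (k t)] has the same rate as [S] itself: [b + k (1-q) = 0], which is [p = p_a]. For
    [q >= 1] it is where the source stops decaying for constant [S]: [b = 0], that is, [a = -2]. The
    obstacle is that [u] and [v] are merely integrable on compact sets that avoid the origin. The
    weights are dilates of a fixed profile, so differentiating a mean in [t] only changes the
    profile and never touches [u]. Two profiles are needed: a ball-shaped one around centres away
    from 0, whose means are monotone, and a ring-shaped one around 0, where nothing is known at the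
    centre. Pointwise information enters only almost everywhere, through a compact subset of
    positive measure of the set where a bound fails; this is why inner regularity of Lebesgue
    measure is established. *)

Lemma is_derive_continuous f df x : is_derive x 1 f (df x) -> {for x, continuous f}.
Proof.
move=> dfx; apply: differentiable_continuous; apply/derivable1_diffP.
exact: (@ex_derive _ _ _ _ _ _ _ dfx).
Qed.

Lemma MVT_ray f df a x y : (forall t, a < t -> is_derive t 1 f (df t)) ->
  a < x -> x <= y -> exists2 c, x <= c <= y & f y - f x = df c * (y - x).
Proof.
move=> dft ax xy; have [c] : exists2 c, c \in `[x, y]%R & f y - f x = df c * (y - x).
  apply: MVT_segment => //.
    by move=> z; rewrite in_itv/= => /andP[xz _]; apply: dft; exact: lt_trans xz.
  apply: continuous_in_subspaceT => z; rewrite inE/= in_itv/= => /andP[xz _].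
  by apply: (@is_derive_continuous _ df); apply: dft; exact: lt_le_trans xz.
by rewrite in_itv/=; exists c.
Qed.

Lemma nondecreasing_ray f df a x y :
  (forall t, a < t -> is_derive t 1 f (df t)) ->
  (forall t, a < t -> 0 <= df t) -> a < x -> x <= y -> f x <= f y.
Proof.
move=> dft df0 ax xy; have [c /andP[xc cy] e] := MVT_ray dft ax xy.
by rewrite -subr_ge0 e mulr_ge0 ?subr_ge0// df0//; exact: lt_le_trans xc.
Qed.

Lemma is_derive_expM a x : is_derive x 1 (fun t => expR (a * t)) (a * expR (a * x)).
Proof.
have h : is_derive x 1 (fun t : R => a * t) (a *: 1) by apply: is_deriveZ.
have := @is_derive1_comp R expR ( *%R a) x _ _ (is_derive_expR _) h.
rewrite /= => h2; apply: (is_derive_eq h2).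
by rewrite /GRing.scale /=; ring.
Qed.

Section radial_mean.
Variables (S S1 S2 : R -> R) (t0 k b q c : R).
Hypothesis dS : forall t, t0 < t -> is_derive t 1 S (S1 t).
Hypothesis dS1 : forall t, t0 < t -> is_derive t 1 S1 (S2 t).
Hypotheses (k0 : 0 < k) (q0 : 0 < q) (c0 : 0 < c).
Hypothesis S_ge0 : forall t, t0 < t -> 0 <= S t.
Hypothesis S_ode : forall t, t0 < t ->
  S2 t - k * S1 t <= - (c * expR (- b * t) * S t `^ q).

Let W t := expR (- k * t) * S1 t.
Let W' t := expR (- k * t) * (S2 t - k * S1 t).

Let dW t : t0 < t -> is_derive t 1 W (W' t).
Proof.
move=> t0t; have h := is_deriveM (is_derive_expM (- k) t) (dS1 t0t).
apply: (is_derive_eq h); rewrite /W' /GRing.scale /=; ring.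
Qed.

Let W'_le t : t0 < t -> W' t <= - (c * expR (- (k + b) * t) * S t `^ q).
Proof.
move=> /S_ode h; rewrite /W' (_ : - (k + b) * t = - k * t + - b * t); last ring.
rewrite expRD.
apply: (le_trans (ler_wpM2l (expR_ge0 _) h)).
by lra.
Qed.

Let rhs_ge0 t : 0 <= c * expR (- (k + b) * t) * S t `^ q.
Proof. by rewrite !mulr_ge0 ?expR_ge0 ?powR_ge0// ltW. Qed.

Let W_nincr x y : t0 < x -> x <= y -> W y <= W x.
Proof.
move=> t0x xy; rewrite -lerN2.
apply: (@nondecreasing_ray (fun t => - W t) (fun t => - W' t) t0 x y _ _ t0x xy) => t t0t.
- by apply: is_deriveN; exact: dW.
- by rewrite oppr_ge0 (le_trans (W'_le t0t))// oppr_le0.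
Qed.

Let S1W t : S1 t = expR (k * t) * W t.
Proof.
by rewrite /W mulrA -expRD (_ : k * t + - k * t = 0) ?expR0 ?mul1r//; ring.
Qed.

(** If [S1 t < 0], then [W] stays below [W t < 0] and the factor [expR (k * x)] only amplifies this,
    so [S] lies below a line of negative slope and ends up negative. *)
Let S1_ge0 t : t0 < t -> 0 <= S1 t.
Proof.
move=> t0t; rewrite leNgt; apply/negP => St0.
have Wt : W t < 0 by rewrite /W pmulr_rlt0// expR_gt0.
have S1le x : t <= x -> S1 x <= S1 t.
  move=> tx; rewrite !S1W; have Wx := W_nincr t0t tx.
  apply: (@le_trans _ _ (expR (k * x) * W t)); first by rewrite ler_pM2l ?expR_gt0.
  by rewrite ler_nM2r// ler_expR ler_pM2l.
(* The line through [(t, S t)] of slope [S1 t] takes the value -1 at [y]. *)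
pose y := t - (S t + 1) / S1 t.
have ty : t <= y.
  by rewrite /y lerBrDl gerDr mulr_ge0_le0// ?addr_ge0 ?S_ge0// invr_le0 ltW.
have [e /andP[te ey] eq] := MVT_ray dS t0t ty.
have /S_ge0 Sy : t0 < y by exact: lt_le_trans ty.
have : S y - S t <= S1 t * (y - t).
  by rewrite eq; apply: ler_wpM2r; rewrite ?subr_ge0//; exact: S1le.
have -> : S1 t * (y - t) = - (S t + 1) by rewrite /y; field; rewrite lt_eqF.
by lra.
Qed.

Let S_ndecr x y : t0 < x -> x <= y -> S x <= S y.
Proof. exact: nondecreasing_ray dS S1_ge0. Qed.

Let W_ge t : t0 < t -> c * expR (- `|k + b|) * expR (- (k + b) * t) * S t `^ q <= W t.
Proof.
move=> t0t; have t1 : t <= t + 1 by rewrite lerDl.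
have [e /andP[te et] eq] := MVT_ray dW t0t t1.
have t0e : t0 < e by exact: lt_le_trans te.
have W1 : 0 <= W (t + 1).
  by rewrite mulr_ge0 ?expR_ge0// S1_ge0// (lt_le_trans t0t).
have := W'_le t0e.
have -> : W' e = W (t + 1) - W t by rewrite eq; ring.
suff : c * expR (- `|k + b|) * expR (- (k + b) * t) * S t `^ q <=
  c * expR (- (k + b) * e) * S e `^ q by lra.
rewrite -mulrA -[leRHS]mulrA -mulrA ler_pM2l// mulrA -expRD.
apply: ler_pM; rewrite ?expR_ge0 ?powR_ge0//; last first.
  by apply: ge0_ler_powR; rewrite ?nnegrE ?S_ge0 ?(ltW q0)// S_ndecr.
rewrite ler_expR; have := ler_norm (k + b); have := lerNnormlW (lexx `|k + b|).
by nra.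
Qed.

Let c' := c * expR (- `|k + b|).

Let c'0 : 0 < c'. Proof. by rewrite mulr_gt0 ?expR_gt0. Qed.

Let S1_ge t : t0 < t -> c' * expR (- b * t) * S t `^ q <= S1 t.
Proof.
move=> t0t; rewrite S1W.
apply: (le_trans _ (ler_wpM2l (expR_ge0 _) (W_ge t0t))).
rewrite (_ : - b * t = k * t + - (k + b) * t); last ring.
by rewrite expRD /c'; lra.
Qed.

(** Otherwise the slope of [W] stays below [- (c * d)], and the nonnegative [W] would be at most -1
    at the point [y]. *)
Let not_eventually_ge d T : 0 < d -> t0 < T ->
  ~ (forall t, T <= t -> d <= expR (- (k + b) * t) * S t `^ q).
Proof.
move=> d0 t0T hd.
have WT : 0 <= W T by rewrite mulr_ge0 ?expR_ge0 ?S1_ge0.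
pose y := T + (W T + 1) / (c * d).
have Ty : T <= y by rewrite /y lerDl divr_ge0// ?addr_ge0// mulr_ge0// ltW.
have [e /andP[Te ey] eq] := MVT_ray dW t0T Ty.
have t0e : t0 < e by exact: lt_le_trans Te.
have Wy : 0 <= W y by rewrite mulr_ge0 ?expR_ge0// S1_ge0// (lt_le_trans t0T).
have h : W' e <= - (c * d).
  apply: (le_trans (W'_le t0e)); rewrite lerN2 -mulrA ler_pM2l//; exact: hd.
have : W y - W T <= - (c * d) * (y - T).
  by rewrite eq ler_wpM2r// subr_ge0.
have -> : - (c * d) * (y - T) = - (W T + 1).
  by rewrite /y; field; rewrite !gt_eqF.
by lra.
Qed.

(** Such growth gives [S >= s exp ((k+1) t)]. Once [S >= 1] and [t >= 0], the quantity of
    [not_eventually_ge] is at least [exp (-k t) S >= s exp t >= s]. *)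
Let not_exp_growth T : b <= 0 -> 1 <= q -> t0 < T -> 0 < S T ->
  ~ (forall t, T <= t -> (k + 1) * S t <= S1 t).
Proof.
move=> b0 q1 t0T ST growth.
pose Z t := expR (- (k + 1) * t) * S t.
have dZ t : T < t -> is_derive t 1 Z (expR (- (k + 1) * t) * (S1 t - (k + 1) * S t)).
  move=> Tt; have t0t := lt_trans t0T Tt.
  have h := is_deriveM (is_derive_expM (- (k + 1)) t) (dS t0t).
  by apply: (is_derive_eq h); rewrite /GRing.scale /=; ring.
pose s := Z (T + 1).
have T1 : T < T + 1 by rewrite ltrDl.
have s0 : 0 < s.
  by rewrite mulr_gt0 ?expR_gt0// (lt_le_trans ST)// S_ndecr// ltW.
have Sge t : T + 1 <= t -> s * expR ((k + 1) * t) <= S t.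
  move=> Tt; have : s <= Z t.
    apply: (@nondecreasing_ray Z (fun t => expR (- (k + 1) * t) * (S1 t - (k + 1) * S t)) T) => //.
    by move=> x Tx; rewrite mulr_ge0 ?expR_ge0// subr_ge0 growth// ltW.
  move=> /(ler_wpM2r (expR_ge0 ((k + 1) * t)))/le_trans; apply.
  rewrite /Z mulrAC -expRD (_ : - (k + 1) * t + (k + 1) * t = 0) ?expR0 ?mul1r//; ring.
(* From [s^-1 <= t] and [0 <= t] follows [1 <= s * (1 + (k + 1) * t) <= S t]. *)
pose T' := Num.max (T + 1) (Num.max 0 s^-1).
apply: (@not_eventually_ge s T') => //.
  by rewrite /T' !lt_max (lt_trans t0T T1).
move=> t; rewrite /T' !ge_max => /andP[Tt /andP[t_ge0 st]].
have Se := Sge _ Tt.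
have S_ge1 : 1 <= S t.
  apply: le_trans Se; rewrite -ler_pdivrMl// mulr1 (le_trans st)//.
  apply: le_trans (expR_ge1Dx _); have := mulr_ge0 (ltW k0) t_ge0; lra.
apply: (@le_trans _ _ (expR (- k * t) * S t)); last first.
  apply: ler_pM; rewrite ?expR_ge0 ?(le_trans _ S_ge1)//.
    by rewrite ler_expR; nra.
  exact: le1r_powR.
apply: (@le_trans _ _ (expR (- k * t) * (s * expR ((k + 1) * t)))); last first.
  by rewrite ler_wpM2l ?expR_ge0.
rewrite mulrCA -expRD ler_peMr// ?(ltW s0)//.
by rewrite (_ : - k * t + (k + 1) * t = t) ?expR_ge1//; [rewrite -expR0 ler_expR|ring].
Qed.

(* [exp (-k t) S'] is nonincreasing and nonnegative, so [S] is nondecreasing and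
   [S' >= c' exp (-b t) S^q]; integrating this makes [S] grow too fast for the bound
   [not_eventually_ge], unless [S = 0]. *)
Lemma radial_mean_blowup :
  [\/ b <= 0 /\ 1 < q, b < 0 /\ q = 1 | q < 1 /\ b + k * (1 - q) <= 0] ->
  forall t, t0 < t -> S t = 0.
Proof.
move=> cond t1 t01; apply/eqP; rewrite eq_le S_ge0// andbT leNgt; apply/negP => St1.
case: cond => [[b0 q1]|[b0 q1]|[q1 bk]].
- pose T0 := Num.max t1 0; pose sg := c' * S t1 `^ q.
  have sg0 : 0 < sg by rewrite mulr_gt0// powR_gt0.
  have t1T0 : t1 <= T0 by rewrite le_max lexx.
  have t0T0 : t0 < T0 by exact: lt_le_trans t1T0.
  have S1sg t : T0 <= t -> sg <= S1 t.
    move=> T0t; have t0t : t0 < t by exact: lt_le_trans T0t.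
    apply: le_trans (S1_ge t0t); rewrite /sg -mulrA ler_pM2l//.
    have tt : 0 <= t by apply: le_trans T0t; rewrite le_max lexx orbT.
    rewrite -[leLHS]mul1r ler_pM ?powR_ge0//.
      by rewrite -expR0 ler_expR; nra.
    apply: ge0_ler_powR; rewrite ?nnegrE ?S_ge0 ?(ltW q0)// S_ndecr//.
    exact: le_trans T0t.
  (* [M] solves [c' * M ^ (q - 1) = k + 1]. Since [S1 >= sg] from [T0] on, [S] exceeds [M] after
     time [M / sg], and then [S1 >= c' * S ^ q >= (k + 1) * S]. *)
  pose M := ((k + 1) / c') `^ (q - 1)^-1.
  pose T := T0 + M / sg.
  have M0 : 0 <= M by exact: powR_ge0.
  have T0T : T0 <= T by rewrite lerDl divr_ge0// ltW.
  have t0T : t0 < T by exact: lt_le_trans T0T.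
  apply: (@not_exp_growth T) => //; first exact: ltW.
    by rewrite (lt_le_trans St1)// S_ndecr// (le_trans t1T0).
  move=> t Tt; have t0t : t0 < t by exact: lt_le_trans Tt.
  have MS : M <= S t.
    have T0t : T0 <= t by exact: le_trans Tt.
    have [e /andP[Te et] eq] := MVT_ray dS t0T0 T0t.
    have : sg * (t - T0) <= S t - S T0 by rewrite eq ler_wpM2r ?subr_ge0// S1sg.
    have : M <= sg * (t - T0).
      rewrite mulrC -ler_pdivrMr//; rewrite /T in Tt; lra.
    by have := S_ge0 t0T0; lra.
  apply: le_trans (S1_ge t0t).
  have tt : 0 <= t.
    by apply: le_trans Tt; apply: le_trans T0T; rewrite le_max lexx orbT.
  have St : 0 < S t.
    by rewrite (lt_le_trans St1)// S_ndecr// (le_trans t1T0)// (le_trans T0T).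
  rewrite (_ : S t `^ q = S t `^ (q - 1) * S t); last first.
    rewrite -{3}(powRr1 (ltW St)) -powRD ?subrK//.
    by apply/implyP => _; rewrite gt_eqF.
  rewrite mulrA; apply: ler_wpM2r; first exact: ltW.
  rewrite mulrAC -[leLHS]mulr1; apply: ler_pM => //.
  + by rewrite addr_ge0// ltW.
  + rewrite -ler_pdivrMl// mulrC.
    have -> : (k + 1) / c' = M `^ (q - 1).
      rewrite /M -powRrM mulVf ?powRr1//; last by rewrite subr_eq0 gt_eqF.
      by rewrite divr_ge0 ?addr_ge0// ltW.
    by apply: ge0_ler_powR; rewrite ?nnegrE ?subr_ge0// ltW.
  + by rewrite -expR0 ler_expR; nra.
(* Here [S1 >= c' exp (-b t) S], and [T] is chosen so that [c' * (- b * t) >= k + 1]. *)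
- pose T := Num.max t1 ((k + 1) / (c' * - b)).
  have t1T : t1 <= T by rewrite le_max lexx.
  have t0T : t0 < T by exact: lt_le_trans t1T.
  apply: (@not_exp_growth T) => //; rewrite ?q1//; first exact: ltW.
    by rewrite (lt_le_trans St1)// S_ndecr.
  move=> t Tt; have t0t : t0 < t by exact: lt_le_trans Tt.
  apply: le_trans (S1_ge t0t); rewrite q1 powRr1 ?S_ge0//.
  apply: ler_wpM2r; first exact: S_ge0.
  have : (k + 1) / (c' * - b) <= t by apply: le_trans Tt; rewrite le_max lexx orbT.
  rewrite ler_pdivrMr; last by rewrite mulr_gt0// oppr_gt0.
  move=> h; apply: (le_trans h).
  rewrite mulrCA ler_pM2l// mulrC.
  by have := expR_ge1Dx (- b * t); lra.
- have q1' : 0 < 1 - q by rewrite subr_gt0.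
  have b0 : 0 < - b by have := mulr_gt0 k0 q1'; lra.
  (* Dividing [S1 >= c' exp (-b t) S^q] by [S^q] bounds the derivative of [S^(1-q)] from below by
     that of [g exp (-b t)]; hence [Z] is nondecreasing. *)
  pose g := (1 - q) * c' / - b.
  have g0 : 0 < g by rewrite divr_gt0// mulr_gt0.
  pose Z t := S t `^ (1 - q) - g * expR (- b * t).
  pose Z' t := (1 - q) * S t `^ (- q) * S1 t - (1 - q) * c' * expR (- b * t).
  have Sp t : t1 <= t -> 0 < S t by move=> tt; rewrite (lt_le_trans St1)// S_ndecr.
  have dZ t : t1 < t -> is_derive t 1 Z (Z' t).
    move=> t1t; have t0t : t0 < t by exact: lt_trans t1t.
    have h1 := @is_derive1_comp R (@powR R ^~ (1 - q)) S t _ _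
      (is_derive1_powR (1 - q) (Sp _ (ltW t1t))) (dS t0t).
    have h2 := is_deriveZ g (is_derive_expM (- b) t).
    have h := is_deriveB h1 h2.
    apply: (is_derive_eq h); rewrite /Z' /g /GRing.scale /=.
    rewrite (_ : 1 - q - 1 = - q); last ring.
    by field; lra.
  have Z'0 t : t1 < t -> 0 <= Z' t.
    move=> t1t; have t0t : t0 < t by exact: lt_trans t1t.
    rewrite subr_ge0 -2!mulrA ler_pM2l//.
    apply: le_trans (ler_wpM2l (powR_ge0 _ _) (S1_ge t0t)).
    rewrite mulrCA powRN mulVf ?mulr1//.
    by rewrite gt_eqF// powR_gt0// Sp// ltW.
  pose T1 := t1 + 1; have t1T1 : t1 < T1 by rewrite ltrDl.
  have Zge t : T1 <= t -> - (g * expR (- b * T1)) <= Z t.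
    move=> Tt; apply: le_trans (nondecreasing_ray dZ Z'0 t1T1 Tt).
    by rewrite /Z lerDr powR_ge0.
  (* Increasing [- b * t] by 1 multiplies [expR (- b * t)] by at least 2, so the constant lost at
     [T1] costs at most half of the main term. *)
  pose T := Num.max 0 (T1 + (- b)^-1).
  have T1T : T1 < T by rewrite lt_max ltrDl invr_gt0 b0 orbT.
  have t0T : t0 < T by apply: lt_trans T1T; exact: lt_trans t1T1.
  have Sge t : T <= t -> g / 2 * expR (- b * t) <= S t `^ (1 - q).
    move=> Tt; have T1t : T1 <= t by apply: le_trans Tt; exact: ltW.
    have := Zge _ T1t; rewrite /Z.
    suff : expR (- b * T1) <= expR (- b * t) / 2 by nra.
    have : - b * T1 + 1 <= - b * t.
      have : T1 + (- b)^-1 <= t by apply: le_trans Tt; rewrite le_max lexx orbT.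
      move=> /(ler_wpM2l (ltW b0)); by rewrite mulrDr mulfV ?gt_eqF.
    move=> h0; have h : expR (- b * T1) * expR 1 <= expR (- b * t) by rewrite -expRD ler_expR.
    have := expR_ge1Dx (1 : R); have := expR_gt0 (- b * T1); nra.
  (* As [S^q = (S^(1-q))^r], the exponent to be controlled is [- (k + b) - b r = - b / (1 - q) - k],
     which is nonnegative exactly when [b + k (1 - q) <= 0]. *)
  pose r := q / (1 - q).
  have r0 : 0 <= r by rewrite divr_ge0// ltW.
  apply: (@not_eventually_ge ((g / 2) `^ r) T) => //.
    by rewrite powR_gt0// divr_gt0.
  move=> t Tt.
  have t1t : t1 <= t.
    by apply: le_trans Tt; rewrite (le_trans (ltW t1T1))// ltW.
  have -> : S t `^ q = (S t `^ (1 - q)) `^ r.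
    by rewrite -powRrM /r; congr powR; field; rewrite gt_eqF.
  apply: (@le_trans _ _ (expR (- (k + b) * t) * (g / 2 * expR (- b * t)) `^ r)); last first.
    apply: ler_wpM2l; first exact: expR_ge0.
    apply: ge0_ler_powR => //; rewrite ?nnegrE ?powR_ge0// ?Sge//.
    by rewrite mulr_ge0 ?expR_ge0//; lra.
  have g2 : 0 <= g / 2 by lra.
  rewrite (@powRM _ _ _ r g2 (expR_ge0 _)).
  rewrite [expR (- b * t) `^ r]/powR gt_eqF ?expR_gt0// expRK mulrCA -expRD.
  apply: ler_peMr; first exact: powR_ge0.
  rewrite -expR0 ler_expR.
  have tt : 0 <= t by apply: le_trans Tt; rewrite le_max lexx.
  rewrite (_ : _ + _ = (- b / (1 - q) - k) * t); last first.
    by rewrite /r; field; rewrite gt_eqF.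
  rewrite mulr_ge0// subr_ge0 ler_pdivlMr//; lra.
Qed.

End radial_mean.
End ode.

(** * Topology and Lebesgue measure on row vectors *)
Section rV_topology.
Context {R : realType} {n : nat}.
Implicit Types (x y : 'rV[R]_n) (A : set 'rV[R]_n) (f : 'rV[R]_n -> R).

Lemma rV_norm_coord x i : `|x ord0 i| <= `|x|.
Proof.
rewrite [leRHS]/Num.norm /= mx_normrE; apply/bigmax_geP; right => /=.
by exists (ord0, i).
Qed.

Lemma rV_norm_le x e : 0 <= e -> (forall i, `|x ord0 i| <= e) -> `|x| <= e.
Proof.
move=> e0 xe; rewrite [leLHS]/Num.norm /= mx_normrE; apply/bigmax_leP; split => //.
by move=> [i j] _ /=; rewrite ord1.
Qed.

Lemma rV_norm_lt x e : 0 < e -> (forall i, `|x ord0 i| < e) -> `|x| < e.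
Proof.
move=> e0 xe; rewrite [ltLHS]/Num.norm /= mx_normrE; apply/bigmax_ltP; split => //.
by move=> [i j] _ /=; rewrite ord1.
Qed.

Lemma open_normP A x : open A -> A x ->
  exists2 e, 0 < e & forall y, `|x - y| < e -> A y.
Proof.
move=> oA Ax; have : nbhs x A by apply: open_nbhs_nbhs.
by move=> /nbhs_normP[e /= e0 eA]; exists e.
Qed.

Definition rat_box (k : 'rV[rat]_n * nat) : set 'rV[R]_n :=
  [set x | forall i, `](ratr (k.1 ord0 i) - k.2.+1%:R^-1),
                       (ratr (k.1 ord0 i) + k.2.+1%:R^-1)[%classic (x ord0 i)].

Lemma measurable_rat_box k : measurable (rat_box k).
Proof. by apply: (@measurable_box _ _ (fun i => `](ratr (k.1 ord0 i) - k.2.+1%:R^-1),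
  (ratr (k.1 ord0 i) + k.2.+1%:R^-1)[%classic)) => i; exact: measurable_itv. Qed.

Lemma rat_box_nbhs A x : open A -> A x ->
  exists k, rat_box k x /\ rat_box k `<=` A.
Proof.
move=> oA Ax; have [e e0 eA] := open_normP oA Ax.
pose d (m : nat) : R := m.+1%:R^-1.
have [m me] : exists m, d m < e / 2.
  have [m _ /(_ m (leqnn m))] :=
    near_infty_natSinv_lt (PosNum (divr_gt0 e0 (@ltr0n R 2))).
  by exists m.
have m0 : 0 < d m by rewrite invr_gt0.
have /(_ _)/cid-/all_sig[q hq] : forall i, exists q : rat,
    x ord0 i - d m < ratr q < x ord0 i + d m.
  move=> i; have : x ord0 i - d m < x ord0 i + d m by lra.
  by move=> /rat_in_itvoo[q]; rewrite in_itv/=; exists q.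
exists (\row_i q i, m); split => /= [i|y yq].
  by rewrite mxE /= in_itv/= -/(d m); have /andP[] := hq i; lra.
apply: eA; apply: rV_norm_lt => // i; have := yq i; rewrite !mxE /= in_itv/= -/(d m).
by have /andP[] := hq i; rewrite ltr_norml; lra.
Qed.

(** The sigma-algebra is generated by coordinates, so an open set is written as the union of the
    countably many boxes of rational centre and radius [1/(m+1)] that it contains. *)
Lemma open_measurable_rV A : open A -> measurable A.
Proof.
move=> oA; rewrite (_ : A =
    \bigcup_(k in [set: 'rV[rat]_n * nat]) [set x | rat_box k x /\ rat_box k `<=` A]).
  apply: countable_bigcupT_measurable => // k.
  have [kA|kA] := pselect (rat_box k `<=` A).
    rewrite (_ : [set _ | _] = rat_box k); first exact: measurable_rat_box.
    by apply/seteqP; split => x //= -[].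
  rewrite (_ : [set _ | _] = set0)//.
  by apply/seteqP; split => x //= -[].
apply/seteqP; split => [x Ax|x [k _ [kx]]]; last exact.
by have [k kx] := rat_box_nbhs oA Ax; exists k.
Qed.

Lemma closed_measurable_rV A : closed A -> measurable A.
Proof. by move/closed_openC/open_measurable_rV/measurableC; rewrite setCK. Qed.

Lemma compact_closed_rV A : compact A -> closed A.
Proof. by apply: compact_closed; exact: norm_hausdorff. Qed.

Lemma compact_measurable_rV A : compact A -> measurable A.
Proof. by move/compact_closed_rV/closed_measurable_rV. Qed.

Lemma compact_bounded_rV A : compact A -> exists2 M, 0 < M & forall x, A x -> `|x| <= M.
Proof.
move=> /compact_bounded[M [Mr MA]]; exists (`|M| + 1); first by rewrite ltr_wpDl.
by move=> x Ax; apply: MA => //; rewrite (le_lt_trans (ler_norm _))// ltrDl.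
Qed.

Lemma bounded_closed_compact_rV A M : (forall x, A x -> `|x| <= M) -> closed A -> compact A.
Proof.
move=> AM; apply: bounded_closed_compact; exists M; split; first exact: num_real.
by move=> e Me x Ax /=; rewrite (le_trans (AM _ Ax))// ltW.
Qed.

Lemma open_continuous_measurable_fun_rV A f : open A ->
  (forall x, A x -> {for x, continuous f}) -> measurable_fun A f.
Proof.
move=> oA cf; apply: (measurability _ (measurable_realfun.RGenOInfty.measurableE R)).
move=> _ [_ [a ->] <-]; apply: open_measurable_rV.
rewrite openE => x [Ax fx]; apply: filterI; first exact: open_nbhs_nbhs.
by apply: cf => //; apply: open_nbhs_nbhs; split => //; exact: interval_open.
Qed.

Lemma continuous_measurable_fun_rV f : continuous f -> measurable_fun setT f.
Proof.
by move=> cf; apply: (@open_continuous_measurable_fun_rV [set: 'rV[R]_n] f openT) => x _; exact: cf.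
Qed.

Definition cube (y : 'rV[R]_n) (r : R) : set 'rV[R]_n :=
  [set x | forall i, `[(y ord0 i - r), (y ord0 i + r)]%classic (x ord0 i)].

Lemma measurable_cube y r : measurable (cube y r).
Proof.
by apply: (@measurable_box _ _ (fun i => `[(y ord0 i - r), (y ord0 i + r)]%classic)) => i;
  exact: measurable_itv.
Qed.

Lemma lebesgue_rV_cube y r : 0 <= r -> lebesgue_rV n (cube y r) = ((2 * r) ^+ n)%:E.
Proof.
move=> r0; rewrite (lebesgue_rV_box (A := fun i => `[(y ord0 i - r), (y ord0 i + r)]%classic)) => [|i].
  rewrite (eq_bigr (fun=> (2 * r)%:E)) => [|i _].
    by rewrite prodEFin prodr_const card_ord.
  rewrite lebesgue_measure_itv/= lte_fin; case: ifPn => [_|].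
    by rewrite -EFinD; congr EFin; ring.
  by rewrite -leNgt => rr; congr EFin; lra.
exact: measurable_itv.
Qed.

Lemma lebesgue_rV_bounded A M : measurable A -> (forall x, A x -> `|x| <= M) ->
  (lebesgue_rV n A < +oo)%E.
Proof.
move=> mA AM.
apply: (@le_lt_trans _ _ (lebesgue_rV n (cube 0 `|M|))); last first.
  by rewrite lebesgue_rV_cube// ltry.
apply: le_measure; rewrite ?inE//; first exact: measurable_cube.
move=> x /AM xM i /=; rewrite mxE in_itv/= sub0r add0r -ler_norml.
by rewrite (le_trans (rV_norm_coord _ _))// (le_trans xM)// ler_norm.
Qed.

Lemma lebesgue_rV_compact A : compact A -> (lebesgue_rV n A < +oo)%E.
Proof.
move=> cA; have [M _ AM] := compact_bounded_rV cA.
by apply: lebesgue_rV_bounded AM; exact: compact_measurable_rV.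
Qed.

End rV_topology.

(** * Regularity of finite Borel measures *)

Section regularity.
Context {R : realType} {n : nat}.
Variable mu : {measure set 'rV[R]_n -> \bar R}.
Hypothesis muT : (mu [set: 'rV[R]_n] < +oo)%E.
Implicit Types (A B F G : set 'rV[R]_n).

Let mu_lty A : measurable A -> (mu A < +oo)%E.
Proof.
by move=> mA; apply: le_lt_trans muT; apply: le_measure; rewrite ?inE.
Qed.

(** The sets that can be squeezed between a closed and an open set. They form a sigma-algebra that
    contains the generators, hence all measurable sets. *)
Let approx A := measurable A /\ forall e : R, 0 < e -> exists F G,
  [/\ closed F, open G, F `<=` A, A `<=` G & (mu (G `\` F) < e%:E)%E].

Let nondecreasing_approx (H : (set 'rV[R]_n)^nat) (e : R) :
  (forall k, measurable (H k)) ->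
  {homo H : i j / (i <= j)%N >-> i `<=` j} -> 0 < e ->
  exists k, (mu (\bigcup_i H i `\` H k) < e%:E)%E.
Proof.
move=> mH ndH e0; have mU : measurable (\bigcup_i H i) by exact: bigcup_measurable.
pose F k := \bigcup_i H i `\` H k.
have mF k : measurable (F k) by exact: measurableD.
have F0 : \bigcap_k F k = set0.
  apply/seteqP; split => // x Fx; have [[i _ Hi] _] := Fx O I.
  by have [_] := Fx i I.
have : (mu \o F) x @[x --> \oo] --> mu (\bigcap_k F k).
  apply: nonincreasing_cvg_mu => //; first exact: mu_lty.
    by rewrite F0.
  by move=> i j ij; apply/subsetPset => x [? nx]; split => // /(ndH _ _ ij).
rewrite F0 measure0 => /fine_cvgP[_ /cvgrPdist_lt/(_ _ e0)[k _ /(_ k (leqnn k))]].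
rewrite /= sub0r normrN => h; exists k.
have fn : mu (F k) \is a fin_num by rewrite ge0_fin_numE// mu_lty.
by rewrite -/(F k) -(fineK fn) lte_fin (le_lt_trans (ler_norm _) h).
Qed.

Let approxC A : approx A -> approx (~` A).
Proof.
move=> [mA hA]; split => [|e e0]; first exact: measurableC.
have [F [G [cF oG FA AG h]]] := hA _ e0.
exists (~` G), (~` F); split; [exact: open_closedC|exact: closed_openC| | |].
- exact: subsetC.
- exact: subsetC.
- by rewrite setDE setCK setIC -setDE.
Qed.

(** The outer open sets cost [e / 2] in total by a geometric series. The union of all inner closed
    sets need not be closed; a finite union suffices up to another [e / 2], since [mu] is finite and
    hence continuous along decreasing sequences. *)
Let approx_bigcup (A : (set 'rV[R]_n)^nat) :
  (forall k, approx (A k)) -> approx (\bigcup_k A k).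
Proof.
move=> hA; split => [|e e0]; first by apply: bigcup_measurable => k _; exact: (hA k).1.
have e2 k : 0 < e / 2 / (2 ^ k.+1)%:R :> R.
  by rewrite !divr_gt0// ltr0n expn_gt0.
have /choice[FG hFG] : forall k, exists FG : set 'rV[R]_n * set 'rV[R]_n,
  [/\ closed FG.1, open FG.2, FG.1 `<=` A k, A k `<=` FG.2 &
     (mu (FG.2 `\` FG.1) < (e / 2 / (2 ^ k.+1)%:R)%:E)%E].
  move=> k; have [F [G h]] := (hA k).2 _ (e2 k); by exists (F, G).
pose F k := (FG k).1; pose G k := (FG k).2.
have mF k : measurable (F k) by apply: closed_measurable_rV; have [] := hFG k.
have mG k : measurable (G k) by apply: open_measurable_rV; have [] := hFG k.
pose H k := \bigcup_(i in `I_k) F i.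
have HE : \bigcup_k F k = \bigcup_k H k.
  apply/seteqP; split => x [k _].
    by move=> Fk; exists k.+1 => //; exists k => //=.
  by move=> [i _ Fi]; exists i.
have mH k : measurable (H k) by apply: bigcup_measurable => i _; exact: mF.
have e20 : 0 < e / 2 by rewrite divr_gt0.
have [N hN] : exists k, (mu (\bigcup_i H i `\` H k) < (e / 2)%:E)%E.
  apply: nondecreasing_approx => // i j ij x [l /= li Fl].
  by exists l => //=; exact: leq_trans li ij.
exists (H N), (\bigcup_k G k); split.
- by apply: closed_bigcup => // k _; have [] := hFG k.
- by apply: bigcup_open => k _; have [] := hFG k.
- by move=> x [k _ Fk]; exists k => //; have [_ _ + _ _] := hFG k; apply.
- by move=> x [k _ Fk]; exists k => //; have [_ _ _ + _] := hFG k; apply.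
have mUG : measurable (\bigcup_k G k) by exact: bigcup_measurable.
have mUH : measurable (\bigcup_k H k) by exact: bigcup_measurable.
have sub : \bigcup_k G k `\` H N `<=`
    (\bigcup_k (G k `\` F k)) `|` (\bigcup_i H i `\` H N).
  move=> x [[k _ Gk] nH]; have [Fx|nFx] := pselect ((\bigcup_k F k) x).
    by right; rewrite -HE.
  left; exists k => //; split => // Fk; apply: nFx; by exists k.
apply: le_lt_trans (le_measure _ _ _ sub) _; rewrite ?inE.
- exact: measurableD.
- apply: measurableU; last exact: measurableD.
  by apply: bigcup_measurable => k _; exact: measurableD.
apply: (le_lt_trans (measureU2 _ _ _)).
- by apply: bigcup_measurable => k _; exact: measurableD.
- exact: measurableD.
rewrite (splitr e) EFinD; apply: lee_ltD => //.
  by rewrite ge0_fin_numE// mu_lty//; apply: bigcup_measurable => k _; exact: measurableD.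
apply: le_trans (epsilon_trick0 xpredT (ltW e20)).
apply: (@le_trans _ _ (\sum_(0 <= k <oo) mu (G k `\` F k))%E).
  apply: measure_sigma_subadditive => //.
  - by move=> k; exact: measurableD.
  - by apply: bigcup_measurable => k _; exact: measurableD.
apply: lee_nneseries => // k _; by apply: ltW; have [] := hFG k.
Qed.

Let approx_sigma_algebra : sigma_algebra setT approx.
Proof.
split=> [|A hA|A hA]; last exact: approx_bigcup.
  split => // e e0; exists set0, set0; split; [exact: closed0|exact: open0|by []|by []|].
  by rewrite setD0 measure0 lte_fin.
by rewrite setTD; exact: approxC.
Qed.

Let approx_open A (H : (set 'rV[R]_n)^nat) :
  open A -> (forall k, closed (H k)) ->
  {homo H : i j / (i <= j)%N >-> i `<=` j} -> A = \bigcup_k H k -> approx A.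
Proof.
move=> oA cH ndH AH; split => [|e e0]; first exact: open_measurable_rV.
have mH k : measurable (H k) by exact: closed_measurable_rV.
have [k hk] := nondecreasing_approx mH ndH e0.
by exists (H k), A; split => //; rewrite AH// => x Hx; exists k.
Qed.

Lemma coord_continuous_rV (i : 'I_n) : continuous (fun x : 'rV[R]_n => x ord0 i).
Proof. exact: coord_continuous. Qed.

Let approx_coord (i : 'I_n) (C : set (measurableTypeR R)) :
  measurable C -> approx ((fun x : 'rV[R]_n => x ord0 i) @^-1` C).
Proof.
pose f (x : 'rV[R]_n) := x ord0 i.
have cf : continuous f by exact: coord_continuous_rV.
rewrite [X in X -> _](_ : _ = <<s @measurable_realfun.RGenOInfty.G R >> C); last first.
  exact: (congr1 (@^~ C) (measurable_realfun.RGenOInfty.measurableE R)).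
move: C; apply: (@smallest_sub _ _ _ [set C | approx (f @^-1` C)]) => /=.
  split => /= [|A hA|A hA].
  - by rewrite preimage_set0; have [] := approx_sigma_algebra.
  - by rewrite setTD preimage_setC; exact: approxC.
  - by rewrite preimage_bigcup; exact: approx_bigcup.
(* An open ray is the increasing union of the closed rays starting at [a + 1/(k+1)]. *)
move=> _ [a ->]; apply: (@approx_open _ (fun k => f @^-1` `[(a + k.+1%:R^-1), +oo[)).
- by move/continuousP : cf; apply; exact: interval_open.
- by move=> k; move/continuous_closedP : cf; apply; exact: interval_closed.
- move=> j k jk x /=; rewrite !in_itv/= !andbT; apply: le_trans.
  by rewrite lerD2l lef_pV2 ?posrE// ler_nat.
- by rewrite -preimage_bigcup -itvoyEbigcup.
Qed.

Lemma rV_regular A : measurable A -> forall e : R, 0 < e -> exists F G,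
  [/\ closed F, open G, F `<=` A, A `<=` G & (mu (G `\` F) < e%:E)%E].
Proof.
move=> mA; suff [] : approx A by [].
move: A mA; apply: smallest_sub; first exact: approx_sigma_algebra.
move=> B; rewrite -bigcup_seq/= => -[i _ [C mC <-]].
by rewrite setTI; exact: approx_coord.
Qed.

End regularity.

(** Regularity applies to finite measures, so Lebesgue measure is first restricted to [A]. With
    tolerance [e] equal to the measure of [A], a null closed set [F] would leave all of [e] in [A]
    minus [F]. *)
Lemma rV_inner_regular (R : realType) (n : nat) (A : set 'rV[R]_n) (M : R) :
  measurable A -> (forall x, A x -> `|x| <= M) -> (0 < lebesgue_rV n A)%E ->
  exists F, [/\ compact F, F `<=` A & (0 < lebesgue_rV n F)%E].
Proof.
move=> mA AM A0; have Aoo := lebesgue_rV_bounded mA AM.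
pose mu := mrestr (lebesgue_rV n) mA.
have muT : (mu [set: 'rV[R]_n] < +oo)%E by rewrite /mu /mrestr setTI.
pose e := fine (lebesgue_rV n A).
have eE : e%:E = lebesgue_rV n A by rewrite fineK// ge0_fin_numE.
have e0 : 0 < e by rewrite -lte_fin eE.
have [F [G [cF oG FA AG h]]] := rV_regular muT mA e0.
exists F; split => //.
  by apply: (@bounded_closed_compact_rV _ _ _ M) => // x /FA/AM.
have mF : measurable F by exact: closed_measurable_rV.
have mG : measurable G by exact: open_measurable_rV.
rewrite lt0e measure_ge0 andbT; apply/eqP => F0; move: h; apply/negP.
rewrite -leNgt /mu /mrestr eE.
have GFA : (G `\` F) `&` A = A `\` F.
  by apply/seteqP; split => x /=; [move=> [[_ nF] Ax]|move=> [Ax nF]; split=> //; split => //; exact: AG].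
rewrite [leRHS](_ : _ = lebesgue_rV n ((G `\` F) `&` A))// GFA; have -> : lebesgue_rV n A = lebesgue_rV n ((A `\` F) `|` F).
  by rewrite setUC setDUK.
rewrite (le_trans (measureU2 _ _ _))//; first exact: measurableD.
by rewrite [X in (_ + X)%E](_ : _ = 0%E) ?adde0.
Qed.

(** * Integration by parts *)
Section affine_reparametrization.
Context {K : numFieldType} {V1 V2 W : normedModType K}.
Variables (g : V1 -> V2) (v1 : V1) (v2 : V2) (f : V2 -> W) (x : V1).
Hypothesis gE : forall h : K, g (h *: v1 + x) = h *: v2 + g x.

(** A map that is affine along [v1] carries one difference quotient to the other verbatim;
    derivatives along slices and lines therefore agree without any differentiability of [f] as a
    whole. *)
Let quotientE :
  (fun h : K => h^-1 *: (((f \o g) \o shift x) (h *: v1) - (f \o g) x)) =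
  (fun h : K => h^-1 *: ((f \o shift (g x)) (h *: v2) - f (g x))).
Proof. by apply/funext => h /=; rewrite gE. Qed.

Lemma derivable_reparam : derivable f (g x) v2 -> derivable (f \o g) x v1.
Proof. by rewrite /derivable quotientE. Qed.

Lemma derivable_reparam_inv : derivable (f \o g) x v1 -> derivable f (g x) v2.
Proof. by rewrite /derivable quotientE. Qed.

Lemma derive_reparam : 'D_v1 (f \o g) x = 'D_v2 f (g x).
Proof. by rewrite /derive quotientE. Qed.

End affine_reparametrization.

Lemma continuous_rV (R : realType) (n : nat) (T : topologicalType)
    (g : T -> 'rV[R]_n) t :
  (forall i, {for t, continuous (fun s => g s ord0 i)}) -> {for t, continuous g}.
Proof.
move=> cg; apply/cvgrPdist_lt => e e0.
have : \forall s \near t, forall i : 'I_n, `|g t ord0 i - g s ord0 i| < e.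
  by apply: filter_forall => i; have /cvgrPdist_lt/(_ _ e0) := cg i.
apply: filterS => s h; apply: rV_norm_lt => // i.
by rewrite !mxE; exact: h.
Qed.

Section compact_support.
Context {R : realType} {n : nat}.
Implicit Types (f : 'rV[R]_n -> R) (K D : set 'rV[R]_n).

Lemma continuous_compact_bounded f K : compact K -> continuous f ->
  exists2 M, 0 <= M & forall x, K x -> `|f x| <= M.
Proof.
move=> cK cf; have [K0|K0] := pselect (K !=set0); last first.
  by exists 0 => // x Kx; case: K0; exists x.
have cnf : {within K, continuous (fun x => `|f x|)}.
  by apply: continuous_subspaceT => x; apply: continuous_comp; [exact: cf|exact: norm_continuous].
have [c _ hc] := EVT_max_rV K0 cK cnf.
by exists `|f c| => // x Kx; apply: hc; rewrite inE.
Qed.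

Lemma integrable_bounded_support f K M : compact K -> measurable_fun setT f ->
  (forall x, `|f x| <= M) -> (forall x, ~ K x -> f x = 0) ->
  (lebesgue_rV n).-integrable setT (EFin \o f).
Proof.
move=> cK mf fM f0; have mK := compact_measurable_rV cK.
have -> : EFin \o f = (EFin \o f) \_ K.
  apply/funext => x; rewrite patchE; case: ifPn => //; rewrite notin_setE => /f0 /= ->.
  by [].
apply/(integrable_mkcond _ mK); apply: measurable_bounded_integrable => //.
- exact: lebesgue_rV_compact.
- exact: measurable_funTS.
- exists M; split; first exact: num_real.
  by move=> e Me x _ /=; rewrite (le_trans (fM x))// ltW.
Qed.

Lemma integrable_compact_support f K : compact K -> continuous f ->
  (forall x, ~ K x -> f x = 0) -> (lebesgue_rV n).-integrable setT (EFin \o f).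
Proof.
move=> cK cf f0; have [M M0 fM] := continuous_compact_bounded cK cf.
apply: (@integrable_bounded_support _ K M) => //.
  exact: continuous_measurable_fun_rV.
move=> x; have [/fM//|/f0 ->] := pselect (K x).
by rewrite normr0.
Qed.

End compact_support.

(** * Integrals of partial derivatives *)

Section divergence.
Context {R : realType}.

Lemma rV_cons0 n (t : R) (y : 'rV[R]_n) : rV_cons (t, y) ord0 ord0 = t.
Proof. by rewrite mxE unlift_none. Qed.

Lemma rV_consS n (t : R) (y : 'rV[R]_n) j : rV_cons (t, y) ord0 (lift ord0 j) = y ord0 j.
Proof. by rewrite mxE liftK. Qed.

Lemma rV_cons_eq n (t : R) (y : 'rV[R]_n) (z : 'rV[R]_n.+1) :
  z ord0 ord0 = t -> (forall j, z ord0 (lift ord0 j) = y ord0 j) -> z = rV_cons (t, y).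
Proof.
move=> z0 zS; apply/rowP => i; case: (unliftP ord0 i) => [j ->|->].
  by rewrite rV_consS.
by rewrite rV_cons0.
Qed.

Lemma rV_cons_continuousr n (t : R) : continuous (fun y : 'rV[R]_n => rV_cons (t, y)).
Proof.
move=> y; apply: continuous_rV => l; case: (unliftP ord0 l) => [j ->|->].
  rewrite (_ : (fun _ => _) = (fun s : 'rV[R]_n => s ord0 j)); last first.
    by apply/funext => s; rewrite rV_consS.
  exact: coord_continuous.
rewrite (_ : (fun _ => _) = cst t); last by apply/funext => s; rewrite rV_cons0.
exact: cst_continuous.
Qed.

Lemma rV_cons_continuousl n (y : 'rV[R]_n) : continuous (fun t : R => rV_cons (t, y)).
Proof.
move=> t; apply: continuous_rV => l; case: (unliftP ord0 l) => [j ->|->].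
  rewrite (_ : (fun _ => _) = cst (y ord0 j)); last by apply/funext => s; rewrite rV_consS.
  exact: cst_continuous.
by rewrite (_ : (fun _ => _) = id); last by apply/funext => s; rewrite rV_cons0.
Qed.

Lemma partial_support n (i : 'I_n) (w : 'rV[R]_n -> R) (M : R) :
  (forall x, M < `|x| -> w x = 0) -> forall x, M < `|x| -> partial i w x = 0.
Proof.
move=> w0 x Mx; rewrite /partial (@near_eq_derive _ _ _ w (cst 0)) ?derive_cst//.
have : `|y| @[y --> x] --> `|x| by exact: norm_continuous.
by move=> /cvgr_gt/(_ _ Mx); apply: filterS => y /w0.
Qed.

(** Induction on the dimension with Fubini. If [i] is not the first coordinate, every slice falls
    under the induction hypothesis, the sup norm of a tail being at most that of the vector; if it
    is the first one, every line falls under the fundamental theorem of calculus. *)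
Lemma integral_partial n (i : 'I_n) (w : 'rV[R]_n -> R) (M : R) :
  continuous w -> (forall x, derivable w x (delta_mx ord0 i)) ->
  continuous (partial i w) -> (forall x, M < `|x| -> w x = 0) ->
  (\int[lebesgue_rV n]_x (partial i w x)%:E = 0)%E.
Proof.
elim: n i w M => [[]//|n IH] i w M cw dw cdw w0.
have dw0 := partial_support i w0.
have mdw : measurable_fun setT (partial i w) by exact: continuous_measurable_fun_rV.
pose K : set 'rV[R]_n.+1 := [set x | `|x| <= M].
have cK : compact K.
  apply: (@bounded_closed_compact_rV _ _ _ M) => //.
  have -> : K = (fun x => `|x|) @^-1` `]-oo, M] by apply/seteqP; split => x; rewrite /K/= in_itv.
  by apply: (continuous_closedP _).1; [exact: norm_continuous|exact: interval_closed].
have idw : (lebesgue_rV n.+1).-integrable setT (EFin \o partial i w).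
  by apply: (integrable_compact_support cK) => // x /negP; rewrite -ltNge => /dw0.
have mcons : measurable_fun setT (@rV_cons R n) by exact: measurable_rV_cons.
pose F (p : measurableTypeR R * 'rV[R]_n) := (partial i w (rV_cons p))%:E.
have iF : (lebesgue_measure \x lebesgue_rV n)%E.-integrable setT F.
  apply/integrableP; split.
    by apply/measurable_EFinP; exact: (measurableT_comp mdw mcons).
  have /integrableP[_] := idw; rewrite ge0_integral_pushforward//.
  by apply: measurableT_comp => //; exact/measurable_EFinP.
have -> : (\int[lebesgue_rV n.+1]_x (partial i w x)%:E =
           \int[lebesgue_measure \x lebesgue_rV n]_p F p)%E.
  rewrite [LHS](@integral_pushforward _ _ _ _ _ _ mcons)//.
  exact/measurable_EFinP.
case: (unliftP ord0 i) => [j ij|i0].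
- rewrite -integral12_prod_meas1//; apply: integral0_eq => t _ /=.
  pose wt (y : 'rV[R]_n) := w (rV_cons (t, y)).
  have gE (y : 'rV[R]_n) (h : R) :
      rV_cons (t, h *: delta_mx ord0 j + y) = h *: delta_mx ord0 i + rV_cons (t, y).
    apply/esym/rV_cons_eq => [|l]; rewrite !mxE ?ij /= ?unlift_none ?liftK/=.
      by rewrite mulr0 add0r.
    by rewrite (inj_eq lift_inj).
  have cg : continuous (fun y : 'rV[R]_n => rV_cons (t, y)).
    exact: rV_cons_continuousr.
  have E y : partial i w (rV_cons (t, y)) = partial j wt y.
    by rewrite /partial (derive_reparam w (gE y)).
  under [LHS]eq_integral do rewrite /F E.
  apply: (IH j wt M).
  + by move=> y; apply: continuous_comp; [exact: cg|exact: cw].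
  + by move=> y; apply: (derivable_reparam (gE y)); exact: dw.
  + have -> : partial j wt = partial i w \o (fun y => rV_cons (t, y)).
      by apply/funext => y; rewrite /= E.
    by move=> y; apply: continuous_comp; [exact: cg|exact: cdw].
  + move=> y My; apply: w0; apply: (lt_le_trans My); apply: rV_norm_le => // l.
    by rewrite -(rV_consS t); exact: rV_norm_coord.
- rewrite -integral21_prod_meas1//; apply: integral0_eq => y _ /=.
  pose wy (t : R) := w (rV_cons (t, y)).
  have gE (t : R) (h : R) :
      rV_cons (h *: 1 + t, y) = h *: delta_mx ord0 i + rV_cons (t, y).
    apply/esym/rV_cons_eq => [|l]; rewrite !mxE ?i0 /= ?unlift_none ?liftK/=.
      by rewrite mulr1 /GRing.scale/= mulr1.
    by rewrite mulr0 add0r.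
  have cg : continuous (fun t : R => rV_cons (t, y)).
    exact: rV_cons_continuousl.
  have E (t : R) : partial i w (rV_cons (t, y)) = (derive1 wy) t.
    by rewrite derive1E /partial (derive_reparam w (gE t)).
  have dwy t : derivable wy t 1 by apply: (derivable_reparam (gE t)); exact: dw.
  have cwy : continuous wy.
    by move=> t; apply: continuous_comp; [exact: cg|exact: cw].
  have cwy' : continuous (derive1 wy).
    have -> : (derive1 wy) = partial i w \o (fun t => rV_cons (t, y)).
      by apply/funext => t; rewrite /= E.
    by move=> t; apply: continuous_comp; [exact: cg|exact: cdw].
  (* On a line, [w] and its derivative vanish for [N <= |t|]; the added 1 makes the comparison with
     [M] strict and [N] positive. *)
  pose N := `|M| + 1.
  have N0 : 0 < N by rewrite ltr_wpDl.
  have far t : N <= `|t| -> M < `|rV_cons (t, y)|.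
    move=> Nt; apply: (@lt_le_trans _ _ `|t|).
      by rewrite (lt_le_trans _ Nt)// /N (le_lt_trans (ler_norm M))// ltrDl.
    by rewrite -{1}(rV_cons0 t y); exact: rV_norm_coord.
  rewrite /fubini_G (_ : (fun _ => _) = EFin \o ((derive1 wy) \_ `[- N, N])); last first.
    apply/funext => t /=; rewrite /F patchE; case: ifPn; rewrite ?E//.
    rewrite notin_setE /= in_itv/= => /negP; rewrite -ler_norml -ltNge => Nt.
    by rewrite -E dw0// far// ltW.
  rewrite -restrict_EFin -integral_mkcond.
  rewrite (@continuous_FTC2 _ _ wy).
  + by rewrite /wy !w0 ?far ?normrN ?gtr0_norm// subee.
  + lra.
  + exact: continuous_subspaceT.
  + split; first by move=> t _; exact: dwy.
      by apply: cvg_at_right_filter; exact: cwy.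
    by apply: cvg_at_left_filter; exact: cwy.
  + by [].
Qed.

End divergence.

(** Lets one-variable rules, the chain rule above all, be used for directional derivatives. *)
Lemma is_derive_line (R : numFieldType) (V W : normedModType R) (f : V -> W) (x v : V) (df : W) :
  is_derive (0 : R) 1 (fun s => f (s *: v + x)) df <-> is_derive x v f df.
Proof.
pose g (s : R^o) := s *: v + x.
have gE (h : R) : g (h *: (1 : R^o) + 0) = h *: v + g 0.
  by rewrite /g addr0 scale0r add0r; congr (_ *: _ + _); exact: mulr1.
have E : g 0 = x by rewrite /g scale0r add0r.
split=> -[d1 d2].
- split; first by rewrite -E; exact: (derivable_reparam_inv gE).
  by rewrite -d2 -{1}E; apply/esym; exact: (derive_reparam f gE).
- split; first by apply: (derivable_reparam gE); rewrite E.
  by rewrite -d2 -{2}E; exact: (derive_reparam f gE).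
Qed.

Lemma is_derive_comp1 (R : realType) (V : normedModType R) (f : V -> R) (h : R -> R)
    (x v : V) (df dh : R) :
  is_derive x v f df -> is_derive (f x) 1 h dh -> is_derive x v (h \o f) (dh * df).
Proof.
move=> /is_derive_line df' dh'; apply/is_derive_line.
apply: (@is_derive1_comp R h (fun s => f (s *: v + x)) 0) => //.
by rewrite scale0r add0r.
Qed.

Lemma continuous_sum_fun (R : realType) (T : topologicalType) (n : nat)
    (F : 'I_n -> T -> R) (x : T) :
  (forall i, {for x, continuous (F i)}) -> {for x, continuous (fun z => \sum_i F i z)}.
Proof.
move=> cF; apply: (@cvg_big R 'I_n +%R 0 xpredT) => // [|i _]; last exact: cF.
exact: add_continuous.
Qed.

(** * The squared Euclidean distance *)
Section sqdist.
Context {R : realType} {n : nat}.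
Implicit Types (x y z : 'rV[R]_n) (i j : 'I_n).

(** Radial functions are taken as functions of the squared distance to a centre [y]: it is a
    polynomial, smooth at the centre too. *)
Definition sqdist y x : R := \sum_i (x ord0 i - y ord0 i) ^+ 2.

Lemma sqdist_ge0 y x : 0 <= sqdist y x.
Proof. by apply: sumr_ge0 => i _; exact: sqr_ge0. Qed.

Lemma sqdistC y x : sqdist y x = sqdist x y.
Proof. by apply: eq_bigr => i _; rewrite -sqrrN opprB. Qed.

Lemma sqdist_coord y x i : (x ord0 i - y ord0 i) ^+ 2 <= sqdist y x.
Proof.
rewrite /sqdist (bigD1 i)//= lerDl; apply: sumr_ge0 => j _; exact: sqr_ge0.
Qed.

Lemma sqdist0E x : enorm x = Num.sqrt (sqdist 0 x).
Proof. by congr Num.sqrt; apply: eq_bigr => i _; rewrite mxE subr0. Qed.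

Lemma sqdistxx y : sqdist y y = 0.
Proof. by rewrite /sqdist big1// => i _; rewrite subrr expr0n. Qed.

Lemma sqdist_gt0 y x : x != y -> 0 < sqdist y x.
Proof.
move=> xy; rewrite lt0r sqdist_ge0 andbT; apply: contra xy => /eqP s0.
apply/eqP/rowP => i; apply/eqP; rewrite -subr_eq0 -sqrf_eq0.
by have := sqdist_coord y x i; rewrite s0 => h; rewrite eq_le h sqr_ge0.
Qed.

Lemma sqdist_triangle z y x : sqdist y x <= 2 * sqdist y z + 2 * sqdist z x.
Proof.
rewrite /sqdist !mulr_sumr -big_split/=; apply: ler_sum => i _.
have := sqr_ge0 (x ord0 i - z ord0 i - (z ord0 i - y ord0 i)); nra.
Qed.

(** Young's inequality in each coordinate; the difference of the sides is a square. A large or a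
    small [e] keeps one of the coefficients close to 1, which matters for balls that come near the
    origin or the edge of an annulus. *)
Lemma sqdist_triangle_wgt (e : R) z y x : 0 < e ->
  sqdist y x <= (1 + e) * sqdist y z + (1 + e^-1) * sqdist z x.
Proof.
move=> e0; rewrite /sqdist !mulr_sumr -big_split/=; apply: ler_sum => i _.
set a := z ord0 i - y ord0 i; set b := x ord0 i - z ord0 i.
have -> : x ord0 i - y ord0 i = a + b by rewrite /a /b; ring.
rewrite -subr_ge0 (_ : _ - _ = e * (a - e^-1 * b) ^+ 2).
  by rewrite mulr_ge0 ?sqr_ge0// ltW.
by field; rewrite gt_eqF.
Qed.

Lemma norm_sqdist y x (r : R) : 0 <= r -> sqdist y x <= r ^+ 2 -> `|x - y| <= r.
Proof.
move=> r0 h; apply: rV_norm_le => // i; rewrite !mxE.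
rewrite -(@ler_pXn2r _ 2)// ?nnegrE// real_normK ?num_real//.
exact: le_trans (sqdist_coord _ _ _) h.
Qed.

Lemma sqdist_norm y x : sqdist y x <= n%:R * `|x - y| ^+ 2.
Proof.
rewrite /sqdist; apply: (@le_trans _ _ (\sum_(i < n) `|x - y| ^+ 2)); last first.
  by rewrite sumr_const card_ord mulr_natl.
apply: ler_sum => i _.
rewrite -[leLHS]real_normK ?num_real// ler_pXn2r ?nnegrE//.
by have := rV_norm_coord (x - y) i; rewrite !mxE.
Qed.

Lemma is_derive_coord x i j :
  is_derive x (delta_mx ord0 i) (fun z => z ord0 j) (j == i)%:R.
Proof.
apply/is_derive_line; under eq_fun do rewrite !mxE/=.
have h : is_derive (0 : R) 1 (fun s : R => s * (j == i)%:R + x ord0 j) ((j == i)%:R *: 1 + 0).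
  apply: is_deriveD.
  by apply: (is_derive_eq (is_deriveM (is_derive_id _ _) (is_derive_cst _ _ _))); rewrite scaler0 add0r.
by apply: (is_derive_eq h); rewrite addr0 /GRing.scale/= mulr1.
Qed.

Lemma is_derive_sqdist y x i :
  is_derive x (delta_mx ord0 i) (sqdist y) (2 * (x ord0 i - y ord0 i)).
Proof.
have h (j : 'I_n) : is_derive x (delta_mx ord0 i)
    (fun z : 'rV[R]_n => (z ord0 j - y ord0 j) ^+ 2)
    ((j == i)%:R * (2 * (x ord0 j - y ord0 j))).
  have h1 := is_deriveB (is_derive_coord x i j) (is_derive_cst (y ord0 j) x (delta_mx ord0 i)).
  have h2 := is_deriveX 2 h1.
  apply: (is_derive_eq h2).
  by rewrite [LHS](_ : _ = 2 * (x ord0 j - y ord0 j) ^+ 1 * ((j == i)%:R - 0))//; ring.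
have h0 := is_derive_sum h.
rewrite /sqdist (_ : (fun _ => _) =
    \sum_(j < n) (fun z : 'rV[R]_n => (z ord0 j - y ord0 j) ^+ 2)); last first.
  by apply/funext => z; rewrite fct_sumE.
apply: (is_derive_eq h0).
rewrite (bigD1 i)//= eqxx mul1r big1 ?addr0// => j /negPf ->.
by rewrite mul0r.
Qed.

Lemma continuous_sqdist y : continuous (sqdist y).
Proof.
move=> x; apply: continuous_sum_fun => j.
rewrite (_ : (fun _ => _) = (fun z : 'rV[R]_n => (z ord0 j - y ord0 j) * (z ord0 j - y ord0 j)))//.
by apply: continuousM; (apply: continuousB; [exact: coord_continuous|exact: cst_continuous]).
Qed.

Lemma closed_sqdist_le y (r : R) : closed [set x | sqdist y x <= r].
Proof.
rewrite (_ : [set _ | _] = sqdist y @^-1` `]-oo, r]); last first.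
  by apply/seteqP; split => x; rewrite /= in_itv.
by apply: (continuous_closedP _).1; [exact: continuous_sqdist|exact: interval_closed].
Qed.

Lemma closed_sqdist_ge y (r : R) : closed [set x | r <= sqdist y x].
Proof.
rewrite (_ : [set _ | _] = sqdist y @^-1` `[r, +oo[); last first.
  by apply/seteqP; split => x; rewrite /= in_itv/= andbT.
by apply: (continuous_closedP _).1; [exact: continuous_sqdist|exact: interval_closed].
Qed.

Lemma open_sqdist_lt y (r : R) : open [set x | sqdist y x < r].
Proof.
rewrite (_ : [set _ | _] = sqdist y @^-1` `]-oo, r[); last first.
  by apply/seteqP; split => x; rewrite /= in_itv.
by apply: (continuousP _).1; [exact: continuous_sqdist|exact: interval_open].
Qed.

Lemma compact_sqdist_le y (r : R) : compact [set x | sqdist y x <= r].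
Proof.
apply: (@bounded_closed_compact_rV _ _ _ (`|y| + (1 + `|r|))).
  move=> x /= xr; have : `|x - y| <= 1 + `|r|.
    apply: norm_sqdist; first by rewrite addr_ge0.
    apply: (le_trans xr); have := ler_norm r; have := normr_ge0 r; nra.
  have : `|x| <= `|y| + `|x - y| by rewrite -{1}(subrKC y x) ler_normD.
  lra.
exact: closed_sqdist_le.
Qed.

End sqdist.

Lemma continuous_ext0 (R : realType) (n : nat) (f : 'rV[R]_n -> R) (S D : set 'rV[R]_n) :
  closed S -> S `<=` D -> (forall x, D x -> {for x, continuous f}) ->
  (forall x, ~ S x -> f x = 0) -> continuous f.
Proof.
move=> cS SD cf f0 x; have [/SD/cf//|nSx] := pselect (S x).
have nS : nbhs x (~` S).
  by apply: open_nbhs_nbhs; split => //; exact: closed_openC.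
have h : \near x, f x = 0 by apply: filterS nS => z /f0.
by rewrite /continuous_at f0//; exact: (@cvg_near_cst _ _ 0 f (nbhs x) _ h).
Qed.

(** * Green's identity against a test function *)

Section green.
Context {R : realType} {n : nat}.
Variables (D : set 'rV[R]_n) (u : 'rV[R]_n -> R) (u1 u2 : 'I_n -> 'rV[R]_n -> R).
Hypothesis cu : forall x, D x -> {for x, continuous u}.
Hypothesis cu1 : forall i x, D x -> {for x, continuous (u1 i)}.
Hypothesis cu2 : forall i x, D x -> {for x, continuous (u2 i)}.
Hypothesis du : forall i x, D x -> is_derive x (delta_mx ord0 i) u (u1 i x).
Hypothesis du1 : forall i x, D x -> is_derive x (delta_mx ord0 i) (u1 i) (u2 i x).

(** The field [w i = phi * u1 i - u * partial i phi] has divergence [sum g], the difference of the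
    two integrands up to sign. It is continuous and differentiable everywhere, although [u] is
    controlled only on [D], because it vanishes off the support of [phi]; so each [g i] has integral
    0. *)
Lemma green_identity (phi : 'rV[R]_n -> R) : test_function D phi ->
  (\int[lebesgue_rV n]_(x in D) (u x * - laplacian phi x)%:E =
   \int[lebesgue_rV n]_(x in D) ((- \sum_i u2 i x) * phi x)%:E)%E.
Proof.
move=> [sphi cS SD]; set S := closure _ in cS SD.
have clS : closed S by exact: closed_closure.
have nearS x : ~ S x -> \near x, phi x = 0.
  move=> nSx; have : nbhs x (~` S).
    by apply: open_nbhs_nbhs; split => //; exact: closed_openC.
  apply: filterS => z nSz; apply: contrapT => /eqP phiz.
  by apply: nSz; apply: subset_closure.
have phi0 x : ~ S x -> phi x = 0 by move=> /nearS/nbhs_singleton.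
have near_partial (f : 'rV[R]_n -> R) i x : ~ S x -> (forall z, ~ S z -> f z = 0) ->
    partial i f x = 0.
  move=> nSx f0; rewrite /partial (@near_eq_derive _ _ _ f (cst 0)) ?derive_cst//.
  have : nbhs x (~` S) by apply: open_nbhs_nbhs; split => //; exact: closed_openC.
  by apply: filterS => z /f0.
have p1 i x : ~ S x -> partial i phi x = 0 by move=> nSx; exact: near_partial.
have p2 i x : ~ S x -> partial i (partial i phi) x = 0.
  by move=> nSx; apply: near_partial => // z; exact: p1.
have [cphi dphi] := sphi [::]; rewrite /= in cphi dphi.
have cphi1 i : continuous (partial i phi) by have [] := sphi [:: i].
have dphi1 i x : derivable (partial i phi) x (delta_mx ord0 i) by have [_] := sphi [:: i]; apply.
have cphi2 i : continuous (partial i (partial i phi)) by have [] := sphi [:: i; i].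
pose w i x := phi x * u1 i x - u x * partial i phi x.
pose g i x := phi x * u2 i x - u x * partial i (partial i phi) x.
have cw i : continuous (w i).
  apply: (continuous_ext0 clS SD) => [x Dx|x nSx]; last first.
    by rewrite /w phi0// p1// mul0r mulr0 subr0.
  apply: continuousB; apply: continuousM; by [exact: cphi|exact: cu1|exact: cu|exact: cphi1].
have cg i : continuous (g i).
  apply: (continuous_ext0 clS SD) => [x Dx|x nSx]; last first.
    by rewrite /g phi0// p2// mul0r mulr0 subr0.
  apply: continuousB; apply: continuousM; by [exact: cphi|exact: cu2|exact: cu|exact: cphi2].
have dw i x : is_derive x (delta_mx ord0 i) (w i) (g i x).
  have [Sx|nSx] := pselect (S x).
    have h1 := is_deriveM (derivableP (dphi i x)) (du1 i (SD _ Sx)).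
    have h2 := is_deriveM (du i (SD _ Sx)) (derivableP (dphi1 i x)).
    have h := is_deriveB h1 h2.
    apply: (is_derive_eq h); rewrite /g /partial /GRing.scale/=; ring.
  rewrite /g phi0// p2// mul0r mulr0 subr0.
  have d0 : is_derive x (delta_mx ord0 i) (cst (0 : R)) (0 : R) := is_derive_cst _ _ _.
  apply: (near_eq_is_derive _ d0).
  have nS : nbhs x (~` S) by apply: open_nbhs_nbhs; split => //; exact: closed_openC.
  by apply: (@filterS _ (nbhs x) _ _ _ _ nS) => z nSz; rewrite /w phi0// p1// mul0r mulr0 subr0.
have pw i : partial i (w i) = g i.
  by apply/funext => x; rewrite /partial; apply: derive_val.
have [M M0 SM] := compact_bounded_rV cS.
have ig i : (lebesgue_rV n).-integrable setT (EFin \o g i).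
  by apply: (integrable_compact_support cS) => // x nSx; rewrite /g phi0// p2// mul0r mulr0 subr0.
have Ig i : (\int[lebesgue_rV n]_x (g i x)%:E = 0)%E.
  rewrite -pw; apply: (@integral_partial _ _ i (w i) M) => //.
  - by rewrite pw.
  - move=> x Mx; have nSx : ~ S x by move=> /SM; rewrite leNgt Mx.
    by rewrite /w phi0// p1// mul0r mulr0 subr0.
pose B x := (- \sum_i u2 i x) * phi x.
have cB : continuous B.
  apply: (continuous_ext0 clS SD) => [x Dx|x nSx]; last by rewrite /B phi0// mulr0.
  apply: continuousM; last exact: cphi.
  by apply: continuousN; apply: continuous_sum_fun => i; exact: cu2.
have iB : (lebesgue_rV n).-integrable setT (EFin \o B).
  by apply: (integrable_compact_support cS) => // x nSx; rewrite /B phi0// mulr0.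
have toT (f : 'rV[R]_n -> R) : (forall x, ~ S x -> f x = 0) ->
    (\int[lebesgue_rV n]_(x in D) (f x)%:E = \int[lebesgue_rV n]_x (f x)%:E)%E.
  move=> f0; rewrite integral_mkcond; apply: eq_integral => x _.
  rewrite patchE; case: ifPn => //; rewrite notin_setE => nDx.
  by rewrite f0// => /SD.
have lap0 x : ~ S x -> laplacian phi x = 0.
  by move=> nSx; rewrite /laplacian big1// => i _; exact: p2.
rewrite !toT; last 2 first.
- by move=> x nSx; rewrite phi0// mulr0.
- by move=> x nSx; rewrite lap0// oppr0 mulr0.
transitivity (\int[lebesgue_rV n]_x ((B x)%:E + \sum_(i < n) (g i x)%:E))%E.
  apply: eq_integral => x _; rewrite sumEFin -EFinD; congr EFin.
  rewrite /g sumrB -mulr_sumr -mulr_sumr /B /laplacian; ring.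
rewrite integralD//; last first.
  by apply: integrable_sum => // i _; exact: ig.
rewrite integral_sum//= big1 ?adde0//.
Qed.

End green.

Lemma powR_succ (R : realType) (s r : R) : 0 < s -> s `^ r = s * s `^ (r - 1).
Proof.
move=> s0; rewrite -[X in X * _]powRr1 ?ltW// -powRD ?subrKC//.
by apply/implyP => _; rewrite gt_eqF.
Qed.

(** * Existence of radial solutions *)
Section radial_solutions.
Context {R : realType} {n : nat}.
Variables (Omega : set 'rV[R]_n) (p a : R).
Hypotheses (n_gt0 : (0 < n)%N) (Omega_open : open Omega) (Omega_0 : Omega 0).
Local Notation D := (Omega `\ 0).

Lemma open_punctured : open D.
Proof.
apply: openI => //; apply: closed_openC; apply: compact_closed_rV; exact: compact_set1.
Qed.

Lemma punctured_sqdist x : D x -> 0 < sqdist 0 x.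
Proof. by move=> [_ /= x0]; apply: sqdist_gt0; apply/eqP. Qed.

Lemma continuous_locally_integrable (D' : set 'rV[R]_n) (f : 'rV[R]_n -> R) : open D' ->
  (forall x, D' x -> {for x, continuous f}) -> locally_integrable_rV D' f.
Proof.
move=> oD cf; split => // [|K KD cK]; first exact: open_continuous_measurable_fun_rV.
have mK := compact_measurable_rV cK.
have cnf : {within K, continuous (fun x => `|f x|)}.
  apply: continuous_in_subspaceT => x; rewrite inE => /KD/cf cfx.
  by apply: continuous_comp; [exact: cfx|exact: norm_continuous].
have [M fM] : exists M, forall x, K x -> `|f x| <= M.
  have [K0|K0] := pselect (K !=set0); last first.
    by exists 0 => x Kx; case: K0; exists x.
  have [c _ hc] := EVT_max_rV K0 cK cnf.
  by exists `|f c| => x Kx; apply: hc; rewrite inE.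
have : (lebesgue_rV n).-integrable K (EFin \o f).
  apply: measurable_bounded_integrable => //.
  - exact: lebesgue_rV_compact.
  - have : measurable_fun D' f by exact: open_continuous_measurable_fun_rV.
    by apply: measurable_funS => //; exact: open_measurable_rV.
  - exists M; split; first exact: num_real.
    by move=> e Me x Kx /=; rewrite (le_trans (fM x Kx))// ltW.
by move=> /integrableP[].
Qed.

Lemma punctured_not_negligible : ~ (lebesgue_rV n).-negligible D.
Proof.
have mD : measurable D by apply: open_measurable_rV; exact: open_punctured.
move=> /(@negligibleP _ _ _ (lebesgue_rV n) _ mD) D0.
have [e e0 eO] := open_normP Omega_open Omega_0.
(* All coordinates of points of the cube lie between [e / 4] and [3 * e / 4]: the cube avoids 0 and
   stays in the sup-norm ball of radius [e]. *)
pose y : 'rV[R]_n := \row_i (e / 2).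
have yD : cube y (e / 4) `<=` D.
  move=> x xc; split.
    apply: eO; apply: rV_norm_lt => // i; have := xc i; rewrite /= !mxE in_itv/= sub0r normrN.
    by rewrite ltr_norml; lra.
  move=> /= x0; have := xc (Ordinal n_gt0); rewrite /= x0 !mxE in_itv/=; lra.
have : (lebesgue_rV n (cube y (e / 4)) <= lebesgue_rV n D)%E.
  by apply: le_measure; rewrite ?inE//; exact: measurable_cube.
rewrite [X in (_ <= X)%E](_ : _ = 0%E)// lebesgue_rV_cube; last by lra.
by rewrite lee_fin leNgt exprn_gt0//; lra.
Qed.

Section profile.
Variables (H H1 H2 : R -> R) (lambda : R).
Hypothesis dH : forall s : R, 0 < s -> is_derive s 1 H (H1 s).
Hypothesis dH1 : forall s : R, 0 < s -> is_derive s 1 H1 (H2 s).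
Hypothesis cH2 : forall s : R, 0 < s -> {for s, continuous H2}.
Hypothesis lambda0 : 0 < lambda.
Hypothesis H_gt0 : forall x, D x -> 0 < H (sqdist 0 x).
Hypothesis H_ineq : forall x, D x ->
  lambda * enorm x `^ a * H (sqdist 0 x) `^ (p - 1) <=
  - (4 * sqdist 0 x * H2 (sqdist 0 x) + 2 * n%:R * H1 (sqdist 0 x)).

Let u x := H (sqdist (0 : 'rV[R]_n) x).
Let u1 (i : 'I_n) x := H1 (sqdist (0 : 'rV[R]_n) x) * (2 * x ord0 i).
Let u2 (i : 'I_n) x := H2 (sqdist (0 : 'rV[R]_n) x) * (2 * x ord0 i) ^+ 2
  + 2 * H1 (sqdist (0 : 'rV[R]_n) x).

Let comp_sqdist (h : R -> R) x : {for sqdist 0 x, continuous h} ->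
  {for x, continuous (fun x : 'rV[R]_n => h (sqdist 0 x))}.
Proof. by move=> ch; apply: continuous_comp; [exact: continuous_sqdist|exact: ch]. Qed.

Let cu x : D x -> {for x, continuous u}.
Proof.
move=> /punctured_sqdist/dH d; apply: comp_sqdist; exact: is_derive_continuous d.
Qed.

Let c2x i (x : 'rV[R]_n) : {for x, continuous (fun x : 'rV[R]_n => 2 * x ord0 i)}.
Proof. by apply: continuousM; [exact: cst_continuous|exact: coord_continuous]. Qed.

Let cu1 i x : D x -> {for x, continuous (u1 i)}.
Proof.
move=> /punctured_sqdist/dH1 d; apply: continuousM; last exact: c2x.
by apply: comp_sqdist; exact: is_derive_continuous d.
Qed.

Let cu2 i x : D x -> {for x, continuous (u2 i)}.
Proof.
move=> /punctured_sqdist x0; apply: continuousD; apply: continuousM.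
- by apply: comp_sqdist; exact: cH2.
- rewrite (_ : (fun _ => _) = (fun x : 'rV[R]_n => (2 * x ord0 i) * (2 * x ord0 i)))//.
  by apply: continuousM; exact: c2x.
- exact: cst_continuous.
- by apply: comp_sqdist; exact: is_derive_continuous (dH1 x0).
Qed.

Let dsq i x : is_derive x (delta_mx ord0 i) (sqdist (0 : 'rV[R]_n)) (2 * x ord0 i).
Proof. by apply: (is_derive_eq (is_derive_sqdist 0 x i)); rewrite mxE subr0. Qed.

Let du i x : D x -> is_derive x (delta_mx ord0 i) u (u1 i x).
Proof. by move=> /punctured_sqdist/dH d; exact: is_derive_comp1 (dsq i x) d. Qed.

Let du1 i x : D x -> is_derive x (delta_mx ord0 i) (u1 i) (u2 i x).
Proof.
move=> /punctured_sqdist/dH1 d.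
have h1 := is_derive_comp1 (dsq i x) d.
have h2 : is_derive x (delta_mx ord0 i) (fun x : 'rV[R]_n => 2 * x ord0 i) 2.
  by apply: (is_derive_eq (is_deriveZ 2 (is_derive_coord x i i))); rewrite eqxx /GRing.scale/= mulr1.
apply: (is_derive_eq (is_deriveM h1 h2)); rewrite /u2 /GRing.scale/=; ring.
Qed.

Let sum_u2 x : - \sum_i u2 i x =
  - (4 * sqdist 0 x * H2 (sqdist 0 x) + 2 * n%:R * H1 (sqdist 0 x)).
Proof.
congr (- _); rewrite /u2 big_split/= sumr_const card_ord -mulr_sumr.
rewrite -[X in _ + X]mulr_natl; congr (_ + _); last by ring.
rewrite [LHS]mulrC; congr (_ * _).
rewrite /sqdist mulr_sumr; apply: eq_bigr => i _.
by rewrite mxE subr0; ring.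
Qed.

Let cpow (s r : R) : 0 < s -> {for s, continuous (@powR R ^~ r)}.
Proof.
by move=> s0; exact: (@is_derive_continuous _ _ (fun s => r * s `^ (r - 1)) _ (is_derive1_powR r s0)).
Qed.

Let cup x r : D x -> {for x, continuous (fun x => u x `^ r)}.
Proof.
move=> Dx; apply: (@continuous_comp _ _ _ u (@powR R ^~ r)); first exact: cu.
by apply: cpow; exact: H_gt0.
Qed.

Let enormE r (x : 'rV[R]_n) : enorm x `^ r = sqdist 0 x `^ (r / 2).
Proof. by rewrite sqdist0E -powR12_sqrt ?sqdist_ge0// -powRrM mulrC. Qed.

(** With [u = v] the system is a single inequality. The Laplacian of [H (|x|^2)] is
    [4 s H'' + 2 n H'], and Green's identity turns the pointwise bound [H_ineq] into the weak
    one. *)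
Lemma radial_solution : distr_solution Omega p a u u.
Proof.
have oD := open_punctured; have mD := open_measurable_rV oD.
have ineq : distr_nlaplacian_ge D u (fun x => lambda * enorm x `^ a * u x `^ (p - 1)).
  move=> phi tphi phi0.
  rewrite (green_identity cu cu1 cu2 du du1 tphi).
  have [sphi _ _] := tphi; have [cphi _] := sphi [::]; rewrite /= in cphi.
  apply: ge0_le_integral => //.
  - by move=> x Dx; rewrite lee_fin !mulr_ge0 ?powR_ge0// ltW.
  - apply/measurable_EFinP; apply: open_continuous_measurable_fun_rV => // x Dx.
    apply: continuousM; last exact: cphi.
    apply: continuousM; last exact: cup.
    apply: continuousM; first exact: cst_continuous.
    rewrite (_ : (fun _ => _) = (fun x : 'rV[R]_n => sqdist 0 x `^ (a / 2))); last first.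
      by apply/funext => z; rewrite enormE.
    apply: (@comp_sqdist (@powR R ^~ (a / 2))); apply: cpow; exact: punctured_sqdist.
  - apply/measurable_EFinP; apply: open_continuous_measurable_fun_rV => // x Dx.
    apply: continuousM; last exact: cphi.
    by apply: continuousN; apply: continuous_sum_fun => i; exact: cu2.
  - by move=> x Dx; rewrite lee_fin; apply: ler_wpM2r => //; rewrite sum_u2; exact: H_ineq.
have u0 x : D x -> 0 <= u x by move=> Dx; apply: ltW; exact: H_gt0.
split => //.
- move=> [u_ae _]; apply: punctured_not_negligible; apply: negligibleS u_ae => x Dx /= h.
  by have := H_gt0 Dx; rewrite -/(u x) h// ltxx.
- by split; exact: continuous_locally_integrable.
- by split; apply: continuous_locally_integrable => // x Dx; exact: cup.
- by exists lambda, lambda.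
Qed.

End profile.

Variable rho : R.
Hypothesis Omega_rho : forall x, Omega x -> sqdist 0 x <= rho.
Hypothesis rho1 : 1 <= rho.
Hypothesis p_gt1 : 1 < p.

Let enormE r (x : 'rV[R]_n) : enorm x `^ r = sqdist 0 x `^ (r / 2).
Proof. by rewrite sqdist0E -powR12_sqrt ?sqdist_ge0// -powRrM mulrC. Qed.

Let is_derive_powRZ (c r s : R) : 0 < s ->
  is_derive s 1 (fun s => c * s `^ r) (c * r * s `^ (r - 1)).
Proof.
move=> s0; apply: (is_derive_eq (is_deriveZ c (is_derive1_powR r s0))).
by rewrite /GRing.scale/= mulrA.
Qed.

Lemma solution_a_gtN2 : (3 <= n)%N -> - 2 < a -> exists u v, distr_solution Omega p a u v.
Proof.
move=> n3 a2; pose b := a / 2 + 1; have b0 : 0 < b by rewrite /b; lra.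
have n3' : 3 <= n%:R :> R by rewrite ler_nat.
(* This keeps [C - s^b] between 1 and [C] on [Omega]. The constant [mu] comes from the Laplacian
   [b (4 (b - 1) + 2 n) s^(b-1)] of [s^b], whose power [s^(b-1)] is |x|^a. *)
pose C := rho `^ b + 1; have C0 : 0 < C by rewrite ltr_wpDl ?powR_ge0.
pose mu := b * (4 * b - 4 + 2 * n%:R).
have mu0 : 0 < mu by rewrite mulr_gt0//; lra.
do 2 eexists; apply: (@radial_solution (fun s => C + - 1 * s `^ b) (fun s => - 1 * b * s `^ (b - 1))
  (fun s => - 1 * b * (b - 1) * s `^ (b - 1 - 1)) (mu / C `^ (p - 1))).
- move=> s s0; apply: (is_derive_eq (is_deriveD (is_derive_cst C s 1) (is_derive_powRZ (-1) b s0))).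
  by rewrite add0r.
- by move=> s s0; exact: is_derive_powRZ.
- move=> s s0; exact: (@is_derive_continuous _ _ (fun s => (- 1 * b * (b - 1)) * (b - 1 - 1) * s `^ (b - 1 - 1 - 1)) _ (is_derive_powRZ _ _ s0)).
- by rewrite divr_gt0 ?powR_gt0.
- move=> x Dx; have x0 := punctured_sqdist Dx.
  have : sqdist 0 x `^ b <= rho `^ b.
    apply: ge0_ler_powR; rewrite ?nnegrE ?sqdist_ge0 ?(ltW b0)//.
      exact: le_trans rho1.
    by apply: Omega_rho; case: Dx.
  rewrite /C; lra.
- move=> x Dx; have x0 := punctured_sqdist Dx.
  rewrite enormE; set s := sqdist 0 x in x0 *.
  have sb : s `^ (b - 1) = s * s `^ (b - 1 - 1).
    exact: powR_succ.
  have -> : - (4 * s * (- 1 * b * (b - 1) * s `^ (b - 1 - 1)) + 2 * n%:R * (- 1 * b * s `^ (b - 1)))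
    = mu * s `^ (b - 1) by rewrite /mu sb; ring.
  have -> : a / 2 = b - 1 by rewrite /b; ring.
  rewrite mulrAC ler_wpM2r ?powR_ge0// -mulrA ler_piMr ?(ltW mu0)//.
  rewrite mulrC ler_pdivrMr ?powR_gt0// mul1r.
  have hC : C + - 1 * s `^ b <= C by have := powR_ge0 s b; lra.
  have : s `^ b <= rho `^ b.
    apply: ge0_ler_powR; rewrite ?nnegrE ?(ltW x0) ?(ltW b0)//.
      exact: le_trans rho1.
    by apply: Omega_rho; case: Dx.
  move=> srho; apply: ge0_ler_powR; [by rewrite subr_ge0 ltW|by rewrite nnegrE /C; lra|by rewrite nnegrE ltW|exact: hC].
Qed.

(** For [u = s^(-sg)], [- laplacian u = mu s^(-sg-1)] with [mu > 0] because [2 sg < n - 2]. The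
    right-hand side is [s^(-sg-1)] times [s^e] up to a constant, and [s^e <= rho^e] on the bounded
    set since [e >= 0]. *)
Lemma solution_negative_power (sg : R) : 0 < sg -> 2 * sg < n%:R - 2 ->
  0 <= a / 2 + 1 + sg * (2 - p) -> exists u v, distr_solution Omega p a u v.
Proof.
move=> sg0 sgn e0; set e := a / 2 + 1 + _ in e0.
pose mu := 2 * sg * (n%:R - 2 - 2 * sg).
have mu0 : 0 < mu by rewrite !mulr_gt0//; lra.
have rho0 : 0 < rho by exact: lt_le_trans rho1.
do 2 eexists; apply: (@radial_solution (fun s => 1 * s `^ (- sg)) (fun s => 1 * - sg * s `^ (- sg - 1))
  (fun s => 1 * - sg * (- sg - 1) * s `^ (- sg - 1 - 1)) (mu / rho `^ e)).
- by move=> s s0; exact: is_derive_powRZ.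
- by move=> s s0; exact: is_derive_powRZ.
- move=> s s0; exact: (@is_derive_continuous _ _ (fun s => (1 * - sg * (- sg - 1)) * (- sg - 1 - 1) * s `^ (- sg - 1 - 1 - 1)) _ (is_derive_powRZ _ _ s0)).
- by rewrite divr_gt0 ?powR_gt0.
- by move=> x /punctured_sqdist x0; rewrite mul1r powR_gt0.
- move=> x Dx; have x0 := punctured_sqdist Dx.
  rewrite enormE; set s := sqdist 0 x in x0 *.
  have sb : s `^ (- sg - 1) = s * s `^ (- sg - 1 - 1).
    exact: powR_succ.
  rewrite (_ : - (_ + _) = mu * s `^ (- sg - 1)); last by rewrite /mu sb; ring.
  rewrite mul1r -powRrM -[leLHS]mulrA -powRD; last by apply/implyP => _; rewrite gt_eqF.
  have -> : a / 2 + - sg * (p - 1) = e + (- sg - 1) by rewrite /e; ring.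
  rewrite (@powRD _ s); last by apply/implyP => _; rewrite gt_eqF.
  rewrite mulrA ler_wpM2r ?powR_ge0// -mulrA ler_piMr ?(ltW mu0)//.
  rewrite mulrC ler_pdivrMr ?powR_gt0// mul1r.
  apply: ge0_ler_powR; rewrite ?nnegrE ?(ltW x0) ?(ltW rho0)//.
  by apply: Omega_rho; case: Dx.
Qed.

Lemma solution_exists : (3 <= n)%N ->
  [\/ 2 < p /\ - 2 < a,
      p = 2 /\ - 2 <= a |
      [/\ 1 < p < 2, - n%:R < a & p < critical_exponent n a]] ->
  exists u v, distr_solution Omega p a u v.
Proof.
move=> n3 cond; have n3' : 3 <= n%:R :> R by rewrite ler_nat.
have [a2|a2] := ltP (- 2) a; first exact: solution_a_gtN2.
case: cond => [[_]|[p2 a2']|[/andP[_ p2] _]].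
- by rewrite ltNge a2.
(* Now [a = -2] and [p = 2], so the exponent is 0 for every [sg]; the midpoint of the allowed
   interval is taken. *)
- apply: (@solution_negative_power ((n%:R - 2) / 4)); rewrite ?p2; lra.
- rewrite /critical_exponent ltr_pdivlMr; last by lra.
  (* [s0] is the value of [sg] where the exponent vanishes, and [p < p_a] says that it lies below
     [(n - 2) / 2]. Any value in between serves; the midpoint is taken. *)
  move=> pc; pose s0 := - (a / 2 + 1) / (2 - p).
  have s00 : 0 <= s0 by rewrite divr_ge0//; lra.
  have s0E : s0 * (2 - p) = - (a / 2 + 1) by rewrite /s0 divfK// gt_eqF//; lra.
  have s0n : s0 < (n%:R - 2) / 2 by rewrite /s0 ltr_pdivrMr; lra.
  apply: (@solution_negative_power ((s0 + (n%:R - 2) / 2) / 2)); [lra|lra|].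
  have : s0 * (2 - p) <= (s0 + (n%:R - 2) / 2) / 2 * (2 - p) by apply: ler_wpM2r; lra.
  by rewrite s0E; lra.
Qed.

End radial_solutions.

(** * Radial test functions *)
Section smooth1.
Context {R : realType}.
Implicit Types (f g : R -> R).

Fixpoint class_C (k : nat) f : Prop :=
  if k is k'.+1 then (forall x : R, derivable f x 1) /\ class_C k' (derive1 f)
  else continuous f.

Definition smooth1 f := forall k, class_C k f.

Lemma derivable_continuous1 f : (forall x : R, derivable f x 1) -> continuous f.
Proof. by move=> df x; apply: differentiable_continuous; exact/derivable1_diffP. Qed.

Lemma class_C_pred k f : class_C k.+1 f -> class_C k f.
Proof.
elim: k f => [|k IH] f [df Cf]; first exact: derivable_continuous1.
by split => //; exact: IH.
Qed.

Lemma smooth1_derive f : smooth1 f -> smooth1 (derive1 f).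
Proof. by move=> sf k; have [_] := sf k.+1. Qed.

Lemma smooth1_is_derive f (x : R) : smooth1 f -> is_derive x 1 f (derive1 f x).
Proof. by move=> sf; rewrite derive1E; apply: derivableP; have [+ _] := sf 1%N; apply. Qed.

Lemma smooth1_continuous f : smooth1 f -> continuous f.
Proof. by move=> /(_ O). Qed.

Lemma derive1_ext f f' : (forall x : R, is_derive x 1 f (f' x)) -> derive1 f = f'.
Proof. by move=> df; apply/funext => x; rewrite derive1E; exact: derive_val. Qed.

Lemma class_C_intro k f f' : (forall x : R, is_derive x 1 f (f' x)) ->
  class_C k f' -> class_C k.+1 f.
Proof.
move=> df Cf; split; last by rewrite (derive1_ext df).
by move=> x; exact: (@ex_derive _ _ _ _ _ _ _ (df x)).
Qed.

Lemma class_CD k f g : class_C k f -> class_C k g -> class_C k (fun x => f x + g x).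
Proof.
elim: k f g => [|k IH] f g.
  by move=> cf cg x; apply: continuousD; [exact: cf|exact: cg].
move=> [df Cf] [dg Cg].
apply: (@class_C_intro _ _ (fun x => derive1 f x + derive1 g x)); last exact: IH.
by move=> x; rewrite !derive1E; apply: is_deriveD; exact: derivableP.
Qed.

Lemma class_CM k f g : class_C k f -> class_C k g -> class_C k (fun x => f x * g x).
Proof.
elim: k f g => [|k IH] f g.
  by move=> cf cg x; apply: continuousM; [exact: cf|exact: cg].
move=> Cf Cg; have [df Cf'] := Cf; have [dg Cg'] := Cg.
apply: (@class_C_intro _ _ (fun x => f x * derive1 g x + g x * derive1 f x)).
  move=> x; rewrite !derive1E.
  by apply: (is_derive_eq (is_deriveM (derivableP (df x)) (derivableP (dg x)))).
by apply: class_CD; apply: IH => //; exact: class_C_pred.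
Qed.

Lemma class_C_comp k f g : class_C k f -> class_C k g -> class_C k (fun x => f (g x)).
Proof.
elim: k f g => [|k IH] f g.
  by move=> cf cg x; apply: continuous_comp; [exact: cg|exact: cf].
move=> [df Cf'] Cg; have [dg Cg'] := Cg.
apply: (@class_C_intro _ _ (fun x => derive1 f (g x) * derive1 g x)).
  move=> x; rewrite !derive1E.
  exact: (is_derive1_comp (derivableP (df (g x))) (derivableP (dg x))).
by apply: class_CM => //; apply: IH => //; exact: class_C_pred.
Qed.

Lemma smooth1_cst (c : R) : smooth1 (cst c).
Proof.
move=> k; elim: k c => [|k IH] c; first exact: cst_continuous.
by apply: (@class_C_intro _ _ (cst 0)) => // x; exact: is_derive_cst.
Qed.

Lemma smooth1_id : smooth1 id.
Proof.
case=> [|k]; first by move=> x; exact: cvg_id.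
by apply: (@class_C_intro _ _ (cst 1)); exact: smooth1_cst.
Qed.

Lemma smooth1D f g : smooth1 f -> smooth1 g -> smooth1 (fun x => f x + g x).
Proof. by move=> sf sg k; exact: class_CD. Qed.

Lemma smooth1M f g : smooth1 f -> smooth1 g -> smooth1 (fun x => f x * g x).
Proof. by move=> sf sg k; exact: class_CM. Qed.

Lemma smooth1_comp f g : smooth1 f -> smooth1 g -> smooth1 (fun x => f (g x)).
Proof. by move=> sf sg k; exact: class_C_comp. Qed.

(** Differentiating [exp (-1/s)] brings out powers of [1/s]. With the parameter [m] the family is
    closed under differentiation up to linear combinations, so smoothness follows by an induction
    over all [m] at once. *)
Definition flat_pow (m : nat) (s : R) : R := if 0 < s then s ^- m * expR (- s^-1) else 0.

Definition flat := flat_pow 0.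

Lemma flat_powE m (s : R) : 0 < s -> flat_pow m s = s ^- m * expR (- s^-1).
Proof. by rewrite /flat_pow => ->. Qed.

Lemma flat_pow_le0 m (s : R) : s <= 0 -> flat_pow m s = 0.
Proof. by rewrite /flat_pow ltNge => ->. Qed.

Lemma flat_pow_ge0 m (s : R) : 0 <= flat_pow m s.
Proof.
rewrite /flat_pow; case: ifPn => // s0; rewrite mulr_ge0 ?expR_ge0// invr_ge0 exprn_ge0//.
exact: ltW.
Qed.

Lemma flat_pow_gt0 m (s : R) : 0 < s -> 0 < flat_pow m s.
Proof. by move=> s0; rewrite flat_powE// mulr_gt0 ?expR_gt0// invr_gt0 exprn_gt0. Qed.

Lemma exprn_le_expR (k : nat) (y : R) : 0 <= y -> y ^+ k.+1 <= k.+1`!%:R * expR y.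
Proof.
move=> y0; have := expR_ge1Dxn k y0; rewrite -ler_pdivrMl ?ltr0n ?fact_gt0// mulrC.
by apply: le_trans; rewrite lerDr.
Qed.

(** The exponential series at [1/s] dominates its term of degree [m + 2]. The quadratic bound makes
    the difference quotient at 0 vanish. *)
Lemma flat_pow_bound m (s : R) : `|flat_pow m s| <= m.+2`!%:R * s ^+ 2.
Proof.
rewrite ger0_norm ?flat_pow_ge0//; have [s0|s0] := leP s 0.
  by rewrite flat_pow_le0// mulr_ge0 ?sqr_ge0.
rewrite flat_powE// -ler_pdivrMr ?exprn_gt0//.
rewrite mulrAC -invfM -exprD addn2 expRN ler_pdivrMr ?expR_gt0// -exprVn.
by apply: exprn_le_expR; rewrite invr_ge0 ltW.
Qed.

Lemma is_derive_flat_pow m (s : R) :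
  is_derive s 1 (flat_pow m) (- m%:R * flat_pow m.+1 s + flat_pow m.+2 s).
Proof.
have [s0|s0|->] := ltgtP s 0.
- rewrite !flat_pow_le0 ?(ltW s0)// mulr0 addr0.
  apply: (near_eq_is_derive _ (is_derive_cst (0 : R) s 1)).
  have : \forall z \near s, z < 0 by exact: lt_nbhsl.
  by apply: filterS => z z0; rewrite flat_pow_le0// ltW.
- have h : is_derive s 1 (fun s : R => s ^- m * expR (- s^-1))
      (- m%:R * flat_pow m.+1 s + flat_pow m.+2 s).
    have sn : s != 0 by rewrite gt_eqF.
    have d1 : is_derive s 1 (fun z : R => z^-1) (- s ^- 2).
      by apply: (is_derive_eq (is_deriveV sn (is_derive_id _ _))); rewrite /GRing.scale/= mulr1.
    have d2 := is_deriveN d1.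
    have d3 := is_derive1_comp (is_derive_expR _) d2.
    have d4 := is_derive1_comp (DeriveDef (@exprn_derivable R m s^-1 1) (@exp_derive R m s^-1 1)) d1.
    have d5 := is_deriveM d4 d3.
    have -> : (fun s : R => s ^- m * expR (- s^-1)) =
        ((@GRing.exp R ^~ m \o (fun z : R => z^-1)) * (expR \o (- (fun z : R => z^-1))))%R.
      by apply/funext => z; rewrite -exprVn.
    apply: (is_derive_eq d5); rewrite !flat_powE// [LHS](_ : _ =
      s^-1 ^+ m * (expR (- s^-1) * (- (- s ^- 2))) +
      expR (- s^-1) * (m%:R * s^-1 ^+ m.-1 * 1 * (- s ^- 2)))//.
    rewrite -!exprVn; case: m {d4 d5} => [|m]; first by rewrite !expr0; ring.
    by rewrite !exprS /=; ring.
  apply: (near_eq_is_derive _ h).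
  have : \forall z \near s, 0 < z by exact: lt_nbhsr.
  by apply: filterS => z z0; rewrite flat_powE.
- rewrite !flat_pow_le0// mulr0 addr0.
  have h : h^-1 *: ((flat_pow m \o shift 0) (h *: (1 : R)) - flat_pow m 0) @[h --> (0 : R)^'] --> (0 : R).
    apply/cvgr0Pnorm_le => e e0; near=> h.
    have h0 : h != 0 by near: h; exact: nbhs_dnbhs_neq.
    rewrite /= addr0 (flat_pow_le0 _ (lexx 0)) subr0.
    have -> : h *: (1 : R) = h by exact: mulr1.
    rewrite normrM normfV.
    apply: (@le_trans _ _ (`|h|^-1 * (m.+2`!%:R * h ^+ 2))).
      by rewrite ler_wpM2l ?flat_pow_bound// invr_ge0.
    rewrite mulrCA -[h ^+ 2]real_normK ?num_real// expr2 mulKf ?normr_eq0//.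
    rewrite -ler_pdivlMl ?ltr0n ?fact_gt0//; near: h.
    by apply: dnbhs0_le; rewrite mulr_gt0// invr_gt0 ltr0n fact_gt0.
  by split; [apply/cvg_ex; exists 0|exact: cvg_lim].
Unshelve. all: end_near. Qed.

Lemma smooth1_flat_pow m : smooth1 (flat_pow m).
Proof.
move=> k; elim: k m => [|k IH] m.
  move=> x; exact: (@is_derive_continuous _ _ (fun s => - m%:R * flat_pow m.+1 s + flat_pow m.+2 s) _ (is_derive_flat_pow m x)).
apply: (class_C_intro (is_derive_flat_pow m)).
apply: class_CD; last exact: IH.
by apply: class_CM; [exact: smooth1_cst|exact: IH].
Qed.

Lemma flat_le1 (s : R) : flat s <= 1.
Proof.
have [s0|s0] := leP s 0; first by rewrite /flat flat_pow_le0.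
rewrite /flat flat_powE// expr0 invr1 mul1r -expR0 ler_expR oppr_le0 invr_ge0.
exact: ltW.
Qed.

Lemma le_flat : {homo flat : s t / s <= t}.
Proof.
move=> s t st; have [s0|s0] := leP s 0.
  by rewrite /flat (flat_pow_le0 _ s0) flat_pow_ge0.
have t0 := lt_le_trans s0 st.
by rewrite /flat !flat_powE// !expr0 invr1 !mul1r ler_expR lerN2 lef_pV2 ?posrE.
Qed.

End smooth1.

(** * Smooth functions of several variables *)

Section smooth_rV.
Context {R : realType} {n : nat}.
Implicit Types (f g : 'rV[R]_n -> R).

Fixpoint class_C_rV (k : nat) f : Prop :=
  if k is k'.+1 then [/\ continuous f,
    forall (i : 'I_n) x, derivable f x (delta_mx ord0 i) &
    forall i, class_C_rV k' (partial i f)]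
  else continuous f.

Lemma smooth_class_C f : (forall k, class_C_rV k f) -> smooth f.
Proof.
move=> Cf s; suff : forall k g, class_C_rV (size s + k) g ->
    class_C_rV k (iter_partial s g).
  by move=> /(_ 1%N f (Cf _))[].
(* [foldr] differentiates along the last index first, so the sequence is peeled off from its end. *)
elim/last_ind: s => [//|s i IH] k g; rewrite size_rcons addSn => -[_ _ /(_ i) Cg].
by rewrite /iter_partial foldr_rcons; exact: IH.
Qed.

Lemma class_C_rV_pred k f : class_C_rV k.+1 f -> class_C_rV k f.
Proof.
elim: k f => [|k IH] f [cf df Cf]; first exact: cf.
by split => // i; exact: IH.
Qed.

Lemma partial_ext i f f' : (forall x, is_derive x (delta_mx ord0 i) f (f' x)) ->
  partial i f = f'.
Proof. by move=> df; apply/funext => x; rewrite /partial; exact: derive_val. Qed.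

Lemma class_C_rV_intro k f (f' : 'I_n -> 'rV[R]_n -> R) : continuous f ->
  (forall i x, is_derive x (delta_mx ord0 i) f (f' i x)) ->
  (forall i, class_C_rV k (f' i)) -> class_C_rV k.+1 f.
Proof.
move=> cf df Cf; split => // i.
by rewrite (partial_ext (df i)).
Qed.

Lemma class_C_rVM k f g : class_C_rV k f -> class_C_rV k g ->
  class_C_rV k (fun x => f x * g x).
Proof.
have cM f1 g1 : continuous f1 -> continuous g1 ->
    continuous (fun x : 'rV[R]_n => f1 x * g1 x).
  by move=> cf cg x; apply: continuousM; [exact: cf|exact: cg].
have CD k' f1 g1 : class_C_rV k' f1 -> class_C_rV k' g1 ->
    class_C_rV k' (fun x => f1 x + g1 x).
  elim: k' f1 g1 => [|k' IH] f1 g1.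
    by move=> cf cg x; apply: continuousD; [exact: cf|exact: cg].
  move=> [cf df Cf] [cg dg Cg].
  apply: (@class_C_rV_intro _ _ (fun i x => partial i f1 x + partial i g1 x)).
  - by move=> x; apply: continuousD; [exact: cf|exact: cg].
  - by move=> i x; apply: is_deriveD; exact: derivableP.
  - by move=> i; apply: IH; [exact: Cf|exact: Cg].
elim: k f g => [|k IH] f g; first exact: cM.
move=> Cf Cg; have [cf df Cf'] := Cf; have [cg dg Cg'] := Cg.
apply: (@class_C_rV_intro _ _ (fun i x => f x * partial i g x + g x * partial i f x)).
- exact: cM.
- move=> i x.
  by apply: (is_derive_eq (is_deriveM (derivableP (df i x)) (derivableP (dg i x)))).
- move=> i; apply: CD; apply: IH.
  + exact: class_C_rV_pred Cf.
  + exact: Cg'.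
  + exact: class_C_rV_pred Cg.
  + exact: Cf'.
Qed.

Lemma class_C_rV_cst k (c : R) : class_C_rV k (cst c).
Proof.
elim: k c => [|k IH] c; first exact: cst_continuous.
apply: (@class_C_rV_intro _ _ (fun=> cst 0)) => //; exact: cst_continuous.
Qed.

(** A partial derivative is a function of the same kind, with [derive1 h] for [h], times an affine
    function; hence an induction on [k] over all smooth [h]. *)
Lemma class_C_rV_comp_sqdist k (h : R -> R) (b : R) (y : 'rV[R]_n) : smooth1 h ->
  class_C_rV k (fun x => h (b * sqdist y x)).
Proof.
have cb : continuous (fun x : 'rV[R]_n => b * sqdist y x).
  by move=> x; apply: continuousM; [exact: cst_continuous|exact: continuous_sqdist].
have cc (h1 : R -> R) : smooth1 h1 -> continuous (fun x : 'rV[R]_n => h1 (b * sqdist y x)).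
  by move=> sh x; apply: continuous_comp; [exact: cb|exact: smooth1_continuous].
elim: k h => [|k IH] h sh; first exact: cc.
apply: (@class_C_rV_intro _ _ (fun i x =>
    derive1 h (b * sqdist y x) * (b * (2 * (x ord0 i - y ord0 i))))); first exact: cc.
  move=> i x.
  have d1 := is_deriveZ b (is_derive_sqdist y x i).
  exact: (is_derive_comp1 d1 (smooth1_is_derive _ sh)).
move=> i; apply: class_C_rVM; first by apply: IH; exact: smooth1_derive.
have cl : continuous (fun x : 'rV[R]_n => b * (2 * (x ord0 i - y ord0 i))).
  move=> x; have c1 : {for x, continuous (fun x : 'rV[R]_n => x ord0 i - y ord0 i)}.
    by apply: continuousB; [exact: coord_continuous|exact: cst_continuous].
  have c2 : {for x, continuous (fun x : 'rV[R]_n => 2 * (x ord0 i - y ord0 i))}.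
    by apply: continuousM; [exact: cst_continuous|exact: c1].
  by apply: (continuousM _ c2); exact: cst_continuous.
case: k {IH} => [|k]; first exact: cl.
apply: (@class_C_rV_intro _ _ (fun j => cst (b * (2 * (i == j)%:R)))).
- exact: cl.
- move=> j x.
  have d1 := is_deriveB (is_derive_coord x j i) (is_derive_cst (y ord0 i) x (delta_mx ord0 j)).
  apply: (is_derive_eq (is_deriveZ b (is_deriveZ 2 d1))).
  by rewrite subr0.
- by move=> j; exact: class_C_rV_cst.
Qed.

Lemma test_function_radial (D K : set 'rV[R]_n) (h : R -> R) (b : R) (y : 'rV[R]_n) :
  smooth1 h -> compact K -> K `<=` D -> (forall x, h (b * sqdist y x) != 0 -> K x) ->
  test_function D (fun x => h (b * sqdist y x)).
Proof.
move=> sh cK KD hK.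
have SK : closure [set x | h (b * sqdist y x) != 0] `<=` K.
  by rewrite [X in _ `<=` X](closure_id K).1; [exact: closure_subset|exact: compact_closed_rV].
split; first by apply: smooth_class_C => k; exact: class_C_rV_comp_sqdist.
- by apply: subclosed_compact SK => //; exact: closed_closure.
- exact: subset_trans KD.
Qed.

Lemma laplacian_radial (h : R -> R) (b : R) (y x : 'rV[R]_n) : smooth1 h ->
  laplacian (fun x => h (b * sqdist y x)) x =
  b * (4 * (b * sqdist y x) * derive1 (derive1 h) (b * sqdist y x) +
       2 * n%:R * derive1 h (b * sqdist y x)).
Proof.
move=> sh.
have d1 i z : is_derive z (delta_mx ord0 i) (fun x => b * sqdist y x)
    (b * (2 * (z ord0 i - y ord0 i))) := is_deriveZ b (is_derive_sqdist y z i).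
have p1 i : partial i (fun x => h (b * sqdist y x)) =
    (fun x => derive1 h (b * sqdist y x) * (b * (2 * (x ord0 i - y ord0 i)))).
  by apply: partial_ext => z; exact: (is_derive_comp1 (d1 i z) (smooth1_is_derive _ sh)).
have p2 i z : partial i (partial i (fun x => h (b * sqdist y x))) z =
    derive1 (derive1 h) (b * sqdist y z) * (b * (2 * (z ord0 i - y ord0 i))) ^+ 2 +
    2 * b * derive1 h (b * sqdist y z).
  rewrite p1; have e1 := is_derive_comp1 (d1 i z)
    (smooth1_is_derive (b * sqdist y z) (smooth1_derive sh)).
  have e2 := is_deriveZ b (is_deriveZ 2 (is_deriveB (is_derive_coord z i i)
    (is_derive_cst (y ord0 i) z (delta_mx ord0 i)))).
  rewrite /partial (derive_val (is_derive := is_deriveM e1 e2)).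
  rewrite eqxx subr0 [LHS](_ : _ = derive1 h (b * sqdist y z) * (b * (2 * 1)) +
    (b * (2 * (z ord0 i - y ord0 i))) *
    (derive1 (derive1 h) (b * sqdist y z) * (b * (2 * (z ord0 i - y ord0 i)))))//.
  ring.
rewrite /laplacian; under eq_bigr do rewrite p2.
rewrite big_split/= sumr_const card_ord -mulr_sumr -[X in _ + X]mulr_natl.
rewrite (_ : \sum_(i < n) _ = 4 * b ^+ 2 * sqdist y x); first by ring.
by rewrite /sqdist mulr_sumr; apply: eq_bigr => i _; ring.
Qed.

End smooth_rV.

(** * Weighted means of superharmonic functions *)
Section weighted_means.
Context {R : realType} {n : nat}.
Implicit Types (D K : set 'rV[R]_n) (u g : 'rV[R]_n -> R) (chi : R -> R) (y : 'rV[R]_n).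
Local Notation leb := (lebesgue_rV n).

(** Meant for functions extended by 0 outside [D]: measurability and integrals refer to the whole
    space, whereas integrability is asked only on compact subsets of [D]. *)
Definition admissible D u := [/\ measurable_fun setT u, forall x, 0 <= u x &
  forall K, compact K -> K `<=` D -> (\int[leb]_(x in K) (u x)%:E < +oo)%E].

Definition superharmonic D u := forall phi, test_function D phi ->
  (forall x, 0 <= phi x) -> 0 <= (\int[leb]_x (u x * - laplacian phi x))%R.

Lemma integrable_admissible D u K : admissible D u -> compact K -> K `<=` D ->
  leb.-integrable setT (EFin \o (u \_ K)).
Proof.
move=> [mu u0 ui] cK KD; have mK := compact_measurable_rV cK.
rewrite -restrict_EFin; apply/(integrable_mkcond _ mK)/integrableP; split.
  by apply/measurable_EFinP; exact: measurable_funTS.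
rewrite (eq_integral (EFin \o u)) => [|x _]; first exact: ui.
by rewrite /= ger0_norm.
Qed.

Lemma integrable_admissibleM D u g K M : admissible D u -> compact K -> K `<=` D ->
  measurable_fun setT g -> (forall x, `|g x| <= M) -> (forall x, ~ K x -> g x = 0) ->
  leb.-integrable setT (EFin \o (fun x => u x * g x)).
Proof.
move=> au cK KD mg gM g0; have [mu u0 _] := au.
have iK := integrable_admissible au cK KD.
apply: (le_integrable measurableT _ _ (integrableZl measurableT M iK)).
  by apply/measurable_EFinP; exact: measurable_funM.
move=> x _; rewrite /= lee_fin patchE; case: ifPn => [_|].
  rewrite normrM [leRHS]normrM mulrC; apply: ler_wpM2r => //.
  by rewrite (le_trans (gM x))// ler_norm.
by rewrite notin_setE => /g0 ->; rewrite mulr0 normr0.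
Qed.

(* The dilation of [chi] to the scale [|x - y|^2 ~ exp (-t)], with constant mass. *)
Definition wkernel chi y (t : R) x := expR (n%:R / 2 * t) * chi (expR t * sqdist y x).

Definition wmean u chi y (t : R) : R := (\int[leb]_x (u x * wkernel chi y t x))%R.

(* [d/dt] of [wkernel chi] is [wkernel (euler chi)]. *)
Definition euler chi (s : R) : R := n%:R / 2 * chi s + s * derive1 chi s.

Lemma bounded_vanishing (f : R -> R) (s1 : R) : continuous f ->
  (forall s, s1 < s -> f s = 0) -> exists2 M, 0 <= M & forall s, 0 <= s -> `|f s| <= M.
Proof.
move=> cf f0; have N0 : 0 <= `|s1| + 1 by rewrite addr_ge0.
have cnf : {within `[0, `|s1| + 1], continuous (fun s => `|f s|)}.
  apply: continuous_subspaceT => x.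
  by apply: continuous_comp; [exact: cf|exact: norm_continuous].
have [c _ hc] := EVT_max N0 cnf.
exists `|f c| => // s s0; have [sN|sN] := leP s (`|s1| + 1).
  by apply: hc; rewrite in_itv/= s0.
rewrite f0 ?normr0// (le_lt_trans (ler_norm s1))// (lt_trans _ sN)// ltrDl//.
Qed.

Lemma smooth1_euler chi : smooth1 chi -> smooth1 (euler chi).
Proof.
move=> sc; apply: smooth1D.
  by apply: smooth1M; [exact: smooth1_cst|exact: sc].
by apply: smooth1M; [exact: smooth1_id|exact: smooth1_derive].
Qed.

Lemma derive1_vanishing chi (U : set R) (s : R) : open U -> U s ->
  (forall z, U z -> chi z = 0) -> derive1 chi s = 0.
Proof.
move=> oU Us c0; rewrite derive1E (@near_eq_derive _ _ _ chi (cst 0)) ?derive_cst//.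
have : nbhs s U by exact: open_nbhs_nbhs.
by apply: filterS => z /c0.
Qed.

Lemma derive1_vanishing_gt chi (s1 : R) : (forall s, s1 < s -> chi s = 0) ->
  forall s, s1 < s -> derive1 chi s = 0.
Proof.
move=> c0 s s1s; apply: (@derive1_vanishing _ `]s1, +oo[).
- exact: interval_open.
- by rewrite /= in_itv/= s1s.
- by move=> z; rewrite /= in_itv/= andbT; exact: c0.
Qed.

Lemma euler_vanishing_gt chi (s1 : R) : (forall s, s1 < s -> chi s = 0) ->
  forall s, s1 < s -> euler chi s = 0.
Proof.
move=> c0 s s1s; rewrite /euler c0// (derive1_vanishing_gt c0)//.
by rewrite !mulr0 addr0.
Qed.

Lemma euler_vanishing_lt chi (s0 : R) : (forall s, 0 <= s < s0 -> chi s = 0) ->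
  forall s, 0 <= s < s0 -> euler chi s = 0.
Proof.
move=> c0 s /andP[s_ge0 ss0]; rewrite /euler c0 ?s_ge0// mulr0 add0r.
move: s_ge0; rewrite le_eqVlt => /predU1P[<-|s_gt0]; first by rewrite mul0r.
rewrite (@derive1_vanishing _ `]0, s0[) ?mulr0//.
- by rewrite /= in_itv/= s_gt0.
- by move=> z; rewrite /= in_itv/= => /andP[z0 zs]; apply: c0; rewrite ltW.
Qed.

Definition annulus y (a b : R) : set 'rV[R]_n := [set x | a <= sqdist y x <= b].

Lemma compact_annulus y a b : compact (annulus y a b).
Proof.
have sub : annulus y a b `<=` [set x | sqdist y x <= b] by move=> x /andP[].
apply: (subclosed_compact _ _ sub); last exact: compact_sqdist_le.
rewrite (_ : annulus y a b = [set x | a <= sqdist y x] `&` [set x | sqdist y x <= b]).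
  by apply: closedI; [exact: closed_sqdist_ge|exact: closed_sqdist_le].
by apply/seteqP; split => x /=; [move=> /andP[]|move=> [? ?]; apply/andP].
Qed.

Section derivative.
Variables (D : set 'rV[R]_n) (u : 'rV[R]_n -> R).
Hypothesis au : admissible D u.
Variables (y : 'rV[R]_n) (s0 s1 : R).
Hypotheses (s0_ge0 : 0 <= s0) (s1_ge0 : 0 <= s1).

Lemma continuous_wkernel chi t : continuous chi -> continuous (wkernel chi y t).
Proof.
move=> cc x.
have c1 : {for x, continuous (fun x => expR t * sqdist y x)}.
  by apply: continuousM; [exact: cst_continuous|exact: continuous_sqdist].
have c2 : {for x, continuous (fun x => chi (expR t * sqdist y x))}.
  by apply: (continuous_comp c1); exact: cc.
by apply: (continuousM _ c2); exact: cst_continuous.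
Qed.

Lemma wkernel_vanishing chi (t0 t1 t : R) x : (forall s, s1 < s -> chi s = 0) ->
  (forall s, 0 <= s < s0 -> chi s = 0) -> t0 <= t <= t1 ->
  ~ annulus y (s0 * expR (- t1)) (s1 * expR (- t0)) x -> wkernel chi y t x = 0.
Proof.
move=> c1 c0 /andP[t0t tt1] nK; rewrite /wkernel.
have [lt1|le1] := ltP s1 (expR t * sqdist y x); first by rewrite c1 ?mulr0.
have [lt0|le0] := ltP (expR t * sqdist y x) s0; first by rewrite c0 ?mulr0// mulr_ge0 ?expR_ge0 ?sqdist_ge0.
exfalso; apply: nK; apply/andP; rewrite !expRN; split.
- rewrite ler_pdivrMr ?expR_gt0// mulrC (le_trans le0)//.
  by rewrite ler_wpM2r ?sqdist_ge0// ler_expR.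
- rewrite ler_pdivlMr ?expR_gt0// mulrC (le_trans _ le1)//.
  by rewrite ler_wpM2r ?sqdist_ge0// ler_expR.
Qed.

Lemma integrable_wkernel chi (t : R) : continuous chi -> (forall s, s1 < s -> chi s = 0) ->
  (forall s, 0 <= s < s0 -> chi s = 0) ->
  annulus y (s0 * expR (- t)) (s1 * expR (- t)) `<=` D ->
  leb.-integrable setT (EFin \o (fun x => u x * wkernel chi y t x)).
Proof.
move=> cc c1 c0 KD; have [M M0 cM] := bounded_vanishing cc c1.
apply: (integrable_admissibleM (M := expR (n%:R / 2 * t) * M) au (@compact_annulus _ _ _) KD).
- by apply: continuous_measurable_fun_rV; exact: continuous_wkernel.
- move=> x; rewrite normrM ger0_norm ?expR_ge0// ler_wpM2l ?expR_ge0// cM//.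
  by rewrite mulr_ge0 ?expR_ge0 ?sqdist_ge0.
- by move=> x; apply: wkernel_vanishing; rewrite ?lexx.
Qed.

Lemma is_derive_wkernel chi x (t : R) : smooth1 chi ->
  is_derive t 1 (fun t => wkernel chi y t x) (wkernel (euler chi) y t x).
Proof.
move=> sc.
have d1 : is_derive t 1 (fun t => expR t * sqdist y x) (expR t * sqdist y x).
  apply: (is_derive_eq (is_deriveM (is_derive_expR t) (is_derive_cst (sqdist y x) t 1))).
  by rewrite scaler0 add0r /GRing.scale/= mulrC.
have d2 := @is_derive1_comp R chi (fun t => expR t * sqdist y x) t _ _
  (smooth1_is_derive (expR t * sqdist y x) sc) d1.
have d3 := is_deriveM (is_derive_expM (n%:R / 2) t) d2.
by apply: (is_derive_eq d3); rewrite /wkernel /euler /GRing.scale/=; ring.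
Qed.

(** For all scales between [t0] and [t1] the kernels live in one annulus [K], compact in [D], so a
    multiple of [u] on [K] dominates the derivative of the integrand. With [s0 = 0] the annulus is a
    ball. *)
Lemma is_derive_wmean chi (t0 t1 t : R) : smooth1 chi ->
  (forall s, s1 < s -> chi s = 0) -> (forall s, 0 <= s < s0 -> chi s = 0) ->
  annulus y (s0 * expR (- t1)) (s1 * expR (- t0)) `<=` D -> t0 < t < t1 ->
  is_derive t 1 (wmean u chi y) (wmean u (euler chi) y t).
Proof.
move=> sc c1 c0 KD tt.
have [mu u0 _] := au.
have se := smooth1_euler sc.
have [M M0 eM] := bounded_vanishing (smooth1_continuous se) (euler_vanishing_gt c1).
pose K := annulus y (s0 * expR (- t1)) (s1 * expR (- t0)).
have cK : compact K by exact: compact_annulus.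
have mK := compact_measurable_rV cK.
pose f (z : R) x := u x * wkernel chi y z x.
pose B := expR (n%:R / 2 * t1) * M.
have It : `]t0, t1[%classic t by rewrite /= in_itv.
pose G x := B * (u \_ K) x.
have Kz z : t0 < z < t1 -> annulus y (s0 * expR (- z)) (s1 * expR (- z)) `<=` K.
  move=> /andP[t0z zt1] x /andP[h1 h2]; apply/andP; split.
    by rewrite (le_trans _ h1)// ler_wpM2l// ler_expR lerN2 ltW.
  by rewrite (le_trans h2)// ler_wpM2l// ler_expR lerN2 ltW.
have intf z : `]t0, t1[%classic z -> leb.-integrable setT (EFin \o f z).
  rewrite /= in_itv/= => zz; apply: integrable_wkernel => //.
    exact: smooth1_continuous.
  exact: subset_trans (Kz _ zz) KD.
have df (z : R) x : is_derive z 1 (f ^~ x) (u x * wkernel (euler chi) y z x).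
  by apply: is_deriveZ; exact: is_derive_wkernel.
have G0 x : 0 <= G x.
  rewrite mulr_ge0 ?mulr_ge0 ?expR_ge0// patchE; case: ifPn => // _; exact: u0.
have iG : leb.-integrable setT (EFin \o G).
  rewrite (_ : EFin \o G = (fun x => B%:E * (EFin \o (u \_ K)) x)%E); last first.
    by apply/funext => x; rewrite /= EFinM.
  by apply: integrableZl => //; exact: integrable_admissible au _ KD.
have dfE z x : lebesgue_integral_under.partial1of2 f z x = u x * wkernel (euler chi) y z x.
  by rewrite partial1of2E; exact: derive_val.
have Gub z x : `]t0, t1[%classic z -> [set: 'rV[R]_n] x ->
    `|lebesgue_integral_under.partial1of2 f z x| <= G x.
  rewrite /= in_itv/= => zz _; rewrite dfE /G patchE; case: ifPn => [_|].
    rewrite normrM ger0_norm ?u0// mulrC ler_wpM2r ?u0//.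
    rewrite normrM ger0_norm ?expR_ge0//; apply: ler_pM; rewrite ?expR_ge0//.
      by rewrite ler_expR ler_wpM2l//; case/andP: zz => _ /ltW.
    by rewrite eM// mulr_ge0 ?expR_ge0 ?sqdist_ge0.
  rewrite notin_setE => nK; rewrite (@wkernel_vanishing _ t0 t1) ?mulr0 ?normr0//.
  - exact: euler_vanishing_gt.
  - exact: euler_vanishing_lt.
  - by case/andP: zz => *; rewrite !ltW.
have df' z x : `]t0, t1[%classic z -> [set: 'rV[R]_n] x -> derivable (f ^~ x) z 1.
  by move=> _ _; exact: (@ex_derive _ _ _ _ _ _ _ (df z x)).
apply: DeriveDef.
  exact: (derivable_under_integral measurableT It intf df' G0 iG Gub).
rewrite -derive1E (differentiation_under_integral measurableT It intf df' G0 iG Gub).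
by apply: eq_Rintegral => x _; rewrite dfE.
Qed.

End derivative.

(** Minus the derivative of [flat (1 - s)]. With this profile the [t]-derivative of the mean is a
    positive multiple of the integral of [u] against minus the Laplacian of a nonnegative test
    function. *)
Definition mean_bump (s : R) : R := flat_pow 2 (1 - s).

Let smooth1_onem : smooth1 (fun s : R => 1 + (-1) * s).
Proof.
apply: smooth1D; first exact: smooth1_cst.
by apply: smooth1M; [exact: smooth1_cst|exact: smooth1_id].
Qed.

Lemma smooth1_flat_onem m : smooth1 (fun s : R => flat_pow m (1 - s)).
Proof.
have := smooth1_comp (smooth1_flat_pow m) smooth1_onem.
by under eq_fun do rewrite mulN1r.
Qed.

Lemma smooth1_mean_bump : smooth1 mean_bump.
Proof. exact: smooth1_flat_onem. Qed.

Lemma mean_bump_vanishing s : 1 < s -> mean_bump s = 0.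
Proof. by move=> s1; rewrite /mean_bump flat_pow_le0// subr_le0 ltW. Qed.

Lemma mean_bump_ge0 s : 0 <= mean_bump s.
Proof. exact: flat_pow_ge0. Qed.

Lemma derive1_flat_onem : derive1 (fun s : R => flat (1 - s)) = (fun s => - mean_bump s).
Proof.
apply: derive1_ext => s.
have d1 : is_derive s 1 (fun s : R => 1 - s) (-1).
  by apply: (is_derive_eq (is_deriveB (is_derive_cst (1 : R) (s : R) (1 : R)) (is_derive_id (s : R) (1 : R)))); rewrite sub0r.
have d2 := @is_derive1_comp R flat (fun s : R => 1 - s) s _ _ (is_derive_flat_pow 0 (1 - s)) d1.
by apply: (is_derive_eq d2); rewrite /mean_bump oppr0 mul0r add0r mulrN1.
Qed.

Lemma laplacian_flat_onem y (t : R) x :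
  - laplacian (fun x => flat (1 - expR t * sqdist y x)) x =
  4 * expR t * euler mean_bump (expR t * sqdist y x).
Proof.
rewrite (laplacian_radial (h := fun s => flat (1 - s)))//; last exact: smooth1_flat_onem.
rewrite derive1_flat_onem; set s := expR t * sqdist y x.
have -> : derive1 (fun s : R => - mean_bump s) s = - derive1 mean_bump s.
  rewrite !derive1E; apply: derive_val.
  by apply: is_deriveN; rewrite -derive1E; exact: smooth1_is_derive smooth1_mean_bump.
by rewrite /euler; field.
Qed.

Section mean_value.
Variables (D : set 'rV[R]_n) (u : 'rV[R]_n -> R).
Hypotheses (au : admissible D u) (su : superharmonic D u).

(** The smooth form of the mean value property: as [t] grows the ball shrinks, and by
    superharmonicity the mean increases, its derivative being tested against
    [flat (1 - expR z * sqdist y x)]. *)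
Lemma wmean_bump_nondecreasing y (t0 t t' : R) :
  [set x | sqdist y x <= expR (- t0)] `<=` D -> t0 < t -> t <= t' ->
  wmean u mean_bump y t <= wmean u mean_bump y t'.
Proof.
move=> BD t0t tt'.
have mb0 (s : R) : 0 <= s < 0 -> mean_bump s = 0 by case: ltgtP.
have BD' z : annulus y (0 * expR (- z)) (1 * expR (- t0)) `<=` D.
  by move=> x; rewrite /annulus /= mul0r mul1r => /andP[_ ?]; exact: BD.
have dW z : t0 < z -> is_derive z 1 (wmean u mean_bump y) (wmean u (euler mean_bump) y z).
  move=> t0z; apply: (is_derive_wmean au (lexx 0) ler01 smooth1_mean_bump mean_bump_vanishing mb0 (BD' (z + 1))).
  by rewrite t0z/= ltrDl.
apply: (nondecreasing_ray dW _ t0t tt') => z t0z.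
pose phi x := flat (1 - expR z * sqdist y x).
have tphi : test_function D phi.
  apply: (@test_function_radial _ _ D [set x | sqdist y x <= expR (- t0)] (fun s => flat (1 - s))).
  - exact: smooth1_flat_onem.
  - exact: compact_sqdist_le.
  - exact: BD.
  - move=> x; apply: contra_neqP => /negP; rewrite -ltNge => h.
    rewrite /flat flat_pow_le0// subr_le0.
    rewrite -ler_pdivrMl ?expR_gt0// mulr1 -expRN (le_trans _ (ltW h))//.
    by rewrite ler_expR lerN2 ltW.
have := su tphi (fun x => flat_pow_ge0 0 _).
rewrite (_ : (\int[leb]_x (u x * - laplacian phi x))%R =
  4 * expR z / expR (n%:R / 2 * z) * wmean u (euler mean_bump) y z); last first.
  have ez := smooth1_euler smooth1_mean_bump.
  rewrite -RintegralZl//; last first.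
    apply: (integrable_wkernel (s0 := 0) (s1 := 1) au) => //.
    - exact: smooth1_continuous.
    - exact: euler_vanishing_gt mean_bump_vanishing.
    - exact: euler_vanishing_lt mb0.
    - move=> x; rewrite /annulus /= mul0r mul1r => /andP[_ xz]; apply: BD.
      by rewrite /= (le_trans xz)// ler_expR lerN2 ltW.
  apply: eq_Rintegral => x _; rewrite laplacian_flat_onem /wkernel.
  by field; rewrite gt_eqF// expR_gt0.
by rewrite pmulr_rge0// divr_gt0 ?expR_gt0// mulr_gt0 ?expR_gt0.
Qed.

End mean_value.
End weighted_means.

(** * The weak Harnack inequality *)
Section weak_harnack.
Context {R : realType} {n : nat}.
Local Notation leb := (lebesgue_rV n).
Implicit Types (x y z : 'rV[R]_n).

Lemma mean_bump_le2 (s : R) : mean_bump s <= 2.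
Proof.
rewrite /mean_bump; have [h|h] := leP (1 - s) 0; first by rewrite flat_pow_le0.
rewrite flat_powE// expRN ler_pdivrMr ?expR_gt0// -exprVn.
by rewrite (le_trans (exprn_le_expR 1 _))// invr_ge0 ltW.
Qed.

Lemma mean_bump_ge (s : R) : 0 <= s -> s <= 2^-1 -> expR (-2) <= mean_bump s.
Proof.
move=> s0 s2; have h : 0 < 1 - s by lra.
have h1 : 1 <= (1 - s)^-1 by rewrite invf_ge1//; lra.
have h2 : (1 - s)^-1 <= 2 by rewrite -[leRHS]invrK lef_pV2 ?posrE//; lra.
rewrite /mean_bump flat_powE// -exprVn -[leLHS]mul1r ler_pM ?expR_ge0//.
  by rewrite exprn_ege1.
by rewrite ler_expR lerN2.
Qed.

Lemma mean_bump_gt0 (s : R) : s < 1 -> 0 < mean_bump s.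
Proof. by move=> s1; rewrite /mean_bump flat_pow_gt0// subr_gt0. Qed.

Lemma wkernel_mean_bump_ge0 y (t : R) x : 0 <= wkernel mean_bump y t x.
Proof. by rewrite mulr_ge0 ?expR_ge0 ?mean_bump_ge0. Qed.

Lemma wkernel_mean_bump0 y (t : R) x : expR (- t) < sqdist y x ->
  wkernel mean_bump y t x = 0.
Proof.
move=> h; rewrite /wkernel mean_bump_vanishing ?mulr0//.
by rewrite -ltr_pdivrMl ?expR_gt0// mulr1 -expRN.
Qed.

Lemma wkernelC chi y (t : R) x : wkernel chi y t x = wkernel chi x t y.
Proof. by rewrite /wkernel sqdistC. Qed.

Lemma expR_half_cube (t : R) : expR (n%:R / 2 * t) * expR (- (t / 2)) ^+ n = 1.
Proof.
rewrite -expRM_natl -expRD (_ : _ + _ = 0) ?expR0//; ring.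
Qed.

(** The kernel lives in a cube of half side [expR (- (t / 2))] and [mean_bump] is at most 2; the
    point is that the bound does not depend on [t]. *)
Lemma wkernel_mass y (t : R) :
  (\int[leb]_x (wkernel mean_bump y t x)%:E <= (2 ^+ n.+1)%:E)%E.
Proof.
pose C := cube y (expR (- (t / 2))).
have mC : measurable C by exact: measurable_cube.
have out x : ~ C x -> wkernel mean_bump y t x = 0.
  move=> nC; apply: wkernel_mean_bump0.
  have [i hi] : exists i : 'I_n, expR (- (t / 2)) < `|x ord0 i - y ord0 i|.
    apply: contrapT => h; apply: nC => i /=; rewrite in_itv/=.
    rewrite -ler_distl leNgt; apply/negP => hi; apply: h; by exists i.
  apply: lt_le_trans (sqdist_coord y x i).
  rewrite -[ltRHS]real_normK ?num_real// (_ : - t = - (t / 2) *+ 2); last first.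
    by rewrite mulr2n; field.
  by rewrite mulr2n expRD -expr2 ltr_pXn2r ?nnegrE ?expR_ge0.
have mw : measurable_fun setT (fun x => (wkernel mean_bump y t x)%:E).
  apply/measurable_EFinP; apply: continuous_measurable_fun_rV.
  by apply: continuous_wkernel; apply: smooth1_continuous; exact: smooth1_mean_bump.
have -> : (\int[leb]_x (wkernel mean_bump y t x)%:E =
           \int[leb]_(x in C) (wkernel mean_bump y t x)%:E)%E.
  rewrite [RHS]integral_mkcond; apply: eq_integral => x _; rewrite patchE.
  by case: ifPn => //; rewrite notin_setE => /out ->.
apply: (@le_trans _ _ (\int[leb]_(x in C) (expR (n%:R / 2 * t) * 2)%:E)%E).
  apply: ge0_le_integral => //.
  - by move=> x _; rewrite lee_fin wkernel_mean_bump_ge0.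
  - exact: measurable_funTS.
  - by move=> x _; rewrite lee_fin ler_wpM2l ?expR_ge0 ?mean_bump_le2.
rewrite integral_cst// [X in (_ * X)%E](_ : _ = ((2 * expR (- (t / 2))) ^+ n)%:E); last first.
  exact: lebesgue_rV_cube (expR_ge0 _).
rewrite -EFinM lee_fin exprMn (mulrC (2 ^+ n)) mulrACA expR_half_cube mul1r.
by rewrite exprS.
Qed.

Lemma expR_half_le2 : expR (2^-1) <= 2 :> R.
Proof.
have := expR_ge1Dx (- 2^-1 : R); have := expRxMexpNx_1 (2^-1 : R).
have := expR_gt0 (2^-1 : R); nra.
Qed.

Variables (D : set 'rV[R]_n) (u : 'rV[R]_n -> R).
Hypotheses (au : admissible D u) (su : superharmonic D u).

Let bump0 (s : R) : 0 <= s < 0 -> mean_bump s = 0. Proof. by case: ltgtP. Qed.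

Lemma integrable_wkernel_bump y (t : R) : [set x | sqdist y x <= expR (- t)] `<=` D ->
  leb.-integrable setT (EFin \o (fun x => u x * wkernel mean_bump y t x)).
Proof.
move=> BD; apply: (integrable_wkernel (s0 := 0) (s1 := 1) au) => //.
- by apply: smooth1_continuous; exact: smooth1_mean_bump.
- exact: mean_bump_vanishing.
- by move=> x; rewrite /annulus /= mul0r mul1r => /andP[_ xz]; exact: BD.
Qed.

Lemma measurable_wkernel_pair (t : R) :
  measurable_fun setT (fun xz : 'rV[R]_n * 'rV[R]_n => wkernel mean_bump xz.1 t xz.2).
Proof.
apply: measurable_funM; first exact: measurable_cst.
apply: (measurableT_comp (f := @mean_bump R)).
  by apply: continuous_measurable_fun; apply: smooth1_continuous; exact: smooth1_mean_bump.
apply: measurable_funM; first exact: measurable_cst.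
rewrite /sqdist; apply: measurable_sum => i.
apply: measurable_funX; apply: measurable_funB.
- exact: (measurableT_comp (measurable_coord i) measurable_snd).
- exact: (measurableT_comp (measurable_coord i) measurable_fst).
Qed.

Section one_ball.
Variables (y : 'rV[R]_n) (t1 : R).
Hypothesis yD : [set x | sqdist y x <= 5 * expR (- t1)] `<=` D.
Let B := [set x | sqdist y x <= expR (- t1) / 8].
(** Points [x], [z] of [B] satisfy [expR t1 * sqdist x z <= 1/2], where [mean_bump] is at least
    [expR (-2)]; so [m] bounds from below the mean at scale [t1] around every point of [B]. *)
Let m := expR (n%:R / 2 * t1) * expR (-2) * (\int[leb]_(x in B) u x)%R.

(** Monotonicity of the means is used from a scale strictly before [t1], here [t1 - 1/2], whose
    squared radius is at most twice that of [t1]. The 5 in [yD] leaves room for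
    [2 * (1/8) + 2 * 2]. *)
Let BD x : B x -> [set z | sqdist x z <= expR (- (t1 - 2^-1))] `<=` D.
Proof.
rewrite /B /= => Bx z /= xz; apply: yD => /=.
have := sqdist_triangle x y z.
have : expR (- (t1 - 2^-1)) <= 2 * expR (- t1).
  rewrite (_ : - (t1 - 2^-1) = 2^-1 + - t1) ?expRD; last ring.
  by rewrite ler_wpM2r ?expR_ge0 ?expR_half_le2.
have := expR_gt0 (- t1); lra.
Qed.

Let m_ge0 : 0 <= m.
Proof.
rewrite mulr_ge0 ?mulr_ge0 ?expR_ge0//; apply: Rintegral_ge0 => x _.
by have [_ + _] := au; apply.
Qed.

Let cB : compact B. Proof. exact: compact_sqdist_le. Qed.
Let mB : measurable B. Proof. exact: compact_measurable_rV. Qed.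

Let BsubD : B `<=` D.
Proof. by move=> x; rewrite /B /= => Bx; apply: yD => /=; have := expR_gt0 (- t1); lra. Qed.

Let wmean_ge x (t : R) : B x -> t1 <= t -> m <= wmean u mean_bump x t.
Proof.
move=> Bx tt; have [_ u0 _] := au.
have t01 : t1 - 2^-1 < t1 by rewrite ltrBlDr ltrDl.
apply: le_trans (wmean_bump_nondecreasing au su (BD Bx) t01 tt).
rewrite /m Rintegral_mkcond -RintegralZl//; last exact: integrable_admissible au cB BsubD.
apply: le_Rintegral => //.
- rewrite (_ : EFin \o _ = (fun x => (expR (n%:R / 2 * t1) * expR (-2))%:E * (EFin \o (u \_ B)) x)%E).
    by apply: integrableZl => //; exact: integrable_admissible au cB BsubD.
  by apply/funext => z; rewrite /= EFinM.
- apply: integrable_wkernel_bump => z /= xz; apply: (BD Bx) => /=.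
  by rewrite (le_trans xz)// ler_expR lerN2 ltW.
- move=> z _; rewrite patchE; case: ifPn => [|_]; last first.
    by rewrite mulr0 mulr_ge0// wkernel_mean_bump_ge0.
  rewrite inE => Bz; rewrite [leRHS]mulrC ler_wpM2r// /wkernel ler_wpM2l ?expR_ge0//.
  apply: mean_bump_ge; first by rewrite mulr_ge0 ?expR_ge0 ?sqdist_ge0.
  rewrite -ler_pdivlMl ?expR_gt0// -expRN.
  have := sqdist_triangle y x z; move: Bx Bz; rewrite /B /= (sqdistC y x); lra.
Qed.

(* For [x] in the ball [B] the means around [x] are bounded below by [m] at every small
   scale.  If [u < kap] on a set of positive measure, integrating these means over a compact
   subset [F] and exchanging the integrals leads to a contradiction as the scale tends
   to 0, the part of the integral outside [F] vanishing by dominated convergence. *)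
Lemma weak_harnack : {ae leb, forall x, B x -> m / 2 ^+ n.+2 <= u x}.
Proof.
have [mu u0 ui] := au.
(* [A] bounds the mass of every kernel and [kap * A = m / 2], so the part of the integral over [F]
   uses up only half of the lower bound [m * muF]. *)
pose kap := m / 2 ^+ n.+2; pose A : R := 2 ^+ n.+1.
have A0 : 0 < A by rewrite exprn_gt0.
have kapA : kap * A = m / 2.
  by rewrite /kap /A [in X in _ / X]exprS invfM mulrA divfK// expf_neq0.
pose E := B `&` [set x | u x < kap].
have mE : measurable E.
  apply: measurableI => //; rewrite -[X in measurable X]setTI.
  rewrite (_ : [set x | u x < kap] = u @^-1` `]-oo, kap[); last first.
    by apply/seteqP; split => x; rewrite /= in_itv.
  by apply: mu => //; exact: measurable_itv.
suff E0 : leb E = 0%E.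
  exists E; split => // x /= h; have [Bx nux] : B x /\ ~ (kap <= u x).
    by apply: contrapT => h2; apply: h => Bx; apply: contrapT => h3; apply: h2.
  by split => //=; rewrite ltNge; exact/negP.
apply/eqP; rewrite eq_le measure_ge0 andbT leNgt; apply/negP => E0.
have m0 : 0 < m.
  rewrite lt0r m_ge0 andbT; apply/eqP => m0; move: E0.
  rewrite (_ : E = set0) ?measure0 ?ltxx//; apply/seteqP; split => // x [_ /=].
  by rewrite /kap m0 mul0r ltNge u0.
have [M M0 BM] := compact_bounded_rV cB.
have EM x : E x -> `|x| <= M by move=> [/BM].
have [F [cF FE F0]] := rV_inner_regular mE EM E0.
have mF := compact_measurable_rV cF.
have Foo := lebesgue_rV_compact cF.
pose muF := fine (leb F).
have muFE : leb F = muF%:E by rewrite fineK// ge0_fin_numE.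
have muF0 : 0 < muF by rewrite -lte_fin -muFE.
(* By symmetry of the kernel, [g k z] is also the mean of the indicator of [F] around [z]: at most
   [A], and eventually 0 at a point outside the closed set [F]. *)
pose w k x z := wkernel mean_bump x (t1 + k%:R) z.
pose g k z := (\int[leb]_x (\1_F x * w k x z)%:E)%E.
have w0 k x z : 0 <= w k x z by exact: wkernel_mean_bump_ge0.
have g0 k z : (0 <= g k z)%E.
  by apply: integral_ge0 => x _; rewrite lee_fin mulr_ge0.
have mw k z : measurable_fun setT (fun x => w k x z).
  rewrite (_ : (fun x => w k x z) = wkernel mean_bump z (t1 + k%:R)).
    apply: continuous_measurable_fun_rV; apply: continuous_wkernel.
    by apply: smooth1_continuous; exact: smooth1_mean_bump.
  by apply/funext => x; rewrite /w wkernelC.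
have gA k z : (g k z <= A%:E)%E.
  apply: le_trans (wkernel_mass z (t1 + k%:R)); apply: ge0_le_integral => //.
  - by move=> x _; rewrite lee_fin mulr_ge0.
  - by apply/measurable_EFinP; apply: measurable_funM => //; exact: measurable_indic.
  - have := mw k z; rewrite (_ : (fun x => w k x z) = wkernel mean_bump z (t1 + k%:R)).
      by move=> /measurable_EFinP.
    by apply/funext => x; rewrite /w wkernelC.
  - move=> x _; rewrite lee_fin wkernelC -/(w k x z) indicE.
    by case: (x \in F); rewrite ?mul1r// mul0r.
pose h k (xz : 'rV[R]_n * 'rV[R]_n) := (\1_F xz.1 * (u xz.2 * w k xz.1 xz.2))%:E.
have mh k : measurable_fun setT (h k).
  apply/measurable_EFinP; apply: measurable_funM.
    by apply: measurableT_comp; [exact: measurable_indic|exact: measurable_fst].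
  apply: measurable_funM; last exact: measurable_wkernel_pair.
  by apply: (measurableT_comp mu); exact: measurable_snd.
have h0 k xz : (0 <= h k xz)%E by rewrite /h lee_fin mulr_ge0// mulr_ge0//.
have FB x : F x -> B x by move=> /FE[].
have lower k : ((m * muF)%:E <= \int[leb]_x \int[leb]_z h k (x, z))%E.
  rewrite EFinM -muFE -integral_cst// integral_mkcond.
  apply: ge0_le_integral => //.
  - move=> x _; rewrite patchE; case: ifPn => // _; rewrite lee_fin; exact: m_ge0.
  - apply/(measurable_restrictT _ mF); exact: measurable_cst.
  - exact: (@measurable_fun_fubini_tonelli_F _ _ _ _ R leb (h k) (mh k) (h0 k)).
  - move=> x _; rewrite patchE; case: ifPn => [|_]; last first.
      by apply: integral_ge0 => z _; exact: h0.
    rewrite inE => Fx.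
    have tk : t1 <= t1 + k%:R by rewrite lerDl.
    have iw : leb.-integrable setT (EFin \o (fun z => u z * w k x z)).
      apply: integrable_wkernel_bump => z /= xz; apply: (BD (FB _ Fx)) => /=.
      by rewrite (le_trans xz)// ler_expR lerN2 lerBlDr (le_trans tk)// lerDl.
    rewrite (eq_integral (EFin \o (fun z => u z * w k x z))) => [|z _]; last first.
      by rewrite /h/= indicE mem_set// mul1r.
    rewrite -[leRHS]fineK; last exact: integrable_fin_num.
    by rewrite lee_fin; exact: (wmean_ge (FB _ Fx) tk).
have upper k : (\int[leb]_x \int[leb]_z h k (x, z) = \int[leb]_z ((u z)%:E * g k z))%E.
  rewrite (fubini_tonelli (h k) (mh k) (h0 k)); apply: eq_integral => z _.
  rewrite /g -ge0_integralZl//; last 3 first.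
  - by apply/measurable_EFinP; apply: measurable_funM => //; exact: measurable_indic.
  - by move=> x _; rewrite lee_fin mulr_ge0.
  - by rewrite lee_fin.
  by apply: eq_integral => x _; rewrite /h /= -EFinM mulrCA.
have mg k : measurable_fun setT (g k).
  have := @measurable_fun_fubini_tonelli_G _ _ _ _ R leb
    (fun xz : 'rV[R]_n * 'rV[R]_n => (\1_F xz.1 * w k xz.1 xz.2)%:E).
  apply; last by move=> xz; rewrite lee_fin mulr_ge0.
  apply/measurable_EFinP; apply: measurable_funM; last exact: measurable_wkernel_pair.
  by apply: measurableT_comp; [exact: measurable_indic|exact: measurable_fst].
have mug k : measurable_fun setT (fun z => (u z)%:E * g k z)%E.
  by apply: emeasurable_funM => //; exact/measurable_EFinP.
have mFc : measurable (~` F) by exact: measurableC.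
(* All kernels centred in [B] live in this compact subset of [D], so [A * u] on it is the dominating
   function. *)
pose B' := [set x | sqdist y x <= 5 * expR (- t1)].
have cB' : compact B' by exact: compact_sqdist_le.
have gB' k z : ~ B' z -> g k z = 0%E.
  move=> nz; apply: integral0_eq => x _.
  rewrite indicE; case: (boolP (x \in F)) => [|_]; last by rewrite mul0r.
  rewrite inE => /FB Bx; rewrite /w wkernel_mean_bump0 ?mulr0// ltNge; apply/negP => xz.
  apply: nz; rewrite /B' /=; have := sqdist_triangle x y z.
  have : expR (- (t1 + k%:R)) <= expR (- t1) by rewrite ler_expR lerN2 lerDl.
  move: Bx; rewrite /B /=; have := expR_gt0 (- t1); lra.
have gcvg z : ~ F z -> \forall k \near \oo, g k z = 0%E.
  move=> nFz.
  have [e e0 eF] : exists2 e, 0 < e & forall x, `|z - x| < e -> (~` F) x.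
    by apply: open_normP => //; apply: closed_openC; exact: compact_closed_rV.
  near=> k; apply: integral0_eq => x _.
  rewrite indicE; case: (boolP (x \in F)) => [|_]; last by rewrite mul0r.
  rewrite inE => Fx; rewrite /w wkernel_mean_bump0 ?mulr0//.
  have ex : e <= `|z - x| by rewrite leNgt; apply/negP => /eF.
  apply: (@lt_le_trans _ _ (e ^+ 2)); last first.
    rewrite leNgt; apply/negP => xz.
    have : `|z - x| < e.
      apply: rV_norm_lt => // i; rewrite !mxE.
      have := le_lt_trans (sqdist_coord x z i) xz.
      by rewrite -real_normK ?num_real// ltr_pXn2r ?nnegrE// ltW.
    by rewrite ltNge ex.
  rewrite -[ltRHS]lnK ?posrE ?exprn_gt0// ltr_expR ltrNl -ltrBlDl.
  near: k; exact: nbhs_infty_gtr.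
have := @dominated_convergence _ _ R leb _ mFc (fun k z => (u z)%:E * g k z)%E (cst 0%E)
  (fun z => (A * (u \_ B') z)%:E).
case.
- by move=> k; exact: measurable_funTS.
- exact: measurable_cst.
- apply: aeW => z nFz; apply: cvg_near_cst.
  by apply: filterS (gcvg z nFz) => k ->; rewrite mule0.
- apply: (integrableS measurableT) => //.
  rewrite (_ : (fun _ => _) = (fun z => A%:E * (EFin \o (u \_ B')) z)%E); last first.
    by apply/funext => z; rewrite /= EFinM.
  by apply: integrableZl => //; exact: integrable_admissible au cB' yD.
- apply: aeW => z k _; rewrite gee0_abs; last by rewrite mule_ge0// lee_fin.
  rewrite patchE; case: ifPn => [_|]; last first.
    by rewrite notin_setE => /gB' ->; rewrite mule0 mulr0.
  by rewrite mulrC EFinM; apply: lee_wpmul2l; rewrite ?lee_fin.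
move=> _ _; rewrite integral0 => /fine_cvgP[/= fn /cvgrPdist_lt].
(* For large [k] the integral outside [F] is below [m / 2 * muF], and that over [F] is at most
   [m / 2 * muF]: together strictly less than the lower bound [m * muF]. *)
have mF2 : 0 < m / 2 * muF by rewrite mulr_gt0// divr_gt0.
move=> /(_ _ mF2) cv.
have [k [fnk cvk]] : exists k, (\int[leb]_(z in ~` F) ((u z)%:E * g k z))%E \is a fin_num /\
  `|0 - fine (\int[leb]_(z in ~` F) ((u z)%:E * g k z))%E| < m / 2 * muF.
  by have [k _ /(_ k (leqnn k))[]] := filterI fn cv; exists k.
move: cvk; rewrite sub0r normrN => /(le_lt_trans (ler_norm _)) cvk.
have := lower k; rewrite upper.
have -> : (\int[leb]_z ((u z)%:E * g k z) = \int[leb]_(z in F) ((u z)%:E * g k z) +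
   \int[leb]_(z in ~` F) ((u z)%:E * g k z))%E.
  rewrite -ge0_integral_setU//.
  - by rewrite setUv.
  - by rewrite setUv.
  - by move=> z _; rewrite mule_ge0// lee_fin.
  - by rewrite disj_set2E setICr.
have inF : (\int[leb]_(z in F) ((u z)%:E * g k z) <= (m / 2 * muF)%:E)%E.
  rewrite EFinM -muFE -integral_cst//; apply: ge0_le_integral => //.
  - by move=> z _; rewrite mule_ge0// lee_fin.
  - exact: measurable_funTS.
  - move=> z /FE[_ /= uz]; rewrite -kapA EFinM; apply: lee_pmul; rewrite ?lee_fin//.
    exact: ltW.
move=> hh; have := le_trans hh (leeD inF (lexx _)).
rewrite -[X in (_ <= _ + X)%E](fineK fnk) -EFinD lee_fin; lra.
Unshelve. all: end_near. Qed.

End one_ball.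

(** The mean at a very small scale is 0. Means increase as the ball shrinks, so the mean at the
    larger scale [t] is 0 as well, and its kernel is positive on the open ball. *)
Lemma zero_propagation y (t0 t e : R) : [set x | sqdist y x <= expR (- t0)] `<=` D ->
  t0 < t -> 0 < e -> {ae leb, forall x, sqdist y x < e -> u x = 0} ->
  {ae leb, forall x, sqdist y x < expR (- t) -> u x = 0}.
Proof.
move=> BD t0t e0 u_ae; have [mu u0 ui] := au.
have [t' tt' et'] : exists2 t', t <= t' & expR (- t') < e.
  exists (Num.max t (1 - ln e)); first by rewrite le_max lexx.
  rewrite -[ltRHS](lnK (x := e)) ?posrE// ltr_expR ltrNl.
  by rewrite lt_max ltrDr ltr01 orbT.
have BDt (z : R) : t0 < z -> [set x | sqdist y x <= expR (- z)] `<=` D.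
  by move=> t0z x /= xz; apply: BD; rewrite /= (le_trans xz)// ler_expR lerN2 ltW.
have iw (z : R) : t0 < z -> leb.-integrable setT (EFin \o (fun x => u x * wkernel mean_bump y z x)).
  by move=> t0z; apply: integrable_wkernel_bump; exact: BDt.
have W' : wmean u mean_bump y t' = 0.
  rewrite /wmean /Rintegral (ae_eq_integral (cst 0%E)) ?integral0//.
  - by have /integrableP[] := iw t' (lt_le_trans t0t tt').
  - apply: filterS u_ae => x /= h _; have [xe|xe] := ltP (sqdist y x) e.
      by rewrite h// mul0r.
    by rewrite wkernel_mean_bump0 ?mulr0// (lt_le_trans et').
have W : wmean u mean_bump y t = 0.
  apply/eqP; rewrite eq_le -{1}W' (wmean_bump_nondecreasing au su BD)//=.
  by apply: Rintegral_ge0 => x _; rewrite mulr_ge0 ?wkernel_mean_bump_ge0.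
have iwt := iw t t0t; have /integrableP[mw _] := iwt.
have : (\int[leb]_x `|(u x * wkernel mean_bump y t x)%:E| = 0)%E.
  rewrite (eq_integral (EFin \o (fun x => u x * wkernel mean_bump y t x))) => [|x _].
    by rewrite -[LHS]fineK ?integrable_fin_num//; congr EFin; exact: W.
  by rewrite /= ger0_norm// mulr_ge0 ?wkernel_mean_bump_ge0.
move=> /(ae_eq_integral_abs leb measurableT mw); apply: filterS => x /= h xt.
have := h I; move=> [] /eqP; rewrite mulf_eq0 => /orP[/eqP//|/eqP wx].
have : 0 < wkernel mean_bump y t x.
  rewrite mulr_gt0 ?expR_gt0// mean_bump_gt0//.
  by rewrite -ltr_pdivlMl ?expR_gt0// mulr1 -expRN.
by rewrite wx ltxx.
Qed.

End weak_harnack.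

(** * The Harnack inequality on annuli *)
Section annulus_harnack.
Context {R : realType} {n : nat}.
Local Notation leb := (lebesgue_rV n).
Implicit Types (x y z : 'rV[R]_n) (v : 'rV[R]_n -> R).

(** Supported in [1 <= s <= 4], hence away from the centre: means around the origin only see points
    of [D]. *)
Definition ring_bump (s : R) := flat (s - 1) * flat (4 - s).

Lemma smooth1_ring_bump : smooth1 ring_bump.
Proof.
have s1 : smooth1 (fun s : R => s - 1).
  by apply: smooth1D; [exact: smooth1_id|exact: smooth1_cst].
have s4 : smooth1 (fun s : R => 4 - s).
  under eq_fun do rewrite -mulN1r.
  apply: smooth1D; first exact: smooth1_cst.
  by apply: smooth1M; [exact: smooth1_cst|exact: smooth1_id].
by apply: smooth1M; apply: smooth1_comp => //; exact: smooth1_flat_pow.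
Qed.

Lemma ring_bump_ge0 s : 0 <= ring_bump s.
Proof. by rewrite mulr_ge0// flat_pow_ge0. Qed.

Lemma ring_bump_le1 s : ring_bump s <= 1.
Proof. by rewrite mulr_ile1 ?flat_pow_ge0 ?flat_le1. Qed.

Lemma ring_bump_vanishing_gt s : 4 < s -> ring_bump s = 0.
Proof. by move=> s4; rewrite /ring_bump [X in _ * X]flat_pow_le0 ?mulr0//; lra. Qed.

Lemma ring_bump_vanishing_lt s : 0 <= s < 1 -> ring_bump s = 0.
Proof. by move=> /andP[_ s1]; rewrite /ring_bump [X in X * _]flat_pow_le0 ?mul0r//; lra. Qed.

Lemma ring_bump_gt0 s : 1 < s < 4 -> 0 < ring_bump s.
Proof. by move=> /andP[s1 s4]; rewrite mulr_gt0// flat_pow_gt0//; lra. Qed.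

Lemma ring_bump_ge s : 11/10 <= s -> s <= 39/10 -> flat (1/10) ^+ 2 <= ring_bump s.
Proof.
by move=> h1 h2; rewrite expr2 ler_pM ?flat_pow_ge0//; apply: le_flat; lra.
Qed.

Lemma sqdistZ (c : R) y x : sqdist (c *: y) (c *: x) = c ^+ 2 * sqdist y x.
Proof.
rewrite /sqdist mulr_sumr; apply: eq_bigr => i _; rewrite !mxE; ring.
Qed.

Lemma sqdist0Z (c : R) x : sqdist 0 (c *: x) = c ^+ 2 * sqdist 0 x.
Proof. by rewrite -sqdistZ scaler0. Qed.

(** The centres are kept strictly inside the annulus, between the radii 1.1 and 1.9, so that a small
    neighbourhood of each lies where [ring_bump] is bounded below. *)
Lemma annulus_cover : exists Y : seq 'rV[R]_n,
  (forall y, y \in Y -> 121/100 <= sqdist 0 y <= 361/100) /\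
  forall x, 1 <= sqdist 0 x <= 4 -> exists2 y, y \in Y & sqdist y x < 1/40.
Proof.
have := @compact_annulus R n 0 1 4; rewrite compact_cover.
move=> /(_ _ [set y | 121/100 <= sqdist 0 y <= 361/100] (fun y => [set x | sqdist y x < 1/40])).
case.
- by move=> y _; exact: open_sqdist_lt.
- move=> x /andP[x1 x4].
  have E (c : R) : sqdist (c *: x) x = (c - 1) ^+ 2 * sqdist 0 x.
    rewrite /sqdist mulr_sumr; apply: eq_bigr => i _; rewrite !mxE; ring.
  (* A point of the inner half is pushed outwards, to [1.1 x], at squared distance at most 0.02; one
     of the outer half inwards, to [0.95 x], at squared distance at most 0.01. *)
  have [x2|x2] := leP (sqdist 0 x) 2.
    by exists ((11/10) *: x) => /=; rewrite ?sqdist0Z ?E; [apply/andP; split|]; lra.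
  by exists ((19/20) *: x) => /=; rewrite ?sqdist0Z ?E; [apply/andP; split|]; lra.
- move=> Y hY cov; exists (finmap.enum_fset Y); split => [y /hY|x xx]; first by rewrite inE.
  by have [y] := cov x xx; exists y.
Qed.

Lemma Rintegral_sum (I : eqType) (s : seq I) (f : I -> 'rV[R]_n -> R) :
  (forall i, i \in s -> leb.-integrable setT (EFin \o f i)) ->
  leb.-integrable setT (EFin \o (fun x => \sum_(i <- s) f i x)) /\
  (\int[leb]_x (\sum_(i <- s) f i x))%R = \sum_(i <- s) (\int[leb]_x f i x)%R.
Proof.
elim: s => [|i s IH] fi.
  have E : (fun x => \sum_(i <- [::]) f i x) = cst 0 :> ('rV[R]_n -> R).
    by apply/funext => x; rewrite big_nil.
  rewrite E big_nil; split; last by rewrite Rintegral_cst// mul0r.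
  exact: integrable0.
have [IH1 IH2] := IH (fun j js => fi j (mem_behead (s := i :: s) js)).
have fi0 := fi i (mem_head i s).
have E : (fun x => \sum_(i <- i :: s) f i x) = (fun x => f i x + \sum_(i <- s) f i x).
  by apply/funext => x; rewrite big_cons.
rewrite E big_cons RintegralD// IH2; split => //.
rewrite (_ : EFin \o _ = ((EFin \o f i) \+ (EFin \o (fun x => (\sum_(i <- s) f i x)%R)))%E).
  exact: integrableD.
by apply/funext => x; rewrite /= EFinD.
Qed.

Variables (D : set 'rV[R]_n) (v : 'rV[R]_n -> R) (q : R).
Hypotheses (av : admissible D v) (sv : superharmonic D v) (q_gt0 : 0 < q).
Hypothesis (avq : admissible D (fun x => v x `^ q)).

(** Small enough for the cube of half side [eta] to lie in the ball of squared radius 1/1000. *)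
Let eta : R := (100 * (n%:R + 1))^-1.
(** The factor of [weak_harnack] to the power [q], times a lower bound of [ring_bump] near the
    centres, times the volume of the cube of half side [eta]. *)
Let c0 : R := (expR (-2) / 2 ^+ n.+2) `^ q * (flat (1/10) ^+ 2 * (2 * eta) ^+ n).

Let n1 : 0 < n%:R + 1 :> R. Proof. by rewrite ltr_wpDl. Qed.
Let eta0 : 0 < eta. Proof. by rewrite invr_gt0 mulr_gt0. Qed.

Lemma eta_bound : n%:R * eta ^+ 2 <= 1/1000.
Proof.
have h : eta * (n%:R + 1) = 1/100 by rewrite /eta; field; rewrite gt_eqF.
have n0 : 0 <= n%:R :> R by [].
have : eta <= 1/100 by nra.
nra.
Qed.

Let c0_gt0 : 0 < c0.
Proof.
by rewrite !mulr_gt0 ?powR_gt0 ?exprn_gt0 ?flat_pow_gt0 ?mulr_gt0 ?invr_gt0 ?exprn_gt0 ?expR_gt0.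
Qed.

Lemma integrable_ring_bump u (t : R) : admissible D u ->
  annulus 0 (expR (- t)) (4 * expR (- t)) `<=` D ->
  leb.-integrable setT (EFin \o (fun x => u x * wkernel ring_bump 0 t x)).
Proof.
move=> au KD; apply: (integrable_wkernel (s0 := 1) (s1 := 4) au) => //.
- by apply: smooth1_continuous; exact: smooth1_ring_bump.
- exact: ring_bump_vanishing_gt.
- exact: ring_bump_vanishing_lt.
- by rewrite mul1r.
Qed.

Lemma wkernel_ring_bump_ge0 y (t : R) x : 0 <= wkernel ring_bump y t x.
Proof. by rewrite mulr_ge0 ?expR_ge0 ?ring_bump_ge0. Qed.

Section one_scale.
Variable (t : R).
Let r2 := expR (- t).
Let r := expR (- (t / 2)).
Hypothesis tD : [set x | 0 < sqdist 0 x <= 10 * r2] `<=` D.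

Let r20 : 0 < r2. Proof. exact: expR_gt0. Qed.
Let r0 : 0 < r. Proof. exact: expR_gt0. Qed.
Let rr : r ^+ 2 = r2.
Proof. by rewrite /r /r2 expr2 -expRD; congr expR; field. Qed.

Let KD : annulus 0 (expR (- t)) (4 * expR (- t)) `<=` D.
Proof.
move=> x /andP[h1 h2]; apply: tD => /=; rewrite (lt_le_trans r20)//=.
by rewrite (le_trans h2)// ler_wpM2r ?ltW//; lra.
Qed.

Let ry y : sqdist 0 (r *: y) = r2 * sqdist 0 y. Proof. by rewrite sqdist0Z rr. Qed.

(** The weak Harnack inequality is applied in these balls, so they have to avoid the origin
    ([1.21 > 1]) and stay within squared radius [10 * r2] ([2 * 3.61 + 2 < 10]). *)
Let ballD y : 121/100 <= sqdist 0 y <= 361/100 ->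
  [set x | sqdist (r *: y) x <= r2] `<=` D.
Proof.
move=> /andP[y1 y4] x /= xr; apply: tD => /=; apply/andP; split.
  rewrite lt0r sqdist_ge0 andbT; apply/eqP => x0.
  (* With the weight 100 the origin would give [1.21 * r2 <= 1.01 * r2]. *)
  have h : 0 < 100 :> R by lra.
  have := sqdist_triangle_wgt x 0 (r *: y) h.
  rewrite x0 (sqdistC x) mulr0 ry; have := r20; nra.
have := sqdist_triangle (r *: y) 0 x; rewrite ry; have := r20; nra.
Qed.

(** Where Jensen's inequality fails, the weak Harnack inequality still bounds [v] almost everywhere
    on the ball by its integral there; raise this pointwise bound to the power [q] and integrate
    over a cube inside the ball on which [ring_bump] is bounded below. *)
Lemma ball_mass_powR y : 121/100 <= sqdist 0 y <= 361/100 ->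
  c0 * (expR (n%:R / 2 * t) * (\int[leb]_(x in [set x | sqdist (r *: y) x <= r2 / 40%R]) v x)%R) `^ q
  <= wmean (fun x => v x `^ q) ring_bump 0 t.
Proof.
move=> yb; have /andP[y1 y4] := yb; have [mv v0 vi] := av; have [mvq vq0 vqi] := avq.
(* Then [5 * expR (- t1) = r2], the squared radius allowed by [ballD], and
   [expR (- t1) / 8 = r2 / 40], that of the cover. *)
pose t1 := t + ln 5.
have t1E : expR (- t1) = r2 / 5.
  by rewrite /t1 opprD expRD [in X in _ * X]expRN lnK// posrE.
have BD : [set x | sqdist (r *: y) x <= 5 * expR (- t1)] `<=` D.
  by move=> x /=; rewrite t1E => xr; apply: (ballD yb); rewrite /=; lra.
have B40 : [set x | sqdist (r *: y) x <= expR (- t1) / 8] = [set x | sqdist (r *: y) x <= r2 / 40].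
  by apply/seteqP; split => x /=; rewrite t1E; lra.
have := weak_harnack av sv BD; rewrite B40.
set I := (\int[leb]_(x in _) v x)%R.
have I0 : 0 <= I by apply: Rintegral_ge0.
set m := (X in X / 2 ^+ n.+2); move=> harnack.
pose kap := expR (-2) / 2 ^+ n.+2 * (expR (n%:R / 2 * t) * I).
have kap0 : 0 <= kap by rewrite !mulr_ge0 ?invr_ge0 ?expR_ge0 ?exprn_ge0.
have kapm : kap <= m / 2 ^+ n.+2.
  rewrite /kap mulrAC ler_wpM2r ?invr_ge0 ?exprn_ge0//.
  rewrite /m mulrA ler_wpM2r// [leLHS]mulrC ler_wpM2r ?expR_ge0// ler_expR ler_wpM2l ?divr_ge0//.
  by rewrite /t1 lerDl ln_ge0//; lra.
pose C := cube (r *: y) (eta * r).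
have mC : measurable C by exact: measurable_cube.
have Cs x : C x -> sqdist (r *: y) x <= r2 / 1000.
  move=> Cx; apply: le_trans (sqdist_norm _ _) _.
  have : `|x - r *: y| <= eta * r.
    apply: rV_norm_le => [|i]; first by rewrite mulr_ge0 ?ltW.
    by rewrite !mxE; have := Cx i; rewrite /= in_itv/= -ler_distl !mxE.
  move=> h; apply: (@le_trans _ _ (n%:R * (eta * r) ^+ 2)).
    by rewrite ler_wpM2l// lerXn2r ?nnegrE// mulr_ge0 ?ltW.
  by rewrite exprMn mulrA rr mulrC ler_wpM2l ?(ltW r20)// -[leRHS]div1r eta_bound.
pose c1 : R := flat (1/10) ^+ 2.
have c1_ge0 : 0 <= c1 by rewrite exprn_ge0// flat_pow_ge0.
have Cchi x : C x -> c1 <= ring_bump (expR t * sqdist 0 x).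
  move=> /Cs h.
  (* With the weight 1/20 and the squared radius 1/1000, centres between 1.21 and 3.61 give points
     between 1.1 and 3.9. *)
  have e0 : 0 < 1/20 :> R by lra.
  have := sqdist_triangle_wgt (r *: y) 0 x e0.
  have := sqdist_triangle_wgt x 0 (r *: y) e0.
  have ti : expR t * r2 = 1 by rewrite /r2 -expRD subrr expR0.
  have tp := expR_gt0 t.
  rewrite (sqdistC x) ry => h1 h2.
  have := ler_wpM2l (ltW tp) h; rewrite mulrA ti mul1r => {}h.
  have := ler_wpM2l (ltW tp) h1; have := ler_wpM2l (ltW tp) h2.
  have tr (z : R) : expR t * (r2 * z) = z by rewrite mulrA ti mul1r.
  rewrite tr !mulrDr !(mulrCA (expR t) (1 + _)) tr => {}h1 {}h2.
  by apply: ring_bump_ge; lra.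
have kC : (\int[leb]_(x in C) (kap `^ q * (expR (n%:R / 2 * t) * c1))%:E <=
           \int[leb]_x (v x `^ q * wkernel ring_bump 0 t x)%:E)%E.
  have mk : measurable_fun setT (fun x => (v x `^ q * wkernel ring_bump 0 t x)%:E).
    by have /integrableP[] := integrable_ring_bump avq KD.
  apply: (@le_trans _ _ (\int[leb]_(x in C) (v x `^ q * wkernel ring_bump 0 t x)%:E)%E); last first.
    apply: ge0_subset_integral => // x _.
    by rewrite lee_fin mulr_ge0 ?wkernel_ring_bump_ge0.
  apply: ae_ge0_le_integral => //.
  - by move=> x _; rewrite lee_fin mulr_ge0 ?powR_ge0// mulr_ge0 ?expR_ge0.
  - by move=> x _; rewrite lee_fin mulr_ge0 ?wkernel_ring_bump_ge0.
  - exact: measurable_funTS.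
  - apply: filterS harnack => x /= hx Cx; rewrite lee_fin; apply: ler_pM.
    + exact: powR_ge0.
    + by rewrite mulr_ge0 ?expR_ge0.
    + apply: ge0_ler_powR; rewrite ?nnegrE ?(ltW q_gt0)//.
      rewrite (le_trans kapm)// hx//.
      by rewrite (le_trans (Cs x Cx))//; have := r20; lra.
    + by rewrite /wkernel ler_wpM2l ?expR_ge0// Cchi.
rewrite /wmean /Rintegral -lee_fin fineK; last exact: integrable_fin_num (integrable_ring_bump avq KD).
apply: le_trans kC; rewrite integral_cst//.
rewrite [X in (_ * X)%E](_ : _ = ((2 * (eta * r)) ^+ n)%:E); last first.
  by apply: lebesgue_rV_cube; rewrite mulr_ge0 ?ltW.
rewrite -EFinM lee_fin le_eqVlt; apply/orP; left; apply/eqP.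
have J0 : 0 <= expR (n%:R / 2 * t) * I by rewrite mulr_ge0 ?expR_ge0.
rewrite /kap; set J := expR (n%:R / 2 * t) * I.
rewrite powRM ?mulr_ge0 ?invr_ge0 ?expR_ge0 ?exprn_ge0// /c0 -/c1.
have := @expR_half_cube R n t; rewrite -/r => rn.
rewrite (mulrA 2) [(2 * eta * r) ^+ n]exprMn.
transitivity ((expR (-2) / 2 ^+ n.+2) `^ q * (c1 * (2 * eta) ^+ n) * J `^ q *
  (expR (n%:R / 2 * t) * r ^+ n)); last by ring.
by rewrite rn mulr1.
Qed.

Lemma wmean_cover (Y : seq 'rV[R]_n) :
  (forall x, 1 <= sqdist 0 x <= 4 -> exists2 y, y \in Y & sqdist y x < 1/40) ->
  (forall y, y \in Y -> 121/100 <= sqdist 0 y <= 361/100) ->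
  wmean v ring_bump 0 t <= \sum_(y <- Y) expR (n%:R / 2 * t) *
    (\int[leb]_(x in [set x | sqdist (r *: y) x <= r2 / 40%R]) v x)%R.
Proof.
move=> cov hY; have [mv v0 vi] := av.
pose B y := [set x | sqdist (r *: y) x <= r2 / 40].
have cB y : compact (B y) by exact: compact_sqdist_le.
have BD y : y \in Y -> B y `<=` D.
  by rewrite /B => yY x /= xr; apply: (ballD (hY _ yY)) => /=; have := r20; lra.
have iB y : y \in Y -> leb.-integrable setT (EFin \o (fun x => expR (n%:R / 2 * t) * (v \_ (B y)) x)).
  move=> yY; rewrite (_ : EFin \o _ = (fun x => (expR (n%:R / 2 * t))%:E * (EFin \o (v \_ (B y))) x)%E).
    by apply: integrableZl => //; exact: integrable_admissible av _ (BD _ yY).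
  by apply/funext => x; rewrite /= EFinM.
have [iS ES] := Rintegral_sum iB.
have -> : \sum_(y <- Y) expR (n%:R / 2 * t) * (\int[leb]_(x in B y) v x)%R =
  (\int[leb]_x (\sum_(y <- Y) expR (n%:R / 2 * t) * (v \_ (B y)) x))%R.
  rewrite ES big_seq [RHS]big_seq; apply: eq_bigr => y yY.
  rewrite [in LHS]Rintegral_mkcond -RintegralZl//.
  exact: integrable_admissible av _ (BD _ yY).
apply: le_Rintegral => //; first exact: integrable_ring_bump.
move=> x _ /=.
have rE : sqdist 0 (r^-1 *: x) = expR t * sqdist 0 x.
  by rewrite sqdist0Z exprVn rr /r2 expRN invrK.
have [xK|xK] := pselect (1 <= sqdist 0 (r^-1 *: x) <= 4); last first.
    rewrite /wkernel; have -> : ring_bump (expR t * sqdist 0 x) = 0.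
      rewrite -rE; have [h|h] := ltP (sqdist 0 (r^-1 *: x)) 1.
        by rewrite ring_bump_vanishing_lt// sqdist_ge0.
      rewrite ring_bump_vanishing_gt// ltNge; apply/negP => h'; apply: xK.
      by rewrite h.
    rewrite !mulr0; apply: sumr_ge0 => z _; rewrite mulr_ge0 ?expR_ge0// patchE.
    by case: ifPn => // _; exact: v0.
  have [y yY xy] := cov _ xK.
  have Bx : B y x.
    rewrite /B /= -[x](scalerKV (lt0r_neq0 r0)) sqdistZ rr mulrC.
    rewrite -ler_pdivlMr// mulrAC divff ?gt_eqF//; lra.
  rewrite (big_rem y)//= patchE mem_set// -[leLHS]addr0 lerD//.
    rewrite /wkernel mulrCA ler_wpM2l ?expR_ge0// -[leRHS]mulr1 ler_wpM2l//.
    exact: ring_bump_le1.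
  apply: sumr_ge0 => z _; rewrite mulr_ge0 ?expR_ge0// patchE; case: ifPn => // _; exact: v0.
Qed.

End one_scale.

(** The cover of the unit annulus is rescaled by [r], so [c] does not depend on [t]. Each ball mass
    is at most [A], the [q]-th root of [Vq / c0], and the mean over the annulus is at most the sum
    of the ball masses. *)
Lemma annulus_harnack : exists2 c, 0 < c & forall t : R,
  [set x | 0 < sqdist 0 x <= 10 * expR (- t)] `<=` D ->
  c * wmean v ring_bump 0 t `^ q <= wmean (fun x => v x `^ q) ring_bump 0 t.
Proof.
have [Y [hY cov]] := annulus_cover.
(* The added 1 gives positivity whatever the length of [Y]. *)
pose N : R := (size Y)%:R + 1.
have N0 : 0 < N by rewrite ltr_wpDl.
exists (c0 / N `^ q) => [|t tD]; first by rewrite divr_gt0// powR_gt0.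
set W := wmean v _ _ _; set Vq := wmean _ _ _ _.
have W0 : 0 <= W.
  apply: Rintegral_ge0 => x _; rewrite mulr_ge0 ?wkernel_ring_bump_ge0//.
  by have [_ + _] := av; apply.
have Vq0 : 0 <= Vq.
  by apply: Rintegral_ge0 => x _; rewrite mulr_ge0 ?wkernel_ring_bump_ge0// powR_ge0.
pose A := (Vq / c0) `^ q^-1.
have WA : W <= N * A.
  apply: (le_trans (wmean_cover tD cov hY)).
  apply: (@le_trans _ _ (\sum_(y <- Y) A)); last first.
    by rewrite big_const_seq count_predT iter_addr_0 -mulr_natl ler_wpM2r ?powR_ge0// lerDl.
  rewrite big_seq [leRHS]big_seq; apply: ler_sum => y yY.
  set J := expR _ * _.
  have J0 : 0 <= J.
    rewrite mulr_ge0 ?expR_ge0//; apply: Rintegral_ge0 => x _.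
    by have [_ + _] := av; apply.
  have := ball_mass_powR tD (hY y yY); rewrite -/J -/Vq => h.
  rewrite -[leLHS]powRr1// -(mulfV (lt0r_neq0 q_gt0)) powRrM ge0_ler_powR ?nnegrE ?powR_ge0//.
  - by rewrite invr_ge0 ltW.
  - by rewrite divr_ge0// ltW.
  - by rewrite ler_pdivlMr// mulrC.
have : W `^ q <= (N * A) `^ q.
  by rewrite ge0_ler_powR ?nnegrE ?(ltW q_gt0)// mulr_ge0 ?powR_ge0// ltW.
rewrite powRM ?powR_ge0 ?(ltW N0)// /A -powRrM mulVf ?gt_eqF// powRr1; last by rewrite divr_ge0// ltW.
move=> h; rewrite mulrAC ler_pdivrMr ?powR_gt0// mulrC -ler_pdivlMr//.
by rewrite (le_trans h)// mulrA (mulrC Vq).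
Qed.

End annulus_harnack.

(** * The differential inequality satisfied by the means *)
Section radial_inequality.
Context {R : realType} {n : nat}.
Local Notation leb := (lebesgue_rV n).
Implicit Types (x y z : 'rV[R]_n) (u v w f : 'rV[R]_n -> R) (D : set 'rV[R]_n).

Definition nlaplacian_ge D u f := forall phi, test_function D phi ->
  (forall x, 0 <= phi x) ->
  (\int[leb]_x (f x * phi x)%:E <= \int[leb]_x (u x * - laplacian phi x)%:E)%E.

Lemma nlaplacian_ge_superharmonic D u f : (forall x, 0 <= f x) ->
  nlaplacian_ge D u f -> superharmonic D u.
Proof.
move=> f0 uf phi tphi phi0; apply: fine_ge0; apply: le_trans (uf _ tphi phi0).
by apply: integral_ge0 => x _; rewrite lee_fin mulr_ge0.
Qed.

(** In the variable [t] the Laplacian carries a factor [1 / |x|^2]; using [s * chi s] as test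
    function cancels it. *)
Let mulid (chi : R -> R) (s : R) : R := s * chi s.

Let smooth1_mulid chi : smooth1 chi -> smooth1 (mulid chi).
Proof. by move=> sc; apply: smooth1M => //; exact: smooth1_id. Qed.

Let derive1M (f g : R -> R) : smooth1 f -> smooth1 g ->
  derive1 (fun s => f s * g s) = (fun s => derive1 f s * g s + f s * derive1 g s).
Proof.
move=> sf sg; apply: derive1_ext => s.
apply: (is_derive_eq (is_deriveM (smooth1_is_derive s sf) (smooth1_is_derive s sg))).
by rewrite /GRing.scale/= addrC [g s * _]mulrC.
Qed.

Let derive1D (f g : R -> R) : smooth1 f -> smooth1 g ->
  derive1 (fun s => f s + g s) = (fun s => derive1 f s + derive1 g s).
Proof.
move=> sf sg; apply: derive1_ext => s.
exact: is_deriveD (smooth1_is_derive s sf) (smooth1_is_derive s sg).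
Qed.

Let derive1_idE : derive1 (@id R) = cst 1.
Proof. by apply: derive1_ext => s; exact: is_derive_id. Qed.

Let derive1_cstE (c : R) : derive1 (cst c : R -> R) = cst 0.
Proof. by apply: derive1_ext => s; exact: is_derive_cst. Qed.

(* In the variable [t = - ln r^2] the radial Laplacian becomes
   [d^2/dt^2 - (n-2)/2 d/dt]; conjugation by the dilations turns [d/dt] into [euler]. *)
Lemma laplacian_euler chi (t : R) x : smooth1 chi ->
  laplacian (fun x => mulid chi (expR t * sqdist 0 x)) x = 4 * expR t *
  (@euler R n (@euler R n chi) (expR t * sqdist 0 x) -
   (n%:R - 2) / 2 * @euler R n chi (expR t * sqdist 0 x)).
Proof.
move=> sc; have sd := smooth1_derive sc; have si := @smooth1_id R.
rewrite laplacian_radial; last exact: smooth1_mulid.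
set s := expR t * sqdist 0 x.
have E1 : derive1 (mulid chi) = (fun s => chi s + s * derive1 chi s).
  rewrite /mulid (derive1M (f := id))//; apply/funext => z.
  by rewrite derive1_idE mul1r.
have E2 : derive1 (fun s => chi s + s * derive1 chi s) =
    (fun s => derive1 chi s + (derive1 chi s + s * derive1 (derive1 chi) s)).
  rewrite (derive1D (g := fun s => s * derive1 chi s)) ?(derive1M (f := id))//; last first.
    exact: smooth1M.
  by apply/funext => z; rewrite derive1_idE mul1r.
have E3 : derive1 (@euler R n chi) =
    (fun s => n%:R / 2 * derive1 chi s + (derive1 chi s + s * derive1 (derive1 chi) s)).
  rewrite /euler (derive1D (f := fun s => n%:R / 2 * chi s) (g := fun s => s * derive1 chi s)); last 2 first.
  - by apply: smooth1M => //; exact: smooth1_cst.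
  - exact: smooth1M.
  rewrite (derive1M (f := id))// (derive1M (f := cst (n%:R / 2)))//; last exact: smooth1_cst.
  by apply/funext => z; rewrite derive1_idE derive1_cstE /= mul0r add0r mul1r.
rewrite E1 E2 /euler -/(euler chi) E3 /euler; by field.
Qed.

Lemma ring_bump0 (s : R) : 0 <= s -> ~ (1 <= s <= 4) -> ring_bump s = 0.
Proof.
move=> s0 ns; have [s1|s1] := ltP s 1; first by rewrite ring_bump_vanishing_lt// s0.
by rewrite ring_bump_vanishing_gt// ltNge; apply/negP => s4; apply: ns; rewrite s1.
Qed.

Lemma annulus_scale (t : R) x :
  annulus 0 (expR (- t)) (4 * expR (- t)) x <-> 1 <= expR t * sqdist 0 x <= 4.
Proof.
rewrite /annulus /= expRN -div1r ler_pdivrMr ?expR_gt0//.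
by rewrite div1r ler_pdivlMr ?expR_gt0// (mulrC (sqdist _ _)).
Qed.

Lemma integrableMl_real (c : R) f : leb.-integrable setT (EFin \o f) ->
  leb.-integrable setT (EFin \o (fun x => c * f x)).
Proof.
move=> /(integrableZl measurableT c); by apply: eq_integrable.
Qed.

Section integrability.
Variables (D : set 'rV[R]_n) (u : 'rV[R]_n -> R) (t : R).
Hypotheses (au : admissible D u) (KD : annulus 0 (expR (- t)) (4 * expR (- t)) `<=` D).
Let k : R := (n%:R - 2) / 2.
Let E1 := @euler R n ring_bump.
Let E2 := @euler R n E1.
Let phi x := mulid ring_bump (expR t * sqdist 0 x).

Let sE1 : smooth1 E1. Proof. exact: smooth1_euler (@smooth1_ring_bump R). Qed.
Let sE2 : smooth1 E2. Proof. exact: smooth1_euler. Qed.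
Let gt1 := euler_vanishing_gt (n := n) (@ring_bump_vanishing_gt R).
Let lt1 := euler_vanishing_lt (n := n) (@ring_bump_vanishing_lt R).
Let gt2 := euler_vanishing_gt (n := n) gt1.
Let lt2 := euler_vanishing_lt (n := n) lt1.
Let KD' : annulus 0 (1 * expR (- t)) (4 * expR (- t)) `<=` D. Proof. by rewrite mul1r. Qed.

Lemma integrable_laplacian_ring_bump :
  leb.-integrable setT (EFin \o (fun x => u x * - laplacian phi x)).
Proof.
pose chi s := E2 s + (- k) * E1 s.
have schi : smooth1 chi.
  by apply: smooth1D => //; apply: smooth1M => //; exact: smooth1_cst.
have ichi : leb.-integrable setT (EFin \o (fun x => u x * wkernel chi 0 t x)).
  apply: (integrable_wkernel (s0 := 1) (s1 := 4) au) => //.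
  - exact: smooth1_continuous.
  - by move=> s s4; rewrite /chi /E2 /E1 gt1// gt2// mulr0 addr0.
  - by move=> s s4; rewrite /chi /E2 /E1 lt1// lt2// mulr0 addr0.
have -> : (fun x => u x * - laplacian phi x) =
    (fun x => - (4 * expR t) / expR (n%:R / 2 * t) * (u x * wkernel chi 0 t x)).
  apply/funext => x; rewrite laplacian_euler; last exact: smooth1_ring_bump.
  by rewrite /wkernel /chi -/E1 -/E2 -/k; field; rewrite gt_eqF// expR_gt0.
exact: integrableMl_real.
Qed.

Lemma wmean_laplacian : wmean u E2 0 t - k * wmean u E1 0 t =
  - (expR (n%:R / 2 * t) * expR (- t) / 4) * (\int[leb]_x (u x * - laplacian phi x))%R.
Proof.
have i1 := integrable_wkernel au (smooth1_continuous sE1) gt1 lt1 KD'.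
have i2 := integrable_wkernel au (smooth1_continuous sE2) gt2 lt2 KD'.
have i1k : leb.-integrable setT (EFin \o (fun x => k * (u x * wkernel E1 0 t x))).
  exact: integrableMl_real.
rewrite /wmean -RintegralZl// -RintegralB// -RintegralZl//; last exact: integrable_laplacian_ring_bump.
apply: eq_Rintegral => x _; rewrite laplacian_euler; last exact: smooth1_ring_bump.
rewrite /wkernel -/E1 -/E2 -/k expRN; field.
by rewrite gt_eqF ?expR_gt0.
Qed.

End integrability.

Lemma powR_ge_expR (s r : R) : 1 <= s <= 4 -> expR (- (`|r| * ln 4)) <= s `^ r.
Proof.
move=> /andP[s1 s4]; have s0 : 0 < s by lra.
rewrite /powR gt_eqF// ler_expR -mulNr.
have ls : 0 <= ln s <= ln 4 by rewrite ln_ge0// ler_ln ?posrE//; lra.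
have h : - `|r| <= r by rewrite lerNl -normrN ler_norm.
have := normr_ge0 r; case/andP: ls; nra.
Qed.

(** Test with [mulid ring_bump]. On its support |x|^2 is comparable to [expR (- t)], so the weight
    |x|^a contributes [expR (- (a / 2) * t)] and the Laplacian another [expR (- t)]. *)
Lemma radial_inequality D u w (lam a : R) : admissible D u -> admissible D w -> 0 < lam ->
  nlaplacian_ge D u (fun x => lam * enorm x `^ a * w x) ->
  exists2 c, 0 < c & forall t : R, annulus 0 (expR (- t)) (4 * expR (- t)) `<=` D ->
  wmean u (@euler R n (@euler R n ring_bump)) 0 t -
  (n%:R - 2) / 2 * wmean u (@euler R n ring_bump) 0 t <=
  - (c * expR (- ((a + 2) / 2) * t) * wmean w ring_bump 0 t).
Proof.
move=> au aw lam0 uw; have [mw w0 wi] := aw.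
(* A lower bound of [s * s^(a/2)] for [1 <= s <= 4], valid for either sign of [1 + a / 2]. *)
pose c2 : R := expR (- (`|1 + a / 2| * ln 4)).
have c20 : 0 < c2 by exact: expR_gt0.
exists (lam * c2 / 4) => [|t KD]; first by rewrite !mulr_gt0 ?invr_gt0.
rewrite (wmean_laplacian au KD).
pose phi x := mulid ring_bump (expR t * sqdist 0 x).
have phi0 x : 0 <= phi x.
  by rewrite mulr_ge0 ?ring_bump_ge0// mulr_ge0 ?expR_ge0 ?sqdist_ge0.
have sm := smooth1_mulid (@smooth1_ring_bump R).
have tphi : test_function D phi.
  apply: (test_function_radial (K := annulus 0 (expR (- t)) (4 * expR (- t))) sm) => //.
    exact: compact_annulus.
  move=> x; apply: contra_neqP => nK.
  by rewrite /mulid ring_bump0 ?mulr0 ?mulr_ge0 ?expR_ge0 ?sqdist_ge0// => /annulus_scale.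
have := uw _ tphi phi0.
have : ((c2 * lam * expR (- (a / 2) * t) / expR (n%:R / 2 * t) * wmean w ring_bump 0 t)%:E <=
    \int[leb]_x (lam * enorm x `^ a * w x * phi x)%:E)%E.
  have iw := integrable_ring_bump aw KD.
  rewrite /wmean -RintegralZl// /Rintegral fineK; last first.
    by apply: integrable_fin_num => //; exact: integrableMl_real iw.
  apply: ge0_le_integral => //.
  - move=> x _; rewrite lee_fin; apply: mulr_ge0; last by apply: mulr_ge0 => //; exact: wkernel_ring_bump_ge0.
    by rewrite divr_ge0 ?expR_ge0// mulr_ge0 ?expR_ge0// mulr_ge0// ltW.
  - apply/measurable_EFinP; apply: measurable_funM => //.
    have /integrableP[/measurable_EFinP] := iw; exact.
  - apply/measurable_EFinP; apply: measurable_funM; last first.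
      apply: continuous_measurable_fun_rV => x.
      have c1 : {for x, continuous (fun x => expR t * sqdist 0 x)}.
        by apply: continuousM; [exact: cst_continuous|exact: continuous_sqdist].
      by apply: (continuous_comp c1); exact: smooth1_continuous sm _.
    apply: measurable_funM => //; apply: measurable_funM => //.
    apply: (measurableT_comp (measurable_powR a)).
    apply: continuous_measurable_fun_rV => x.
    rewrite (_ : enorm = Num.sqrt \o sqdist 0); last by apply/funext => z; rewrite sqdist0E.
    by apply: (continuous_comp (@continuous_sqdist _ _ 0 x)); exact: sqrt_continuous.
  - move=> x _; rewrite lee_fin /phi /mulid /wkernel.
    set s := expR t * sqdist 0 x.
    have [s1|s1] := pselect (1 <= s <= 4); last first.
      by rewrite ring_bump0 ?mulr0 ?mulr_ge0 ?expR_ge0 ?sqdist_ge0.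
    have s0 : 0 < s by case/andP: s1 => ? _; lra.
    have -> : enorm x `^ a = s `^ (a / 2) * expR (- (a / 2) * t).
      have -> : enorm x = (s * expR (- t)) `^ 2^-1.
        rewrite powR12_sqrt ?mulr_ge0 ?expR_ge0 ?sqdist_ge0// sqdist0E /s.
        by rewrite mulrAC -expRD subrr expR0 mul1r.
      rewrite -powRrM powRM ?expR_ge0 ?(ltW s0)// (mulrC 2^-1); congr (_ * _).
      by rewrite {1}/powR gt_eqF ?expR_gt0// expRK mulrN mulNr.
    have := powR_ge_expR (1 + a / 2) s1; rewrite powRD; last by apply/implyP => _; rewrite gt_eqF.
    rewrite powRr1 ?(ltW s0)// -/c2 => h.
    rewrite (_ : _ * (w x * _) = (lam * w x * expR (- (a / 2) * t) * ring_bump s) * c2); last first.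
      by field; rewrite gt_eqF// expR_gt0.
    rewrite [leRHS](_ : _ = (lam * w x * expR (- (a / 2) * t) * ring_bump s) * (s * s `^ (a / 2))); last by ring.
    by rewrite ler_wpM2l// mulr_ge0 ?ring_bump_ge0// mulr_ge0 ?expR_ge0// mulr_ge0// ltW.
move=> h1 h2; have {h1 h2} := le_trans h1 h2.
rewrite -[leRHS]fineK; last exact: integrable_fin_num (integrable_laplacian_ring_bump au KD).
rewrite lee_fin -/(Rintegral _ _ _) -/phi; set I := Rintegral _ _ _; set W := wmean _ _ _ _ => h.
rewrite mulNr lerN2.
pose e := expR (n%:R / 2 * t) * expR (- t) / 4; have e0 : 0 < e.
  by rewrite !mulr_gt0 ?invr_gt0 ?expR_gt0.
have := ler_wpM2l (ltW e0) h; rewrite -/e; apply: le_trans.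
rewrite le_eqVlt; apply/orP; left; apply/eqP; rewrite /e.
have -> : - ((a + 2) / 2) * t = - (a / 2) * t + - t by field.
by rewrite (expRD (- (a / 2) * t)); field; rewrite gt_eqF// expR_gt0.
Qed.

End radial_inequality.

(** * Propagation of vanishing *)
Section unique_continuation.
Context {R : realType} {n : nat}.
Local Notation leb := (lebesgue_rV n).
Implicit Types (x y z : 'rV[R]_n) (u v w f : 'rV[R]_n -> R) (D : set 'rV[R]_n).

(** A vanishing mean forces [u = 0] almost everywhere on its annulus. The annuli at the scales
    [t0 + 1 + k] overlap because [e < 4], so countably many of them cover the punctured ball. *)
Lemma vanishing_near0 D u (t0 : R) : admissible D u -> u 0 = 0 ->
  [set x | 0 < sqdist 0 x <= 10 * expR (- t0)] `<=` D ->
  (forall t, t0 < t -> wmean u ring_bump 0 t = 0) ->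
  {ae leb, forall x, sqdist 0 x < expR (- (t0 + 1)) -> u x = 0}.
Proof.
move=> au u00 t0D W0; have [mu u0 _] := au.
have KD (t : R) : t0 < t -> annulus 0 (expR (- t)) (4 * expR (- t)) `<=` D.
  move=> t0t x /andP[h1 h2]; apply: t0D; rewrite /= (lt_le_trans _ h1) ?expR_gt0//=.
  have : expR (- t) <= expR (- t0) by rewrite ler_expR lerN2 ltW.
  have := expR_gt0 (- t); lra.
have step (k : nat) : {ae leb, forall x,
    expR (- (t0 + 1 + k%:R)) < sqdist 0 x < 4 * expR (- (t0 + 1 + k%:R)) -> u x = 0}.
  set t := t0 + 1 + k%:R.
  have t0t : t0 < t by rewrite /t -addrA ltrDl ltr_pwDl.
  have iwt := integrable_ring_bump au (KD t t0t); have /integrableP[mw _] := iwt.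
  have : (\int[leb]_x `|(u x * wkernel ring_bump 0 t x)%:E| = 0)%E.
    rewrite (eq_integral (EFin \o (fun x => u x * wkernel ring_bump 0 t x))) => [|x _].
      by rewrite -[LHS]fineK ?integrable_fin_num//; congr EFin; exact: W0.
    by rewrite /= ger0_norm// mulr_ge0 ?wkernel_ring_bump_ge0.
  move=> /(ae_eq_integral_abs leb measurableT mw); apply: filterS => x /= h /andP[x1 x4].
  have := h I; move=> [] /eqP; rewrite mulf_eq0 => /orP[/eqP//|/eqP wx].
  have : 0 < wkernel ring_bump 0 t x.
    rewrite mulr_gt0 ?expR_gt0// ring_bump_gt0//.
    rewrite -ltr_pdivrMl ?expR_gt0// mulr1 -expRN x1/=.
    by rewrite -ltr_pdivlMl ?expR_gt0// mulrC -expRN.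
  by rewrite wx ltxx.
have := ae_foralln step; apply: filterS => x /= h xt.
have [->//|x0] := eqVneq x 0.
have Q0 : 0 < sqdist 0 x by exact: sqdist_gt0.
pose s := - ln (sqdist 0 x).
have QE : sqdist 0 x = expR (- s) by rewrite /s opprK lnK.
have ts : t0 + 1 < s by rewrite -ltrN2 -ltr_expR -QE.
have [k /andP[h1 h2]] : exists k : nat, k%:R <= s - (t0 + 1) < k.+1%:R.
  by exists (Num.trunc (s - (t0 + 1))); apply: truncn_itv; rewrite subr_ge0 ltW.
(* The index [k.+1] gives the strict inner inequality, and the outer one then loses a factor
   [e < 4]. *)
apply: (h k.+1); rewrite QE.
have e1 : expR 1 < 4 :> R.
  have -> : 1 = 4%:R * 4^-1 :> R by rewrite mulfV.
  rewrite expRM_natl; set e := expR _; have e0 : 0 < e by exact: expR_gt0.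
  have e43 : e <= 4 / 3.
    by have := expR_ge1Dx (- 4^-1 : R); have := expRxMexpNx_1 (4^-1 : R); rewrite -/e; nra.
  apply: (@le_lt_trans _ _ ((4 / 3) ^+ 4)); last by lra.
  by rewrite lerXn2r ?nnegrE// ltW.
apply/andP; split; first by rewrite ltr_expR ltrN2; lra.
apply: le_lt_trans (_ : _ <= expR 1 * expR (- (t0 + 1 + k.+1%:R))) _; last first.
  by rewrite ltr_pM2r ?expR_gt0.
by rewrite -expRD ler_expR -natr1; lra.
Qed.

Definition vanishes_near u x :=
  exists2 e : R, 0 < e & {ae leb, forall z, sqdist x z < e -> u z = 0}.

Lemma open_vanishes_near u : open [set x | vanishes_near u x].
Proof.
rewrite openE => x [e e0 ue].
have : nbhs x [set y | sqdist x y < e / 4].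
  apply: open_nbhs_nbhs; split; first exact: open_sqdist_lt.
  by rewrite /= sqdistxx divr_gt0.
apply: filterS => y /= xy; exists (e / 4); first by rewrite divr_gt0.
apply: filterS ue => z uz yz; apply: uz; have := sqdist_triangle y x z; lra.
Qed.

Lemma open_sqdist_ball (A : set 'rV[R]_n) x : open A -> A x ->
  exists2 e, 0 < e & [set y | sqdist x y <= e] `<=` A.
Proof.
move=> oA Ax; have [e e0 eA] := open_normP oA Ax.
exists ((e / 2) ^+ 2); first by rewrite exprn_gt0// divr_gt0.
move=> y /= xy; apply: eA; rewrite distrC (le_lt_trans (norm_sqdist _ xy))//.
  by rewrite divr_ge0// ltW.
by rewrite ltr_pdivrMr// ltr_pMr// ltr1n.
Qed.

(** If the set where [u > 0] had positive measure, it would contain a compact set of positive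
    measure; finitely many balls of vanishing cover that set, so it is negligible. *)
Lemma ae_zero_of_local u (A : set 'rV[R]_n) (M : R) : measurable A -> (forall x, A x -> `|x| <= M) ->
  measurable_fun setT u -> (forall x, 0 <= u x) -> (forall x, A x -> vanishes_near u x) ->
  {ae leb, forall x, A x -> u x = 0}.
Proof.
move=> mA AM mu u0 uA.
pose E := A `&` [set x | 0 < u x].
have mE : measurable E.
  apply: measurableI => //; rewrite -[X in measurable X]setTI.
  rewrite (_ : [set x | 0 < u x] = u @^-1` `]0, +oo[); last first.
    by apply/seteqP; split => x; rewrite /= in_itv/= andbT.
  by apply: mu => //; exact: measurable_itv.
suff E0 : leb E = 0%E.
  exists E; split => // x /= h; have [Ax nux] : A x /\ ~ (u x = 0).
    by apply: contrapT => h2; apply: h => Ax; apply: contrapT => h3; apply: h2.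
  by split => //=; rewrite lt0r u0 andbT; exact/eqP.
apply/eqP; rewrite eq_le measure_ge0 andbT leNgt; apply/negP => E0.
have EM x : E x -> `|x| <= M by move=> [/AM].
have [F [cF FE F0]] := rV_inner_regular mE EM E0.
have /choice[r rP] : forall x, exists e : R, A x -> 0 < e /\ {ae leb, forall z, sqdist x z < e -> u z = 0}.
  move=> x; have [Ax|nAx] := pselect (A x); last by exists 0.
  by have [e e0 ue] := uA _ Ax; exists e.
have FA x : F x -> A x by move=> /FE[].
have := cF; rewrite compact_cover => /(_ _ F (fun x => [set z | sqdist x z < r x])).
case.
- by move=> x _; exact: open_sqdist_lt.
- by move=> x Fx; exists x => //=; rewrite sqdistxx; have [] := rP x (FA _ Fx).
move=> s sF cov.
have : {ae leb, forall z, forall x, x \in finmap.enum_fset s -> sqdist x z < r x -> u z = 0}.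
  have : forall x, x \in finmap.enum_fset s -> F x by move=> x /sF; rewrite inE.
  elim: (finmap.enum_fset s) => [|x l IH] hl; first by apply: aeW.
  have h1 : {ae leb, forall z, sqdist x z < r x -> u z = 0}.
    by have [] := rP x (FA _ (hl x (mem_head _ _))).
  have h2 := IH (fun y yl => hl y (mem_behead (s := x :: l) yl)).
  apply: filterS2 h1 h2 => z h1 h2 y; rewrite inE => /predU1P[->//|]; exact: h2.
move=> ae0; have : leb.-negligible F.
  apply: negligibleS ae0 => z Fz /= h.
  have [x /= xs xz] := cov z Fz.
  have := (FE z Fz).2; rewrite /= (h x)// ?ltxx//.
move=> /(negligibleP _ (compact_measurable_rV cF)) F00.
by move: F0; rewrite F00 ltxx.
Qed.

Variable Omega : set 'rV[R]_n.
Hypotheses (Omega_open : open Omega) (Omega_connected : connected Omega) (Omega_0 : Omega 0).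
Local Notation D := (Omega `\ 0).

(** The points of vanishing form a relatively open and closed subset of [Omega]. Closedness at [x]
    comes from [zero_propagation] in a ball centred at a nearby point of vanishing and large enough
    to reach [x]; the origin, where no ball lies in [D], is covered by hypothesis. *)
Lemma unique_continuation u : admissible D u -> superharmonic D u -> vanishes_near u 0 ->
  forall x, Omega x -> vanishes_near u x.
Proof.
move=> au su u0.
suff <- : Omega `&` [set x | vanishes_near u x] = Omega by move=> x [].
apply: Omega_connected.
- by exists 0.
- by exists [set x | vanishes_near u x] => //; exact: open_vanishes_near.
exists (closure [set x | vanishes_near u x]); first exact: closed_closure.
apply/seteqP; split => x [Ox Zx]; split => //; first exact: subset_closure.
have [->//|x0] := eqVneq x 0.
have Dx : D x by split => //=; exact/eqP.
have [e e0 eD] := open_sqdist_ball (open_punctured Omega_open) Dx.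
have : nbhs x [set y | sqdist x y < e / 16].
  apply: open_nbhs_nbhs; split; first exact: open_sqdist_lt.
  by rewrite /= sqdistxx divr_gt0.
(* Squared radii: the ball [e / 4] around [z] lies in [D] since [2/16 + 2/4 < 1], and the ball
   [e / 5] around [z] contains the ball [e / 32] around [x] since [2/16 + 2/32 < 1/5]. *)
move=> /Zx[z [/= [d d0 ud] xz]].
have e4 : expR (- (- ln (e / 4))) = e / 4 by rewrite opprK lnK// posrE divr_gt0.
have e5 : expR (- (- ln (e / 5))) = e / 5 by rewrite opprK lnK// posrE divr_gt0.
have := @zero_propagation R n D u au su z (- ln (e / 4)) (- ln (e / 5)) d.
rewrite e4 e5 => /(_ _ _ d0 ud) zp.
exists (e / 32); first by rewrite divr_gt0.
have {}zp : {ae leb, forall x, sqdist z x < e / 5 -> u x = 0}.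
  apply: zp => [y /= zy|].
    by apply: eD => /=; have := sqdist_triangle z x y; lra.
  rewrite ltrN2 ltr_ln ?posrE ?divr_gt0//; lra.
apply: filterS zp => y uy xy; apply: uy.
have := sqdist_triangle x z y; rewrite (sqdistC z x); lra.
Qed.

End unique_continuation.

(** * Nonexistence outside the three cases *)

Section nonexistence.
Context {R : realType} {n : nat}.
Local Notation leb := (lebesgue_rV n).
Variables (Omega : set 'rV[R]_n) (p a : R).
Hypotheses (n_ge3 : (3 <= n)%N) (Omega_open : open Omega)
    (Omega_connected : connected Omega) (Omega_bounded : bounded_set Omega)
    (Omega_0 : Omega 0) (p_gt1 : 1 < p).
Local Notation D := (Omega `\ 0).

Let mD : measurable D.
Proof. by apply: open_measurable_rV; exact: open_punctured. Qed.

Lemma admissible_patch (f : 'rV[R]_n -> R) : (forall x, D x -> 0 <= f x) ->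
  locally_integrable_rV D f -> admissible D (f \_ D).
Proof.
move=> f0 [mf _ fi]; split.
- exact/(measurable_restrictT _ mD).
- by move=> x; rewrite patchE; case: ifPn => //; rewrite inE; exact: f0.
- move=> K cK KD; apply: le_lt_trans (fi K KD cK).
  rewrite (eq_integral (fun x => `|f x|%:E))// => x; rewrite inE => /KD Dx.
  by rewrite patchE mem_set// ger0_norm// f0.
Qed.

Lemma powR_patch (f : 'rV[R]_n -> R) :
  (fun x => (f \_ D) x `^ (p - 1)) = (fun x => f x `^ (p - 1)) \_ D.
Proof.
apply/funext => x; rewrite !patchE; case: ifPn => // _.
by rewrite powR0// subr_eq0 gt_eqF.
Qed.

Lemma nlaplacian_ge_patch (u v : 'rV[R]_n -> R) (lam : R) :
  distr_nlaplacian_ge D u (fun x => lam * enorm x `^ a * v x `^ (p - 1)) ->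
  nlaplacian_ge D (u \_ D) (fun x => lam * enorm x `^ a * (v \_ D) x `^ (p - 1)).
Proof.
move=> h phi tphi phi0; have := h phi tphi phi0.
rewrite !(integral_mkcond D) => h'; apply: le_trans (le_trans _ h') _.
- rewrite le_eqVlt; apply/orP; left; apply/eqP; apply: eq_integral => x _.
  rewrite !patchE; case: ifPn => // _.
  by rewrite powR0 ?mulr0 ?mul0r// subr_eq0 gt_eqF.
- rewrite le_eqVlt; apply/orP; left; apply/eqP; apply: eq_integral => x _.
  by rewrite !patchE; case: ifPn => // _; rewrite mul0r.
Qed.

(** Valid for concave and convex powers alike: the midpoint is at most the larger of [s] and [t]. *)
Lemma powR_mean_le (s t q : R) : 0 <= s -> 0 <= t -> 0 < q ->
  2^-1 `^ q * (s + t) `^ q <= s `^ q + t `^ q.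
Proof.
move=> s0 t0 q0; wlog st : s t s0 t0 / s <= t => [hw|].
  have [/hw|/ltW /hw] := leP s t; first exact.
  by rewrite (addrC s) (addrC (s `^ q)); exact.
rewrite -powRM ?addr_ge0//; apply: (@le_trans _ _ (t `^ q)); last by rewrite lerDr powR_ge0.
apply: ge0_ler_powR; rewrite ?nnegrE ?(ltW q0)//; last by lra.
by rewrite mulr_ge0// addr_ge0.
Qed.

Lemma nonexistence (u v : 'rV[R]_n -> R) : distr_solution Omega p a u v ->
  [\/ 2 < p /\ - 2 < a,
      p = 2 /\ - 2 <= a |
      [/\ 1 < p < 2, - n%:R < a & p < critical_exponent n a]].
Proof.
move=> [[u0 v0] ntriv [lu lv] [luq lvq] [lam1 [lam2 [lam1_gt0 lam2_gt0 hu hv]]]].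
apply: contrapT => ncond; apply: ntriv.
have n3 : 3 <= n%:R :> R by rewrite ler_nat.
pose q := p - 1; have q0 : 0 < q by rewrite subr_gt0.
pose k : R := (n%:R - 2) / 2; pose b := (a + 2) / 2.
have k0 : 0 < k by rewrite divr_gt0//; lra.
have cond : [\/ b <= 0 /\ 1 < q, b < 0 /\ q = 1 | q < 1 /\ b + k * (1 - q) <= 0].
  have [p2|p2|p2] := ltgtP p 2.
  - apply: Or33; split; first by rewrite /q; lra.
    rewrite leNgt; apply/negP => h; apply: ncond; apply: Or33.
    have pc : p < critical_exponent n a.
      rewrite /critical_exponent ltr_pdivlMr; last by lra.
      by move: h; rewrite /b /k /q; lra.
    split => //; first by rewrite p_gt1.
    (* From [1 < p < p_a] one gets [n - 2 < 2 (n - 1) + a], that is, [- n < a]. *)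
    move: pc; rewrite /critical_exponent ltr_pdivlMr; last by lra.
    have := p_gt1; nra.
  - apply: Or31; split; last by rewrite /q; lra.
    rewrite leNgt; apply/negP => h; apply: ncond; apply: Or31; split => //.
    by move: h; rewrite /b; lra.
  - apply: Or32; split; last by rewrite /q; lra.
    rewrite ltNge; apply/negP => h; apply: ncond; apply: Or32; split => //.
    by move: h; rewrite /b; lra.
pose U := u \_ D; pose V := v \_ D.
have aU : admissible D U by exact: admissible_patch.
have aV : admissible D V by exact: admissible_patch.
have aUq : admissible D (fun x => U x `^ q).
  by rewrite powR_patch; apply: admissible_patch => // x _; exact: powR_ge0.
have aVq : admissible D (fun x => V x `^ q).
  by rewrite powR_patch; apply: admissible_patch => // x _; exact: powR_ge0.
have hU := nlaplacian_ge_patch hu; have hV := nlaplacian_ge_patch hv.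
have sU : superharmonic D U.
  apply: nlaplacian_ge_superharmonic hU => x.
  by rewrite !mulr_ge0 ?powR_ge0// ltW.
have sV : superharmonic D V.
  apply: nlaplacian_ge_superharmonic hV => x.
  by rewrite !mulr_ge0 ?powR_ge0// ltW.
have [r r0 rO] := open_sqdist_ball Omega_open Omega_0.
(* Makes [10 * expR (- t) <= r] for [t >= t0], as the Harnack inequality on annuli requires. *)
pose t0 := - ln (r / 10).
have t0E : expR (- t0) = r / 10 by rewrite opprK lnK// posrE divr_gt0.
have tD (t : R) : t0 <= t -> [set x | 0 < sqdist 0 x <= 10 * expR (- t)] `<=` D.
  move=> tt x /andP[x0 xr]; split.
    apply: rO => /=; have : expR (- t) <= expR (- t0) by rewrite ler_expR lerN2.
    rewrite t0E; lra.
  by move=> /= xE; move: x0; rewrite xE sqdistxx ltxx.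
have KD (t1 t : R) : t0 <= t -> annulus 0 (1 * expR (- t1)) (4 * expR (- t)) `<=` D.
  move=> tt x /andP[h1 h2]; apply: (tD t tt) => /=.
  rewrite mul1r in h1; rewrite (lt_le_trans _ h1) ?expR_gt0//=.
  by have := expR_gt0 (- t); lra.
have [c1 c1_gt0 H1] := annulus_harnack aU sU q0 aUq.
have [c2 c2_gt0 H2] := annulus_harnack aV sV q0 aVq.
have [d1 d1_gt0 I1] := radial_inequality aU aVq lam1_gt0 hU.
have [d2 d2_gt0 I2] := radial_inequality aV aUq lam2_gt0 hV.
pose W (f : 'rV[R]_n -> R) := wmean f ring_bump 0.
pose W1 (f : 'rV[R]_n -> R) := wmean f (@euler R n ring_bump) 0.
pose W2 (f : 'rV[R]_n -> R) := wmean f (@euler R n (@euler R n ring_bump)) 0.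
have srb := @smooth1_ring_bump R.
have dwmean chi f (t : R) : smooth1 chi -> (forall s, 4 < s -> chi s = 0) ->
    (forall s, 0 <= s < 1 -> chi s = 0) -> admissible D f -> t0 < t ->
    is_derive t 1 (wmean f chi 0) (wmean f (@euler R n chi) 0 t).
  move=> schi chi4 chi1 af tt.
  have tt1 : t0 < t < t + 1 by rewrite tt/= ltrDl.
  have h4 : 0 <= 4 :> R by [].
  have K1 := KD (t + 1) t0 (lexx _).
  exact: (is_derive_wmean af ler01 h4 schi chi4 chi1 K1 tt1).
have dW f (t : R) : admissible D f -> t0 < t -> is_derive t 1 (W f) (W1 f t).
  apply: dwmean => //; [exact: ring_bump_vanishing_gt|exact: ring_bump_vanishing_lt].
have dW1 f (t : R) : admissible D f -> t0 < t -> is_derive t 1 (W1 f) (W2 f t).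
  apply: dwmean; first exact: smooth1_euler.
  - exact: euler_vanishing_gt (@ring_bump_vanishing_gt R).
  - exact: euler_vanishing_lt (@ring_bump_vanishing_lt R).
have W_ge0 f t : admissible D f -> 0 <= W f t.
  move=> [_ f0 _]; apply: Rintegral_ge0 => x _.
  by rewrite mulr_ge0 ?wkernel_ring_bump_ge0.
(* The indices cross because the inequality for [U] has the mean of [V^q] as its source, which is
   bounded below by the Harnack constant of [V], and conversely. *)
pose m := Num.min (d1 * c2) (d2 * c1).
have m0 : 0 < m by rewrite lt_min !mulr_gt0.
have ode t : t0 < t -> W2 U t + W2 V t - k * (W1 U t + W1 V t) <=
    - (m * 2^-1 `^ q * expR (- b * t) * (W U t + W V t) `^ q).
  move=> tt.
  have KDt : annulus 0 (expR (- t)) (4 * expR (- t)) `<=` D.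
    by have := KD t t (ltW tt); rewrite mul1r.
  have := I1 t KDt; have := I2 t KDt; have := H1 t (tD t (ltW tt)); have := H2 t (tD t (ltW tt)).
  rewrite -/(W U t) -/(W V t) -/(W1 U t) -/(W1 V t) -/(W2 U t) -/(W2 V t) -/k -/b.
  have := powR_mean_le (W_ge0 U t aU) (W_ge0 V t aV) q0.
  set e := expR _; have e0 : 0 < e by exact: expR_gt0.
  rewrite -/e; set X := wmean (fun x => V x `^ q) _ _ _; set Y := wmean (fun x => U x `^ q) _ _ _.
  move=> h0 h2 h1 i2 i1.
  apply: (@le_trans _ _ (- (d1 * e * X) - d2 * e * Y)); first by lra.
  rewrite -opprD lerN2 -mulrA (mulrC e) mulrA -(mulrA m).
  have h3 : m * (W U t `^ q + W V t `^ q) <= d2 * Y + d1 * X.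
    rewrite mulrDr; apply: lerD.
      apply: (@le_trans _ _ (d2 * c1 * W U t `^ q)).
        by rewrite ler_wpM2r ?powR_ge0// ge_min lexx orbT.
      by rewrite -mulrA ler_wpM2l// ltW.
    apply: (@le_trans _ _ (d1 * c2 * W V t `^ q)).
      by rewrite ler_wpM2r ?powR_ge0// ge_min lexx.
    by rewrite -mulrA ler_wpM2l// ltW.
  have h4 := le_trans (ler_wpM2l (ltW m0) h0) h3.
  apply: le_trans (ler_wpM2r (ltW e0) h4) _.
  by rewrite le_eqVlt; apply/orP; left; apply/eqP; ring.
have S0 t : t0 < t -> W U t + W V t = 0.
  have dS s : t0 < s -> is_derive s 1 (fun t => W U t + W V t) (W1 U s + W1 V s).
    by move=> ss; exact: is_deriveD (dW U s aU ss) (dW V s aV ss).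
  have dS1 s : t0 < s -> is_derive s 1 (fun t => W1 U t + W1 V t) (W2 U s + W2 V s).
    by move=> ss; exact: is_deriveD (dW1 U s aU ss) (dW1 V s aV ss).
  have m1 : 0 < m * 2^-1 `^ q by rewrite mulr_gt0// powR_gt0.
  have S_ge0 s : t0 < s -> 0 <= W U s + W V s.
    by move=> _; apply: addr_ge0; exact: W_ge0.
  exact: (radial_mean_blowup dS dS1 k0 q0 m1 S_ge0 ode cond).
have WU t : t0 < t -> W U t = 0.
  by move=> tt; have := S0 t tt; have := W_ge0 U t aU; have := W_ge0 V t aV; lra.
have WV t : t0 < t -> W V t = 0.
  by move=> tt; have := S0 t tt; have := W_ge0 U t aU; have := W_ge0 V t aV; lra.
have U00 : U 0 = 0 by rewrite /U patchE memNset// => -[_ /(_ erefl)].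
have V00 : V 0 = 0 by rewrite /V patchE memNset// => -[_ /(_ erefl)].
have nU : vanishes_near U 0.
  by exists (expR (- (t0 + 1))); [exact: expR_gt0|exact: vanishing_near0 aU U00 (tD t0 (lexx _)) WU].
have nV : vanishes_near V 0.
  by exists (expR (- (t0 + 1))); [exact: expR_gt0|exact: vanishing_near0 aV V00 (tD t0 (lexx _)) WV].
have [M OM] : exists M, forall x, D x -> `|x| <= M.
  have [M [_ /(_ (M + 1))]] := Omega_bounded; rewrite ltrDl ltr01 => /(_ erefl) OM.
  by exists (M + 1) => x [/OM].
split.
- have [mU U0 _] := aU.
  have := ae_zero_of_local mD OM mU U0 (fun x Dx => unique_continuation Omega_open Omega_connected Omega_0 aU sU nU Dx.1).
  by apply: filterS => x /= h Dx; have := h Dx; rewrite /U patchE mem_set.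
- have [mV V0 _] := aV.
  have := ae_zero_of_local mD OM mV V0 (fun x Dx => unique_continuation Omega_open Omega_connected Omega_0 aV sV nV Dx.1).
  by apply: filterS => x /= h Dx; have := h Dx; rewrite /V patchE mem_set.
Qed.

End nonexistence.

Theorem corollary1p3 (R : realType) (n : nat) (Omega : set 'rV[R]_n) (p a : R)
    (n_ge3 : (3 <= n)%N) (Omega_open : open Omega)
    (Omega_connected : connected Omega) (Omega_bounded : bounded_set Omega)
    (Omega_0 : Omega 0) (p_gt1 : 1 < p) :
  (exists u v : 'rV[R]_n -> R, distr_solution Omega p a u v) <->
  [\/ 2 < p /\ - 2 < a,
      p = 2 /\ - 2 <= a |
      [/\ 1 < p < 2, - n%:R < a & p < critical_exponent n a]].
Proof.
split=> [[u [v]]|cond]; first exact: nonexistence.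
have [M [_ /(_ (M + 1))]] := Omega_bounded; rewrite ltrDl ltr01 => /(_ erefl) OM.
have n_gt0 : (0 < n)%N by exact: leq_trans n_ge3.
(* The sup-norm bound [M + 1] on [Omega] becomes [n * (M + 1)^2] for the squared Euclidean norm; the
   added 1 ensures [1 <= rho]. *)
apply: (@solution_exists R n Omega p a n_gt0 Omega_open Omega_0 (n%:R * (M + 1) ^+ 2 + 1)) => //.
  move=> x Ox; apply: (le_trans (sqdist_norm _ _)); rewrite subr0 ler_wpDr//.
  rewrite ler_wpM2l// lerXn2r ?nnegrE//; last exact: OM.
  exact: le_trans (OM _ Ox).
by rewrite lerDr mulr_ge0// sqr_ge0.
Qed.
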